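(* Let $E$ be a finite field of odd cardinality. Then $4$-dimensional quadratic forms over $E(X)$ satisfy the local-global principle for isotropy with respect to $\Omega_{E(X)/E}$; that is, every anisotropic $4$-dimensional quadratic form over $E(X)$ remains anisotropic over the completion $E(X)_v$ for some $v\in\Omega_{E(X)/E}$.
   Context: $E(X)$ is the rational function field in one variable over $E$. $\Omega_{E(X)/E}$ is the set of all valuations $v$ on $E(X)$ with value group $\mathbb{Z}$ such that $v(E^\times)=0$; $E(X)_v$ is the completion of $E(X)$ with respect to $v$. Quadratic forms are always regular (nondegenerate); a form is isotropic if it has a nontrivial zero, and anisotropic otherwise. *)

(* Defs.v *)
From HB Require Import structures.
From mathcomp Require Import all_boot all_order all_algebra.
From mathcomp Require Import generic_quotient ring_quotient.
From mathcomp Require Import boolp classical_sets functions.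
From mathcomp Require Import ring.
Set Implicit Arguments.
Unset Strict Implicit.
Unset Printing Implicit Defensive.
Import Order.TTheory GRing.Theory Num.Theory.
Local Open Scope ring_scope.

(** Valuations with value group Z. The convention [v 0 = +oo] is implicit: the
    integer [dval v 0] is a meaningless default that nothing below depends on. *)
Record discrete_valuation (F : fieldType) := DiscreteValuation {
  dval :> F -> int;
  dvalM : forall x y, x != 0 -> y != 0 -> dval (x * y) = dval x + dval y;
  dvalD : forall x y, x != 0 -> y != 0 -> x + y != 0 ->
    Num.min (dval x) (dval y) <= dval (x + y);
  dval_surj : forall n : int, exists2 x, x != 0 & dval x = n
}.

(** Omega_{E(X)/E}, for E(X) := {fraction {poly E}}. *)
Definition Omega (E : fieldType)
    (v : discrete_valuation {fraction {poly E}}) : Prop :=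
  forall c : E, c != 0 -> v (tofrac c%:P) = 0.

Section Completion.
Variables (F : fieldType) (v : discrete_valuation F).
Implicit Types (x y : F) (N : int) (s t : nat -> F).

(** [v x >= N], with [v 0 = +oo] *)
Definition dval_ge N x : bool := (x == 0) || (N <= v x).

Definition cauchy_seq s : Prop :=
  forall N, exists k, forall m n, (k <= m)%N -> (k <= n)%N ->
    dval_ge N (s m - s n).

Definition null_seq s : Prop :=
  forall N, exists k, forall n, (k <= n)%N -> dval_ge N (s n).

Lemma dval1 : v 1 = 0.
Proof.
have := dvalM v (oner_neq0 F) (oner_neq0 F); rewrite mulr1 => h.
by apply: (addrI (v 1)); rewrite addr0 -h.
Qed.

Lemma dvalN x : v (- x) = v x.
Proof.
have [->|x0] := eqVneq x 0; first by rewrite oppr0.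
have n0 : (-1 : F) != 0 by rewrite oppr_eq0 oner_neq0.
have h : v (-1) = 0.
  have := dvalM v n0 n0; rewrite mulrNN mulr1 dval1 => /esym/eqP.
  by rewrite -mulr2n mulrn_eq0 /= => /eqP.
by rewrite -mulN1r dvalM // h add0r.
Qed.

Lemma dvalV x : x != 0 -> v x^-1 = - v x.
Proof.
move=> x0; apply: (addrI (v x)); rewrite subrr -dvalM ?invr_eq0 //.
by rewrite mulfV // dval1.
Qed.

Lemma dval_ge0 N : dval_ge N 0.
Proof. by rewrite /dval_ge eqxx. Qed.

Lemma dval_geN N x : dval_ge N (- x) = dval_ge N x.
Proof. by rewrite /dval_ge oppr_eq0 dvalN. Qed.

Lemma dval_geD N x y : dval_ge N x -> dval_ge N y -> dval_ge N (x + y).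
Proof.
rewrite /dval_ge; have [->|x0] := eqVneq x 0; first by rewrite add0r.
have [->|y0] := eqVneq y 0; first by rewrite addr0 (negPf x0).
have [//|xy0 /= hx hy] := eqVneq (x + y) 0.
by apply: le_trans (dvalD v x0 y0 xy0); rewrite le_min hx hy.
Qed.

Lemma dval_geM N M x y :
  dval_ge N x -> dval_ge M y -> dval_ge (N + M) (x * y).
Proof.
rewrite /dval_ge mulf_eq0; have [->|x0] := eqVneq x 0; first by [].
have [//|y0 /= hx hy] := eqVneq y 0.
by rewrite dvalM // lerD.
Qed.

Lemma dval_geW N M x : M <= N -> dval_ge N x -> dval_ge M x.
Proof. by move=> h /orP[/eqP->|/(le_trans h) h']; rewrite /dval_ge ?eqxx ?h' ?orbT. Qed.

Lemma dval_ge_lb x : exists N, dval_ge N x.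
Proof. by exists (v x); rewrite /dval_ge lexx orbT. Qed.

Lemma cauchy_lb s : cauchy_seq s ->
  exists N k, forall n, (k <= n)%N -> dval_ge N (s n).
Proof.
move=> /(_ 0) [k hk]; have [N hN] := dval_ge_lb (s k).
exists (Num.min 0 N), k => n kn; rewrite -(subrK (s k) (s n)); apply: dval_geD.
  by apply: dval_geW (hk n k kn (leqnn k)); rewrite ge_min lexx.
by apply: dval_geW hN; rewrite ge_min lexx orbT.
Qed.

Lemma null_cauchy s : null_seq s -> cauchy_seq s.
Proof.
move=> h N; have [k hk] := h N; exists k => m n km kn.
by apply: dval_geD; rewrite ?dval_geN hk.
Qed.

Lemma null_mull s t : cauchy_seq s -> null_seq t -> null_seq (s * t).
Proof.
move=> /cauchy_lb[M [k hk]] h N; have [l hl] := h (N - M).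
exists (maxn k l) => n; rewrite geq_max => /andP[kn ln].
by rewrite -(subrKC M N); apply: dval_geM; [apply: hk|apply: hl].
Qed.

(** The ring of Cauchy sequences. *)
Definition cauchy_pred : {pred nat -> F} := fun s => `[< cauchy_seq s >].

Lemma cauchy_subring : subring_closed cauchy_pred.
Proof.
split.
- by apply/asboolP => N; exists 0%N => m n _ _; rewrite subrr dval_ge0.
- move=> s t /asboolP hs /asboolP ht; apply/asboolP => N.
  have [k hk] := hs N; have [l hl] := ht N.
  exists (maxn k l) => m n; rewrite !geq_max => /andP[km lm] /andP[kn ln].
  have -> : (s - t) m - (s - t) n = (s m - s n) - (t m - t n).
    by rewrite -[(s - t) m]/(s m - t m) -[(s - t) n]/(s n - t n); ring.
  by apply: dval_geD; rewrite ?dval_geN ?hk ?hl.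
- move=> s t /asboolP hs /asboolP ht; apply/asboolP => N.
  have [A [a ha]] := cauchy_lb hs; have [B [b hb]] := cauchy_lb ht.
  have [k hk] := hs (N - B); have [l hl] := ht (N - A).
  exists (maxn (maxn a b) (maxn k l)) => m n; rewrite !geq_max.
  move=> /andP[/andP[am bm] /andP[km lm]] /andP[/andP[an bn] /andP[kn ln]].
  have -> : (s * t) m - (s * t) n = (s m - s n) * t m + s n * (t m - t n).
    by rewrite -[(s * t) m]/(s m * t m) -[(s * t) n]/(s n * t n); ring.
  apply: dval_geD.
    by rewrite -(subrK B N); apply: dval_geM; [apply: hk|apply: hb].
  by rewrite -(subrKC A N); apply: dval_geM; [apply: ha|apply: hl].
Qed.

HB.instance Definition _ :=
  GRing.isSubringClosed.Build (nat -> F) cauchy_pred cauchy_subring.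

Record cauchy := Cauchy { cauchy_val :> nat -> F;
                          cauchy_valP : cauchy_val \in cauchy_pred }.
HB.instance Definition _ := [isSub for cauchy_val].
HB.instance Definition _ := [Choice of cauchy by <:].
HB.instance Definition _ := [SubChoice_isSubComNzRing of cauchy by <:].

Definition null_ideal : pred cauchy := fun s : cauchy => `[< null_seq s >].

Lemma null_idealr_closed : idealr_closed null_ideal.
Proof.
split.
- by apply/asboolP => N; exists 0%N => n _; rewrite dval_ge0.
- apply/asboolPn => /(_ 1) [k /(_ k (leqnn k))].
  by rewrite /dval_ge -[\val 1 k]/(1 : F) oner_eq0 dval1.
- move=> s t u /asboolP ht /asboolP hu; apply/asboolP => N.
  have [k hk] := null_mull (asboolW (cauchy_valP s)) ht N.
  have [l hl] := hu N.
  exists (maxn k l) => n; rewrite geq_max => /andP[kn ln].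
  by apply: dval_geD; [apply: hk|apply: hl].
Qed.

HB.instance Definition _ :=
  isIdealr.Build cauchy null_ideal null_idealr_closed.

(** F_v: Cauchy sequences modulo null sequences. *)
Definition null_idealr : idealr cauchy := null_ideal.
Definition completion : Type := {ideal_quot null_idealr}.
HB.instance Definition _ := GRing.ComNzRing.on completion.

Lemma cauchy_away s : cauchy_seq s -> ~ null_seq s ->
  exists N k, forall n, (k <= n)%N -> s n != 0 /\ v (s n) <= N.
Proof.
move=> cs /existsNP[N hN].
have [k hk] := cs N; exists N, k => n kn.
suff : ~~ dval_ge N (s n).
  by rewrite /dval_ge negb_or -ltNge => /andP[-> /ltW ->].
apply/negP => h; apply: hN; exists k => m km.
by rewrite -(subrK (s n) (s m)); apply: dval_geD => //; apply: hk.
Qed.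

Definition completion_class (s : cauchy) : completion :=
  \pi_({ideal_quot null_idealr})%qT s.

Lemma completion_classB : zmod_morphism completion_class.
Proof. exact: rmorphB. Qed.
Lemma completion_classM : monoid_morphism completion_class.
Proof. split; [exact: rmorph1|exact: rmorphM]. Qed.
HB.instance Definition _ :=
  GRing.isZmodMorphism.Build cauchy completion completion_class completion_classB.
HB.instance Definition _ :=
  GRing.isMonoidMorphism.Build cauchy completion completion_class
    completion_classM.

Lemma completion_class_eq (s t : cauchy) :
  completion_class s = completion_class t <-> null_seq (s - t).
Proof.
have h : (completion_class s == completion_class t) = (s - t \in null_idealr).
  by rewrite Quotient.idealrBE.
split=> [/eqP|hn]; first by rewrite h => /asboolP.
by apply/eqP; rewrite h; apply/asboolP.
Qed.

Lemma completion_class_surj (x : completion) : exists s : cauchy, x = completion_class s.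
Proof. by exists (repr x); rewrite /completion_class reprK. Qed.

Lemma completion_unit (x : completion) : x != 0 -> exists y : completion, y * x = 1.
Proof.
have [s ->] := completion_class_surj x => s0.
have cs : cauchy_seq s := asboolW (cauchy_valP s).
have ns : ~ null_seq s.
  move=> h; move/eqP: s0; apply; rewrite -(rmorph0 completion_class).
  by apply/completion_class_eq; rewrite [_ - _]subr0.
have [N [k hk]] := cauchy_away cs ns.
pose t n : F := if (n < k)%N then 0 else (s n)^-1.
have tE n : (k <= n)%N -> t n = (s n)^-1 by rewrite /t leqNgt => /negPf ->.
have ct : cauchy_seq t.
  move=> M; have [l hl] := cs (M + N + N).
  exists (maxn k l) => m n; rewrite !geq_max => /andP[km lm] /andP[kn ln].
  rewrite !tE //; have [m0 vm] := hk m km; have [n0 vn] := hk n kn.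
  have -> : (s m)^-1 - (s n)^-1 = - ((s m - s n) * ((s m)^-1 * (s n)^-1)).
    rewrite mulrBl mulrA mulfV // mul1r [_^-1 * _]mulrC mulrA mulfV // mul1r.
    by rewrite opprB.
  rewrite dval_geN.
  have -> : M = (M + N + N) + (- N + - N) by rewrite addrA addrK addrK.
  apply: dval_geM; first exact: hl.
  by apply: dval_geM; rewrite /dval_ge dvalV // lerN2 ?vm ?vn orbT.
have ctP : t \in cauchy_pred by apply/asboolP.
exists (completion_class (Cauchy ctP)).
rewrite -rmorphM -(rmorph1 completion_class).
apply/completion_class_eq => M; exists k => n kn.
rewrite -[X in dval_ge _ X]/(t n * s n - 1).
by rewrite tE // mulVf ?subrr ?dval_ge0 //; case: (hk n kn).
Qed.

Definition completion_inv (x : completion) : completion :=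
  if pselect (exists y : completion, y * x = 1) is left h then sval (cid h)
  else 0.

Lemma completion_mulVf (x : completion) : x != 0 -> completion_inv x * x = 1.
Proof.
move=> x0; have h := completion_unit x0; rewrite /completion_inv.
by case: pselect => [h'|//]; case: (cid h').
Qed.

Lemma completion_inv0 : completion_inv 0 = 0.
Proof.
rewrite /completion_inv; case: pselect => [h|//]; exfalso.
by case: h => y /eqP; rewrite mulr0 eq_sym oner_eq0.
Qed.

HB.instance Definition _ :=
  GRing.ComNzRing_isField.Build completion completion_mulVf completion_inv0.

Lemma cst_cauchy (x : F) : (fun=> x : F) \in cauchy_pred.
Proof. by apply/asboolP => N; exists 0%N => m n _ _; rewrite subrr dval_ge0. Qed.

(** The canonical embedding F -> F_v. *)
Definition to_completion (x : F) : completion :=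
  completion_class (Cauchy (cst_cauchy x)).

Lemma to_completionB : zmod_morphism to_completion.
Proof.
move=> x y; rewrite /to_completion -rmorphB; congr completion_class.
exact: val_inj.
Qed.
Lemma to_completionM : monoid_morphism to_completion.
Proof.
split=> [|x y]; rewrite /to_completion -?rmorphM -?(rmorph1 completion_class);
  congr completion_class; exact: val_inj.
Qed.
HB.instance Definition _ :=
  GRing.isZmodMorphism.Build F completion to_completion to_completionB.
HB.instance Definition _ :=
  GRing.isMonoidMorphism.Build F completion to_completion to_completionM.

End Completion.

(** Quadratic forms (V, q) on a finite-dimensional vector space. *)
Record quadratic_form (F : fieldType) (V : vectType F) := QuadraticForm {
  qval :> V -> F;
  qvalZ : forall a u, qval (a *: u) = a ^+ 2 * qval u;
  qval_polar : forall w, scalar (fun u => qval (u + w) - qval u - qval w)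
}.

Section QuadraticForms.
Variables (F : fieldType) (V : vectType F) (q : quadratic_form V).

Definition polar (u w : V) : F := q (u + w) - q u - q w.

(** Nondegeneracy of the polar form; this is the standard notion in
    characteristic different from 2, the only case used here. *)
Definition regular : Prop := forall u, (forall w, polar u w = 0) -> u = 0.

Definition isotropic : Prop := exists2 u, u != 0 & q u = 0.
Definition anisotropic : Prop := ~ isotropic.
End QuadraticForms.

Section ScalarExtension.
Variables (F K : fieldType) (iota : {rmorphism F -> K}).
Variables (V : vectType F) (q : quadratic_form V).
Local Notation n := (\dim {:V}).
Local Notation e := (vbasis {:V}).

Definition scalar_ext_val (x : 'rV[K]_n) : K :=
  \sum_(i < n) iota (q e`_i) * x 0 i ^+ 2 +
  \sum_(i < n) \sum_(j < n | (i < j)%N)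
     iota (polar q e`_i e`_j) * (x 0 i * x 0 j).

Lemma scalar_ext_valZ a x : scalar_ext_val (a *: x) = a ^+ 2 * scalar_ext_val x.
Proof.
rewrite /scalar_ext_val mulrDr !big_distrr; congr (_ + _); apply: eq_bigr => i _.
  by rewrite !mxE /=; ring.
by rewrite big_distrr; apply: eq_bigr => j _; rewrite !mxE /=; ring.
Qed.

Lemma scalar_ext_polar w :
  scalar (fun x => scalar_ext_val (x + w) - scalar_ext_val x - scalar_ext_val w).
Proof.
have E x : scalar_ext_val (x + w) - scalar_ext_val x - scalar_ext_val w =
    \sum_(i < n) iota (q e`_i) * (2 * x 0 i * w 0 i) +
    \sum_(i < n) \sum_(j < n | (i < j)%N)
       iota (polar q e`_i e`_j) * (x 0 i * w 0 j + w 0 i * x 0 j).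
  have aux (a1 a2 b1 b2 c1 c2 : K) :
      a1 + a2 - (b1 + b2) - (c1 + c2) = (a1 - b1 - c1) + (a2 - b2 - c2) by ring.
  rewrite /scalar_ext_val aux -!sumrB.
  congr (_ + _); apply: eq_bigr => i _; first by rewrite !mxE; ring.
  by rewrite -!sumrB; apply: eq_bigr => j _; rewrite !mxE; ring.
move=> a x y /=; rewrite !E mulrDr [RHS]addrACA !big_distrr -!big_split /=.
apply: eq_bigr => i _; congr (_ + _); first by rewrite !mxE; ring.
rewrite big_distrr -big_split; apply: eq_bigr => j _.
by rewrite !mxE /=; ring.
Qed.

(** q_K on K (x)_F V, identified with K^n by the basis (1 (x) e_i). *)
Definition scalar_ext : quadratic_form 'rV[K]_n :=
  QuadraticForm scalar_ext_valZ scalar_ext_polar.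

Lemma qval_sum m (w : 'I_m -> V) : q (\sum_i w i) =
  \sum_i q (w i) + \sum_(i < m) \sum_(j < m | (i < j)%N) polar q (w i) (w j).
Proof.
have q0 : q 0 = 0 by rewrite -(scale0r 0) qvalZ expr0n mul0r.
have qD u v : q (u + v) = q u + q v + polar q u v by rewrite /polar; ring.
have p0 u : polar q 0 u = 0 by rewrite /polar add0r q0 subr0 subrr.
have pD u v z : polar q (u + v) z = polar q u z + polar q v z.
  by have := qval_polar q z 1 u v; rewrite /= !scale1r mul1r.
have ps k (f : 'I_k -> V) z : polar q (\sum_i f i) z = \sum_i polar q (f i) z.
  elim: k f => [|k IH] f; first by rewrite !big_ord0 p0.
  by rewrite !big_ord_recr /= pD IH.
elim: m w => [|m IH] w; first by rewrite !big_ord0 addr0.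
rewrite !big_ord_recr /= qD IH ps.
have -> : \sum_(j < m.+1 | (m < j)%N) polar q (w ord_max) (w j) = 0.
  by apply: big1 => j; rewrite ltnNge -ltnS ltn_ord.
have -> : \sum_(i < m) \sum_(j < m.+1 | (i < j)%N)
    polar q (w (widen_ord (leqnSn m) i)) (w j) =
  \sum_(i < m) \sum_(j < m | (i < j)%N)
    polar q (w (widen_ord (leqnSn m) i)) (w (widen_ord (leqnSn m) j)) +
  \sum_(i < m) polar q (w (widen_ord (leqnSn m) i)) (w ord_max).
  rewrite -big_split; apply: eq_bigr => i _.
  by rewrite big_mkcond big_ord_recr /= ltn_ord -big_mkcond.
by ring.
Qed.

Lemma scalar_extE (u : V) :
  scalar_ext (\row_i iota (coord e i u)) = iota (q u).
Proof.
have bE : forall a b u v, polar q (a *: u) (b *: v) = a * b * polar q u v.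
  have sym u' v' : polar q u' v' = polar q v' u'.
    by rewrite /polar [v' + u']addrC; ring.
  have L a u' v' : polar q (a *: u') v' = a * polar q u' v'.
    have := qval_polar q v' a u' 0; rewrite /= !addr0 !add0r.
    have -> : q 0 = 0 by rewrite -(scale0r 0) qvalZ expr0n mul0r.
    by rewrite subr0 subrr addr0.
  by move=> a b u' v'; rewrite L sym L sym mulrA.
rewrite {2}(coord_vbasis (memvf u)) qval_sum rmorphD !rmorph_sum /=.
congr (_ + _); apply: eq_bigr => i _.
  by rewrite qvalZ mxE rmorphM rmorphXn mulrC.
rewrite rmorph_sum; apply: eq_bigr => j _.
by rewrite !mxE bE !rmorphM /= mulrC.
Qed.

End ScalarExtension.

(* Main.v *)
From HB Require Import structures.
From mathcomp Require Import all_boot all_order all_algebra all_fingroup all_solvable all_field.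
From mathcomp Require Import qpoly qfpoly generic_quotient.
From mathcomp Require Import boolp.
From mathcomp Require Import ring zify.
Require Import Defs.
Set Implicit Arguments.
Unset Strict Implicit.
Unset Printing Implicit Defensive.
Import Order.TTheory GRing.Theory Num.Theory Pdiv.Field.
Local Open Scope ring_scope.

(** Let q be a form of dimension 4 over E(X) that is isotropic at every place;
    it is shown to be isotropic. The idea is to complete q to a form of
    dimension 6 that is hyperbolic for an elementary reason.

    Diagonalise q and, after scaling, write it with squarefree coefficients
    such that each prime divides one or two of them, and such that two
    coefficients divisible by the same prime p cancel modulo p^2 at vectors
    prime to p. The latter is what isotropy at p gives ([normalized_form]).
    Let d be the squarefree part of the discriminant of q; its primes are
    those that divide a single coefficient.

    Suppose that a polynomial c is found, a constant times a product of
    distinct new primes, such that d is a square modulo each prime of c, and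
    such that c has a prescribed quadratic residue symbol at each prime of d.
    Then the form q + <-c, cd> of dimension 6, whose discriminant is minus a
    square, has at every prime dividing its coefficients a vector that allows
    its lattice over E[X] to be enlarged; the lattice becomes unimodular
    ([glue]). By Hermite reduction ([hermite]), a unimodular lattice over E[X]
    has a vector of constant value, and it follows that it has a diagonal Gram
    matrix with entries in E ([harder]). Over the finite field E a form of
    dimension 6 with this discriminant is hyperbolic ([lagrangian_six]). A
    totally isotropic subspace of dimension 3 meets the 4-dimensional space of
    q, so that q is isotropic ([lattice_isotropic]).

    The existence of c ([multiplier_exists]) is a question of linear algebra
    over the field with two elements: the symbols of constants and of the
    primes at which d is a square have to generate the prescribed ones. If
    they do not, there is a set I of primes of d whose product of symbols is 1
    at all of these, but -1 at the prescribed values. By reciprocity the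
    symbol of d at a variable prime is a product of two characters of that
    prime, the one attached to I and a complementary one. If the latter is
    nontrivial, both are -1 at some prime; then d is a square there, a
    contradiction. This existence of primes ([prime_with_symbols]) comes from
    the positivity of a convolution of two characters, whose sums over monic
    polynomials of given degree would otherwise change sign with the degree.
    In the remaining case I consists of all the primes of d, and the
    prescribed values have product 1 by quadratic reciprocity, local isotropy
    at the primes that divide two coefficients and local isotropy at infinity
    ([product_formula]).

    The places are used only through an elementary form of anisotropy over the
    completion, stated in E(X) itself ([vaniso]). It is obtained from
    Springer's criterion ([vaniso_four]) and passes to the completion by
    taking limits ([aniso_completion]). *)

(** * Signs, and the quadratic character of a finite field *)

Lemma signsM (s t : int) : s \in [:: 0; 1; -1] -> t \in [:: 0; 1; -1] ->
  s * t \in [:: 0; 1; -1].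
Proof. by rewrite !inE => /or3P[]/eqP-> /or3P[]/eqP->. Qed.

Lemma signsX (s : int) n : s \in [:: 0; 1; -1] -> s ^+ n \in [:: 0; 1; -1].
Proof. by move=> hs; elim: n => [//|n IH]; rewrite exprS signsM. Qed.

(** Characters take values in [int], while Euler's criterion lives in a field
    of odd characteristic; distinct signs stay distinct there, so identities
    between symbols may be checked in the field. *)
Lemma sign_intr_inj (L : fieldType) (s t : int) : (2 : L) != 0 ->
  s \in [:: 0; 1; -1] -> t \in [:: 0; 1; -1] -> s%:~R = t%:~R :> L -> s = t.
Proof.
move=> two0; have n1 : (1 : L) != -1 by rewrite -subr_eq0 opprK -mulr2n.
have z1 := oner_neq0 L; have zN1 : (-1 : L) != 0 by rewrite oppr_eq0.
rewrite !inE => /or3P[]/eqP-> /or3P[]/eqP-> //=; rewrite ?mulrN1z ?mulr1z ?mulr0z => e.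
all: exfalso; first [by move: z1; rewrite e eqxx | by move: z1; rewrite -e eqxx
  | by move: zN1; rewrite e eqxx | by move: zN1; rewrite -e eqxx
  | by move: n1; rewrite e eqxx | by move: n1; rewrite -e eqxx].
Qed.

Section FiniteField.
Variable K : finFieldType.

Lemma card_pchar_nat : [pchar K].-nat #|K|.
Proof.
have [p pp pK] := finPcharP K.
have := abelem_pgroup (fin_ring_pchar_abelem pK); rewrite /pgroup cardsT.
by apply: sub_in_pnat => x _ /eqnP->.
Qed.

Hypothesis oddK : odd #|K|.

Lemma two_neq0 : (2 : K) != 0.
Proof.
apply/negP => h2; have h2c : 2%N \in [pchar K] by rewrite inE.
have := abelem_pgroup (fin_ring_pchar_abelem h2c) => /card_pgroup.
rewrite cardsT => cK; have := oddK; have := finNzRing_gt1 K.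
by rewrite cK; case: (logn _ _) => // n; rewrite oddX.
Qed.

Definition squares : {set K} := [set y ^+ 2 | y in K].

(** Squaring is at most two-to-one away from 0, so at least half of the
    nonzero elements are squares, and 0 is one more. *)
Lemma card_squares : (#|K| < 2 * #|squares|)%N.
Proof.
have -> : #|K| = (\sum_(s in squares) #|[set y : K | y ^+ 2 == s]|)%N.
  rewrite -sum1_card (partition_big (fun y : K => y ^+ 2) (mem squares)) /=.
    by apply: eq_bigr => s _; rewrite -sum1_card; apply: eq_bigl => y; rewrite inE.
  by move=> y _; apply/imsetP; exists y.
have z0 : 0 \in squares by apply/imsetP; exists 0 => //; rewrite expr0n.
rewrite (big_setD1 0) //= (cardsD1 (0 : K) squares) z0 mulnDr ltnS.
have -> : #|[set y : K | y ^+ 2 == 0]| = 1%N.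
  apply/eqP/cards1P; exists 0; apply/setP => y.
  by rewrite !inE expf_eq0.
rewrite ltnS mulnC -sum_nat_const; apply: leq_sum => s.
rewrite !inE => /andP[_ /imsetP[y _ ->]].
have /subset_leq_card/leq_trans : [set z : K | z ^+ 2 == y ^+ 2] \subset [set y; -y].
  by apply/subsetP => z; rewrite !inE eqf_sqr.
by apply; rewrite cards2; case: (_ != _).
Qed.

(** The sets [u * squares] and [w - v * squares] each contain more than half of
    the field, so they meet. *)
Lemma binary_universal (u v w : K) : u != 0 -> v != 0 ->
  exists x y, u * x ^+ 2 + v * y ^+ 2 = w.
Proof.
move=> u0 v0.
pose A := [set u * s | s in squares]; pose B := [set w - v * s | s in squares].
have cA : #|A| = #|squares| by apply: card_imset; apply: mulfI.
have cB : #|B| = #|squares|.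
  by apply: card_imset => s t /addrI/oppr_inj/(mulfI v0).
have [AB0|[t]] := set_0Vmem (A :&: B).
  have := cardsUI A B; rewrite AB0 cards0 addn0 cA cB addnn -mul2n => cU.
  by have := max_card (mem (A :|: B)); rewrite leqNgt cU card_squares.
rewrite inE => /andP[/imsetP[_ /imsetP[x _ ->] ->]] /imsetP[_ /imsetP[y _ ->]] e.
by exists x, y; rewrite e subrK.
Qed.

Definition qchar (x : K) : int :=
  if x == 0 then 0 else if x \in squares then 1 else -1.

Let h := #|K|./2.
Let cardKE : #|K| = (h.*2).+1.
Proof. by rewrite -[LHS]odd_double_half oddK. Qed.

Lemma expf_half_sqr (x : K) : x != 0 -> x ^+ h ^+ 2 = 1.
Proof.
move=> x0; apply: (mulfI x0); rewrite -exprM muln2 -exprS -cardKE mulr1.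
exact: expf_card.
Qed.

Lemma half_gt0 : (0 < h)%N.
Proof. by case: (h) cardKE (finNzRing_gt1 K) => // ->. Qed.

Lemma squares_sub_roots x : x != 0 -> x \in squares -> x ^+ h = 1.
Proof.
move=> x0 /imsetP[y _ xE].
have y0 : y != 0 by apply: contraNneq x0 => y0; rewrite xE y0 expr0n.
by rewrite xE -exprM mulnC exprM expf_half_sqr.
Qed.

Lemma squares0 : 0 \in squares.
Proof. by apply/imsetP; exists 0 => //; rewrite expr0n. Qed.

Lemma leq_half_roots (s : seq K) : uniq s -> {in s, forall x, x ^+ h = 1} ->
  (size s <= h)%N.
Proof.
move=> us hs; have p0 : 'X^h - 1 != 0 :> {poly K}.
  by rewrite -size_poly_eq0 size_XnsubC ?half_gt0.
rewrite -ltnS -(size_XnsubC (1 : K) half_gt0); apply: max_poly_roots => //.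
by apply/allP => z zs; rewrite rootE !hornerE hs ?subrr.
Qed.

(** Every nonzero square is a root of [X^h - 1], where [h = (q - 1) / 2]; a
    nonsquare root would bring the number of roots above [h]. *)
Lemma qchar_euler (x : K) : (qchar x)%:~R = x ^+ h.
Proof.
rewrite /qchar; have [->|x0] := eqVneq x 0.
  rewrite expr0n; case: (h) cardKE => // K1.
  by have := finNzRing_gt1 K; rewrite K1.
have := expf_half_sqr x0; move/eqP; rewrite sqrf_eq1.
case: ifPn => [/imsetP[y _ xE] _|xS /orP[|/eqP-> //]].
  have y0 : y != 0 by apply: contraNneq x0 => y0; rewrite xE y0 expr0n.
  by rewrite xE -exprM mulnC exprM expf_half_sqr.
move=> /eqP xh; exfalso.
have : (size (x :: enum (squares :\ 0%R)) <= h)%N.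
  apply: leq_half_roots; first by rewrite /= mem_enum !inE (negPf xS) andbF enum_uniq.
  move=> z; rewrite inE => /predU1P[->//|].
  by rewrite mem_enum !inE => /andP[z0 zS]; apply: squares_sub_roots.
have := card_squares; rewrite /= -cardE (cardsD1 (0 : K) squares) squares0 cardKE.
by rewrite add1n mul2n doubleS !ltnS leq_double => h1 /leq_trans/(_ h1); rewrite ltnn.
Qed.

Lemma qchar_sign x : qchar x \in [:: 0; 1; -1].
Proof. by rewrite /qchar; case: (x == 0) => //; case: (x \in squares). Qed.

Lemma qcharM : {morph qchar : x y / x * y}.
Proof.
move=> x y; apply: sign_intr_inj two_neq0 _ _ _; rewrite ?qchar_sign //.
  by move: (qchar_sign x) (qchar_sign y); rewrite !inE;
     move=> /or3P[]/eqP-> /or3P[]/eqP->.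
by rewrite rmorphM /= !qchar_euler exprMn.
Qed.

Lemma nonsquare_exists : exists x : K, qchar x = -1.
Proof.
have [AB0|[x]] := set_0Vmem (~: squares).
  have cS : #|squares| = #|K| by rewrite -(cardsC squares) AB0 cards0 addn0.
  have : (size (enum (squares :\ 0%R)) <= h)%N.
    apply: leq_half_roots; rewrite ?enum_uniq // => z.
    by rewrite mem_enum !inE => /andP[z0 zS]; apply: squares_sub_roots.
  move: cS; rewrite -cardE (cardsD1 (0 : K) squares) squares0 cardKE => /eqP; rewrite add1n eqSS => /eqP->.
  by rewrite -addnn -{3}[h]addn0 leq_add2l leqNgt half_gt0.
rewrite inE => xS; exists x; rewrite /qchar (negPf xS).
case: eqP xS => // -> /negP[]; apply/imsetP; exists 0 => //.
by rewrite expr0n.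
Qed.
End FiniteField.

(** * Quadratic residue symbols of polynomials and their reciprocity law *)

Section Legendre.
Variable E : finFieldType.
Hypothesis oddE : odd #|E|.
Local Notation R := {poly E}.
Local Notation deg p := (size (p : R)).-1.

Definition mirr (p : R) : Prop := irreducible_poly p /\ p \is monic.

Lemma residue_field p : mirr p -> exists (k : finFieldType) (pi : {rmorphism R -> k}),
  [/\ forall x, (pi x == 0) = (p %| x), forall y, exists x, pi x = y
    & #|k| = (#|E| ^ deg p)%N].
Proof.
move=> [pI pM]; have hI : monic_irreducible_poly p by split.
exists {poly %/ p with hI}, (in_qpoly p); split.
- move=> x; apply/eqP/idP => [/val_eqP /= | hDp].
    by rewrite -Pdiv.IdomainMonic.modpE mk_monicE.
  by apply/val_eqP; rewrite /= -Pdiv.IdomainMonic.modpE mk_monicE.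
- move=> y; exists (y : {poly E}); apply: val_inj => /=.
  by apply: Pdiv.CommonRing.rmodp_small; apply: size_mk_monic.
- exact: card_qfpoly.
Qed.

Lemma odd_residue p : odd (#|E| ^ deg p).
Proof. by rewrite oddX oddE orbT. Qed.

Definition leg (p x : R) : int :=
  if p %| x then 0 else if `[< exists y, p %| y ^+ 2 - x >] then 1 else -1.

(** The symbol is the quadratic character of the residue field. Taking an
    arbitrary surjection with kernel [(p)] keeps the quotient ring out of the
    later arguments. *)
Lemma legE p (k : finFieldType) (pi : {rmorphism R -> k}) x :
  (forall x, (pi x == 0) = (p %| x)) -> (forall y, exists x, pi x = y) ->
  leg p x = qchar (pi x).
Proof.
move=> pi0 pis; rewrite /leg /qchar pi0; case: ifP => // _.
congr (if _ then _ else _); apply/asboolP/imsetP => [[y]|[y _ yE]].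
  by rewrite -pi0 rmorphB rmorphXn subr_eq0 => /eqP <-; exists (pi y).
by have [z zE] := pis y; exists z; rewrite -pi0 rmorphB rmorphXn zE yE subrr.
Qed.

Lemma leg_sign p x : leg p x \in [:: 0; 1; -1].
Proof. by rewrite /leg; case: (p %| x) => //; case: asboolP. Qed.

Lemma leg_eq0 p x : (leg p x == 0) = (p %| x).
Proof. by rewrite /leg; case: (p %| x) => //; case: asboolP. Qed.

Lemma leg_eq1 p x : leg p x = 1 -> exists y, p %| y ^+ 2 - x.
Proof. by rewrite /leg; case: (p %| x) => //; case: asboolP. Qed.

Lemma legP p x y : ~~ (p %| x) -> p %| y ^+ 2 - x -> leg p x = 1.
Proof.
by move=> /negPf px pyx; rewrite /leg px; case: asboolP => // -[]; exists y.
Qed.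

Lemma leg_cong p x y : p %| x - y -> leg p x = leg p y.
Proof.
move=> h; rewrite /leg.
have -> : (p %| x) = (p %| y) by rewrite -{1}[x](subrK y) dvdp_addr.
case: ifP => // _; congr (if _ then _ else _); apply: asbool_equiv_eq.
split=> -[z hz]; exists z.
  by rewrite -(subrK x (z ^+ 2)) -addrA dvdp_addr.
by rewrite -(subrK y (z ^+ 2)) -addrA dvdp_addr // -[y - x]opprB dvdpNr.
Qed.

Lemma legM p : mirr p -> {morph leg p : x y / x * y}.
Proof.
move=> /residue_field[k [pi [pi0 pis ck]]] x y; rewrite !(legE _ pi0 pis) rmorphM.
by apply: qcharM; rewrite ck odd_residue.
Qed.

Lemma leg_nonresidue p : mirr p -> exists x, leg p x = -1.
Proof.
move=> /residue_field[k [pi [pi0 pis ck]]].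
have [|y hy] := @nonsquare_exists k; first by rewrite ck odd_residue.
by have [x xE] := pis y; exists x; rewrite (legE _ pi0 pis) xE.
Qed.

(** Reciprocity is proved through norms: in a field containing a root [a] of
    [p], Euler's criterion expresses the symbol of [x] modulo [p] as a power of
    the product of the values of [x] at the conjugates [a ^ (q ^ i)]. *)
Section Closure.
Variables (K : fieldType) (phi : {rmorphism E -> K}).
Local Notation q := #|E|.
Local Notation "f ^i" := (map_poly phi f).

(** Raising to the power [q ^ n] is a ring morphism fixing the coefficients. *)
Lemma frobK_horner (f : R) (a : K) n : (f^i).[a] ^+ (q ^ n) = (f^i).[a ^+ (q ^ n)].
Proof.
have ch : [pchar K].-nat (q ^ n)%N.
  rewrite pnatX; apply/orP; left; apply: sub_in_pnat (card_pchar_nat E) => p _.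
  by rewrite !inE => /andP[-> /eqP h]; rewrite -(rmorph_nat phi) h rmorph0 eqxx.
have fix_c (c : E) : phi c ^+ (q ^ n) = phi c.
  elim: (n) => [|m IH]; first by rewrite expn0 expr1.
  by rewrite expnSr exprM IH -rmorphXn expf_card.
have q0 : (0 < q ^ n)%N by rewrite expn_gt0 (ltnW (finNzRing_gt1 E)).
elim/poly_ind: f => [|f c IH].
  by rewrite map_poly0 !horner0 expr0n eqn0Ngt q0.
rewrite rmorphD rmorphM /= map_polyX map_polyC /= !hornerMXaddC.
by rewrite exprDn_pchar // exprMn IH fix_c.
Qed.

Variables (p : R) (a : K).
Hypotheses (pP : mirr p) (ra : root (p^i) a).

Lemma dvdp_root_minimal x : (p %| x) = root (x^i) a.
Proof.
apply/idP/idP => [/dvdpP[y ->]|xa]; first by rewrite rmorphM rootM ra orbT.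
case: pP => pI _; case: (boolP (p %| x)) => // npx; exfalso.
have : coprimep p x by rewrite irreducible_poly_coprime.
rewrite -(coprimep_map phi) => /coprimep_root/(_ ra).
by rewrite -rootE xa.
Qed.

Lemma deg_gt0 : (0 < deg p)%N.
Proof. by case: pP => -[s1 _] _; case: (size p) s1 => // -[]. Qed.

Lemma conj_period : a ^+ (q ^ deg p) = a.
Proof.
have [k [pi [pi0 pis ck]]] := residue_field pP.
apply/eqP; rewrite -subr_eq0.
have -> : a ^+ (q ^ deg p) - a = (('X^(q ^ deg p) - 'X)^i).[a].
  by rewrite rmorphB /= map_polyXn map_polyX !hornerE.
rewrite -rootE -dvdp_root_minimal -pi0 rmorphB rmorphXn /= -ck expf_card.
by rewrite subrr.
Qed.

(** If [a] were fixed by the [n]-th Frobenius power with [n < deg p], every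
    element of the residue field, being a polynomial in [a], would be a root of
    [X ^ (q ^ n) - X], which has too few roots. *)
Lemma conj_neq n : (0 < n < deg p)%N -> a ^+ (q ^ n) != a.
Proof.
move=> /andP[n0 np]; apply/negP => /eqP an.
have [k [pi [pi0 pis ck]]] := residue_field pP.
have q1 := finNzRing_gt1 E.
have hk (z : k) : z ^+ (q ^ n) = z.
  have [x <-] := pis z; apply/eqP; rewrite -rmorphXn -subr_eq0 -rmorphB pi0.
  rewrite dvdp_root_minimal rootE rmorphB rmorphXn /= !hornerE.
  by rewrite frobK_horner an subrr.
have qn1 : (1 < q ^ n)%N by rewrite -(expn0 q) ltn_exp2l.
have sX : size ('X^(q ^ n) - 'X : {poly k}) = (q ^ n).+1.
  by rewrite size_polyDl size_polyXn ?size_polyN ?size_polyX.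
have : (size (enum k) < size ('X^(q ^ n) - 'X : {poly k})%R)%N.
  apply: max_poly_roots; rewrite ?enum_uniq -?size_poly_eq0 ?sX //.
  by apply/allP => z _; rewrite rootE !hornerE hk subrr.
by rewrite sX -cardE ck ltnS leq_exp2l // leqNgt np.
Qed.

Lemma conj_split : p^i = \prod_(i < deg p) ('X - (a ^+ (q ^ i))%:P).
Proof.
have pm : p^i \is monic by rewrite map_monic; case: pP.
have -> : \prod_(i < deg p) ('X - (a ^+ (q ^ i))%:P) =
   \prod_(z <- [seq a ^+ (q ^ i) | i <- iota 0 (deg p)]) ('X - z%:P).
  by rewrite big_map -(big_mkord xpredT (fun i => 'X - (a ^+ (q ^ i))%:P)) /index_iota subn0.
rewrite [LHS](@all_roots_prod_XsubC _ (p^i)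
  [seq a ^+ (q ^ i) | i <- iota 0 (deg p)]).
- by rewrite (monicP pm) scale1r.
- by rewrite size_map_poly size_map size_iota; have := deg_gt0; case: (size p).
- apply/allP => _ /mapP[i _ ->]; rewrite rootE -frobK_horner.
  by rewrite (rootP ra) expf_eq0 eqxx andbT expn_gt0 (ltnW (finNzRing_gt1 E)).
- rewrite uniq_rootsE map_inj_in_uniq ?iota_uniq // => i j.
  have key u v : (u < v < deg p)%N -> a ^+ (q ^ u) = a ^+ (q ^ v) -> False.
    move=> /andP[uv vn] e; have un := ltn_trans uv vn.
    have c1 : (0 < v - u < deg p)%N.
      by rewrite subn_gt0 uv; apply: leq_ltn_trans vn; rewrite leq_subr.
    have /negP[] := conj_neq c1.
    apply/eqP; have := congr1 (fun z => z ^+ (q ^ (deg p - u))) e.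
    rewrite -!exprM -!expnD subnKC 1?ltnW // conj_period => e2; rewrite [RHS]e2.
    have -> : (v + (deg p - u) = deg p + (v - u))%N.
      by move: uv un; lia.
    by rewrite expnD exprM conj_period.
  rewrite !mem_iota !add0n => /= iN jN e.
  case: (ltngtP i j) => [h|h|//]; exfalso.
    by apply: (key i j) e; apply/andP; split.
  by apply: (key j i) (esym e); apply/andP; split.
Qed.

(** Since [(q ^ deg p - 1) / 2 = (1 + q + ... + q ^ (deg p - 1)) * (q - 1) / 2],
    Euler's criterion in the residue field raises the norm of [x] to the power
    [(q - 1) / 2]. *)
Lemma leg_norm x :
  (leg p x)%:~R = (\prod_(i < deg p) (x^i).[a ^+ (q ^ i)]) ^+ q./2.
Proof.
have [k [pi [pi0 pis ck]]] := residue_field pP.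
have ok : odd #|k| by rewrite ck odd_residue.
have qE : q = (q./2.*2).+1 by rewrite -[LHS]odd_double_half oddE.
have NE : ((q ^ deg p)./2 = (\sum_(i < deg p) q ^ i) * q./2)%N.
  apply: double_inj; rewrite -[RHS]muln2 -mulnA muln2.
  have <- : q.-1 = q./2.*2 by rewrite {1}qE.
  by rewrite mulnC -predn_exp -[in RHS](odd_double_half (q ^ deg p)) odd_residue.
have -> : (leg p x)%:~R = (x^i).[a] ^+ (q ^ deg p)./2.
  apply/eqP; rewrite eq_sym -subr_eq0.
  have -> : (x^i).[a] ^+ (q ^ deg p)./2 - (leg p x)%:~R =
      ((x ^+ (q ^ deg p)./2 - (leg p x)%:~R)^i).[a].
    by rewrite rmorphB rmorphXn rmorph_int /= -(rmorph_int (@polyC K)) !hornerE.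
  rewrite -rootE -dvdp_root_minimal -pi0 rmorphB rmorphXn rmorph_int /=.
  by rewrite (legE _ pi0 pis) qchar_euler // ck subrr.
rewrite NE exprM; congr (_ ^+ _).
rewrite -prodrXr; apply: eq_bigr => i _.
exact: frobK_horner.
Qed.
End Closure.

Lemma closure_exists : exists (K : closedFieldType), inhabited {rmorphism E -> K}.
Proof. by have [K [f _]] := countable_algebraic_closure E; exists K; split. Qed.

Lemma two_neq0_morph (K : fieldType) : {rmorphism E -> K} -> (2 : K) != 0.
Proof. by move=> f; rewrite -(rmorph_nat f) fmorph_eq0 two_neq0. Qed.

Lemma root_exists (K : closedFieldType) (f : {rmorphism E -> K}) p : mirr p ->
  exists a, root (map_poly f p) a.
Proof.
move=> [[s1 _] _]; apply/closed_rootP; rewrite size_map_poly.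
by case: (size p) s1 => // -[].
Qed.

Lemma leg_const p c : mirr p -> leg p c%:P = qchar c ^+ deg p.
Proof.
move=> pP; have [K [f]] := closure_exists; have [a ra] := root_exists f pP.
have t0 := two_neq0_morph f; apply: (sign_intr_inj t0); first exact: leg_sign.
  by rewrite signsX ?qchar_sign.
rewrite (leg_norm pP ra) rmorphXn /= -(rmorph_int f) qchar_euler //= rmorphXn.
rewrite -exprM mulnC exprM; congr (_ ^+ _).
rewrite (eq_bigr (fun=> f c)) => [|i _]; last by rewrite map_polyC hornerC.
by rewrite prodr_const card_ord.
Qed.

Lemma mirr_dvd p p' : mirr p -> mirr p' -> (p %| p') = (p == p').
Proof.
move=> [[p1 _] pm] [[_ p'I] p'm]; apply/idP/eqP => [h|-> //].
apply/eqP; rewrite -eqp_monic //; apply: p'I => //.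
by case: (size p) p1 => // -[].
Qed.

(** Both symbols are the power [(q - 1) / 2] of a resultant: the product of the
    differences of the roots of [p] and of [p']. Exchanging the two polynomials
    changes the sign of each of the [deg p * deg p'] differences. *)
Lemma leg_recip p p' : mirr p -> mirr p' ->
  leg p p' = leg p' p * qchar (-1 : E) ^+ (deg p * deg p').
Proof.
move=> pP p'P; have [K [f]] := closure_exists.
have [a ra] := root_exists f pP; have [b rb] := root_exists f p'P.
have t0 := two_neq0_morph f; apply: (sign_intr_inj t0); first exact: leg_sign.
  by rewrite signsM ?leg_sign ?signsX ?qchar_sign.
rewrite rmorphM rmorphXn /= (leg_norm pP ra) (leg_norm p'P rb).
rewrite -(rmorph_int f (qchar _)) qchar_euler // rmorphXn rmorphN1.
rewrite -exprM mulnC exprM -exprMn; congr (_ ^+ _).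
rewrite (eq_bigr (fun i : 'I_(deg p) => \prod_(j < deg p')
   (- (b ^+ (#|E| ^ j) - a ^+ (#|E| ^ i))))); last first.
  move=> i _; rewrite (conj_split p'P rb) horner_prod.
  by apply: eq_bigr => j _; rewrite !hornerE opprB.
rewrite (eq_bigr (fun i : 'I_(deg p) => (-1) ^+ deg p' * \prod_(j < deg p')
   (b ^+ (#|E| ^ j) - a ^+ (#|E| ^ i)))); last first.
  by move=> i _; rewrite prodrN card_ord.
rewrite big_split /= prodr_const card_ord -exprM mulrC [(deg p' * _)%N]mulnC.
congr (_ * _); rewrite exchange_big; apply: eq_bigr => j _.
rewrite (conj_split pP ra) horner_prod.
by apply: eq_bigr => i _; rewrite !hornerE.
Qed.
End Legendre.

(** * Factorisation of polynomials *)

Section Factor.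
Variable F : fieldType.
Local Notation R := {poly F}.
Implicit Types p f g x y : R.

(** A divisor of least degree among the nonconstant ones is irreducible. *)
Lemma monic_irreducible_factor f : (1 < size f)%N ->
  exists p, [/\ irreducible_poly p, p \is monic & p %| f].
Proof.
move=> f1; pose P n := `[< exists d : R, [/\ d %| f, (1 < size d)%N & size d = n] >].
have exP : exists n, P n by exists (size f); apply/asboolP; exists f.
case: (ex_minnP exP) => n /asboolP[d [df d1 dn]] minn.
have d0 : d != 0 by rewrite -size_poly_gt0 ltnW.
have ld : (lead_coef d)^-1 != 0 by rewrite invr_eq0 lead_coef_eq0.
exists ((lead_coef d)^-1 *: d); split.
- split; first by rewrite size_scale.
  move=> c c1; rewrite dvdpZr // => cd.
  apply: (eqp_trans (y := d)); last by rewrite eqp_sym eqp_scale.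
  rewrite -dvdp_size_eqp // eqn_leq dvdp_leq //= dn; apply: minn.
  apply/asboolP; exists c; split=> //; first exact: dvdp_trans df.
  have : (0 < size c)%N by rewrite size_poly_gt0 (dvdpN0 cd).
  by case: (size c) c1 => [|[]].
- by rewrite monicE lead_coefZ mulVf // lead_coef_eq0.
- by rewrite dvdpZl.
Qed.

Lemma padic_split p f : (1 < size p)%N -> f != 0 ->
  exists k g, f = p ^+ k * g /\ ~~ (p %| g).
Proof.
move=> p1; have [n] := ubnP (size f); elim: n f => // n IH f sf f0.
have [/dvdpP[g fE]|npf] := boolP (p %| f); last by exists 0, f; rewrite mul1r.
have g0 : g != 0 by apply: contraNneq f0 => g0; rewrite fE g0 mul0r.
have p0 : p != 0 by rewrite -size_poly_gt0 ltnW.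
have [|//|k [h [gE nph]]] := IH g.
  apply: leq_trans (_ : size f <= n)%N; last by rewrite -ltnS.
  rewrite fE size_mul // -subn1 -addnBA ?(ltnW p1) // -{1}[size g]addn0 ltn_add2l.
  by rewrite subn_gt0.
by exists k.+1, h; split=> //; rewrite fE gE exprSr -!mulrA [p * h]mulrC.
Qed.

Lemma irr_dvdM p x y : irreducible_poly p -> (p %| x * y) = (p %| x) || (p %| y).
Proof.
move=> pI; case: (boolP (p %| x)) => [px|]; first by rewrite dvdp_mulr.
by rewrite -irreducible_poly_coprime // => /Gauss_dvdpr ->.
Qed.

Lemma irr_dvdX p x n : irreducible_poly p -> (p %| x ^+ n) = (0 < n)%N && (p %| x).
Proof.
move=> pI; elim: n => [|n IH]; last by rewrite exprS irr_dvdM // IH; case: (p %| x); rewrite ?andbF.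
rewrite expr0 dvdp1; case: pI => s1 _; by case: (size p) s1 => // -[].
Qed.
End Factor.

(** * Character sums over monic polynomials *)

Section Enumerate.
Variable E : finFieldType.
Local Notation R := {poly E}.
Local Notation q := #|E|.

Definition polys n : seq R := [seq rVpoly v | v : 'rV[E]_n].
Definition monics n : seq R := [seq 'X^n + r | r <- polys n].

Lemma polys_uniq n : uniq (polys n).
Proof. by rewrite map_inj_uniq ?enum_uniq //; exact: can_inj rVpolyK. Qed.

Lemma mem_polys n f : (f \in polys n) = (size f <= n)%N.
Proof.
apply/mapP/idP => [[v _ ->]|fn]; first exact: size_poly.
by exists (poly_rV f); rewrite ?mem_enum // poly_rV_K.
Qed.

Lemma size_polys n : size (polys n) = (q ^ n)%N.
Proof. by rewrite size_map -cardE card_mx mul1n. Qed.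

Lemma monics_uniq n : uniq (monics n).
Proof. by rewrite map_inj_uniq ?polys_uniq //; exact: addrI. Qed.

Lemma size_monics n : size (monics n) = (q ^ n)%N.
Proof. by rewrite size_map size_polys. Qed.

Lemma mem_monics n f : (f \in monics n) = (f \is monic) && (size f == n.+1).
Proof.
apply/mapP/andP => [[r]|[fm /eqP fs]].
  rewrite mem_polys => rn ->.
  have rX : (size r < size ('X^n : R)%R)%N by rewrite size_polyXn ltnS.
  by rewrite monicE lead_coefDl // lead_coefXn size_polyDl // size_polyXn.
exists (f - 'X^n); last by rewrite addrC subrK.
rewrite mem_polys; apply/leq_sizeP => j nj; rewrite coefB coefXn.
move: nj; rewrite leq_eqVlt => /predU1P[<-|nj].
  by rewrite eqxx; move: fm; rewrite monicE /lead_coef fs => /eqP->; rewrite subrr.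
by rewrite gtn_eqF // subr0 nth_default // fs.
Qed.

Variables (M : R) (D : nat).
Hypotheses (Mm : M \is monic) (MD : size M = D.+1).

(** Division by [M] puts the monic polynomials of degree [n + D] in bijection
    with the pairs (monic quotient of degree [n], arbitrary remainder). *)
Lemma sum_periodic (psi : R -> int) n :
  (forall f g, M %| f - g -> psi f = psi g) ->
  \sum_(f <- monics (n + D)) psi f = (q ^ n)%:R * \sum_(r <- polys D) psi r.
Proof.
move=> per.
have M0 : M != 0 by rewrite monic_neq0.
have small r : r \in polys D -> (size r < size M)%N by rewrite mem_polys MD ltnS.
have p1 : perm_eq (monics (n + D)) [seq t * M + r | t <- monics n, r <- polys D].
  apply: uniq_perm; first exact: monics_uniq.
    apply: allpairs_uniq; rewrite ?monics_uniq ?polys_uniq //.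
    move=> [t r] [t' r'] /allpairsP[[u v] /= [_ vD [-> ->]]].
    move=> /allpairsP[[u' v'] /= [_ v'D [-> ->]]] e.
    have := congr1 (fun x => x %/ M) e; have := congr1 (fun x => x %% M) e.
    by rewrite /= !divp_addl_mul_small ?modp_addl_mul_small ?small // => -> ->.
  move=> f; rewrite mem_monics; apply/andP/allpairsP => [[fm /eqP fs]|].
    have t0 : f %/ M != 0 by rewrite divp_eq0 !negb_or M0 monic_neq0 //= fs MD -leqNgt ltnS leq_addl.
    exists (f %/ M, f %% M); rewrite /= -divp_eq mem_polys -ltnS -MD ltn_modp M0.
    split=> //; rewrite mem_monics size_divp // fs MD /= subSn ?leq_addl // addnK eqxx andbT.
    move: (fm); rewrite !monicE [X in lead_coef X == 1 -> _](divp_eq f M).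
    rewrite lead_coefDl ?lead_coef_Mmonic //.
    rewrite (leq_trans (_ : _ < size M)%N) ?ltn_modp // size_Mmonic // MD addnS /=.
    by rewrite -{1}(add0n D) ltn_add2r size_poly_gt0.
  case=> -[t r] /= [+ rD ->]; rewrite mem_monics => /andP[tm /eqP ts].
  have sr : (size r < size (t * M)%R)%N.
    by rewrite size_Mmonic ?monic_neq0 // ts MD addnS /= addSn ltnS (leq_trans _ (leq_addl _ _)) // -mem_polys.
  rewrite monicE lead_coefDl // lead_coef_Mmonic // (eqP tm) eqxx size_polyDl //.
  by rewrite size_Mmonic ?monic_neq0 // ts MD addnS.
rewrite (perm_big _ p1) big_allpairs_dep /= -size_monics mulr_natl.
rewrite (eq_bigr (fun=> \sum_(r <- polys D) psi r)) => [|t _].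
  by rewrite big_const_seq count_predT iter_addr_0.
by apply: eq_bigr => r _; apply: per; rewrite addrK dvdp_mull.
Qed.

(** Multiplication by a unit [w] of character value [-1] permutes the residue
    classes modulo [M] and changes the sign of the sum. *)
Lemma sum_char0 (psi : R -> int) w :
  (forall f g, M %| f - g -> psi f = psi g) -> {morph psi : x y / x * y} ->
  coprimep w M -> psi w = -1 -> \sum_(r <- polys D) psi r = 0.
Proof.
move=> per mult cw pw; have M0 : M != 0 by rewrite monic_neq0.
have p1 : perm_eq (polys D) [seq (w * r) %% M | r <- polys D].
  have inj : {in polys D &, injective (fun r => (w * r) %% M)}.
    move=> r r'; rewrite !mem_polys => rD r'D e.
    have : M %| w * (r - r').
      by rewrite mulrBr /dvdp modpD modpN e subrr.
    rewrite Gauss_dvdpr 1?coprimep_sym //; apply: contraTeq; rewrite -subr_eq0 => d0.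
    apply/negP => /(dvdp_leq d0); apply/negP; rewrite -ltnNge MD ltnS.
    by rewrite (leq_trans (size_polyD _ _)) // geq_max size_polyN rD.
  have sub : {subset [seq (w * r) %% M | r <- polys D] <= polys D}.
    by move=> _ /mapP[r _ ->]; rewrite mem_polys -ltnS -MD ltn_modp.
  have us : uniq [seq (w * r) %% M | r <- polys D].
    by rewrite map_inj_in_uniq ?polys_uniq.
  have [|_ e] := uniq_min_size us sub; first by rewrite [X in (_ <= X)%N]size_map.
  by apply: uniq_perm; rewrite ?polys_uniq // => x; rewrite e.
have hs : \sum_(r <- polys D) psi r = - \sum_(r <- polys D) psi r.
  rewrite {1}(perm_big _ p1) big_map -sumrN; apply: eq_bigr => r _.
  rewrite (per _ (w * r)) ?mult ?pw ?mulN1r //.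
  by rewrite {2}(divp_eq (w * r) M) opprD addrCA subrr addr0 dvdpNr dvdp_mull.
by apply/eqP; have /eqP := hs; rewrite -addr_eq0 -mulr2n mulrn_eq0.
Qed.
End Enumerate.

(** * A prime at which two quadratic characters are both -1 *)

(** Let [ca] and [cb] be two completely multiplicative sign functions that vanish
    at the same primes. If no prime [p] has [ca p = cb p = -1], their Dirichlet
    convolution is nonnegative, and at least 1 at the squares where they do not
    vanish: on a power of another prime it is one of the sums [1 + ... + 1] and
    [1 - 1 + 1 - ...]. Hence its sum [S n] over the monic
    polynomials of degree [n] is nonnegative for every [n] and positive for some
    large [n]. But if the sums of [ca] vanish in large degree and those of [cb]
    are multiplied by [- q] from one degree to the next, the same holds of [S],
    so that [S (n + 1) = - q * S n] is negative. This contradiction replaces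
    the nonvanishing of L-functions at 1. *)
Section Convolution.
Variable E : finFieldType.
Local Notation R := {poly E}.
Local Notation q := #|E|.

Definition mdivs (f : R) : seq R :=
  [seq u <- flatten [seq monics E i | i <- iota 0 (size f)] | u %| f].

Lemma monics_flatten_uniq s : uniq s -> uniq (flatten [seq monics E i | i <- s]).
Proof.
elim: s => //= i s IH /andP[ins us]; rewrite cat_uniq monics_uniq IH //= andbT.
apply/hasPn => f /flattenP[_ /mapP[j js ->]]; rewrite !mem_monics => /andP[_ /eqP fj].
apply/negP => /andP[_]; rewrite fj eqSS => /eqP ji.
by move: ins; rewrite -ji js.
Qed.

Lemma mem_mdivs f u : f != 0 -> (u \in mdivs f) = (u \is monic) && (u %| f).
Proof.
move=> f0; rewrite mem_filter andbC; apply/andP/andP => -[h uf]; split=> //.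
  by move/flattenP: h => [_ /mapP[j js ->]]; rewrite mem_monics => /andP[].
apply/flattenP; exists (monics E (size u).-1); last first.
  by rewrite mem_monics h prednK ?eqxx // size_poly_gt0 monic_neq0.
apply: map_f; rewrite mem_iota add0n /=.
have := dvdp_leq f0 uf; have := monic_neq0 h; rewrite -size_poly_gt0.
by case: (size u).
Qed.

Lemma mdivs_uniq f : uniq (mdivs f).
Proof. by rewrite filter_uniq // monics_flatten_uniq // iota_uniq. Qed.

Variables (ca cb : R -> int).
Hypotheses (caM : {morph ca : x y / x * y}) (cbM : {morph cb : x y / x * y}).
Hypotheses (ca1 : ca 1 = 1) (cb1 : cb 1 = 1).

Definition conv (f : R) : int := \sum_(u <- mdivs f) ca u * cb (f %/ u).

Lemma cbX x n : cb (x ^+ n) = cb x ^+ n.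
Proof. by elim: n => [|n IH]; rewrite ?expr0 // !exprS cbM IH. Qed.

(** The divisors of [p ^ (k + 1) * g] are those divisible by [p], which are [p]
    times the divisors of [p ^ k * g], and the divisors of [g]. *)
Lemma conv_rec p g k : mirr p -> g \is monic -> ~~ (p %| g) ->
  conv (p ^+ k.+1 * g) = ca p * conv (p ^+ k * g) + cb p ^+ k.+1 * conv g.
Proof.
move=> [pI pm] gm npg; set f := p ^+ k.+1 * g.
have p0 : p != 0 by rewrite monic_neq0.
have g0 : g != 0 by rewrite monic_neq0.
have f0 : f != 0 by rewrite mulf_neq0 // expf_neq0.
have f'0 : p ^+ k * g != 0 by rewrite mulf_neq0 // expf_neq0.
rewrite /conv (bigID (fun u => p %| u)) /=; congr (_ + _).
  rewrite -big_filter (perm_big [seq p * u | u <- mdivs (p ^+ k * g)]); last first.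
    apply: uniq_perm => [||u]; first exact/filter_uniq/mdivs_uniq.
      by rewrite (map_inj_uniq (mulfI p0)) mdivs_uniq.
    rewrite mem_filter mem_mdivs //; apply/and3P/mapP.
      move=> [/dvdpP[v ->] um uf]; exists v; last by rewrite mulrC.
      rewrite mem_mdivs //; move: um uf; rewrite monicMr // => -> /=.
      by rewrite /f exprSr -mulrA [p * g]mulrC mulrA dvdp_mul2r.
    move=> [v]; rewrite mem_mdivs // => /andP[vm vf] ->; split.
    - by rewrite dvdp_mulr.
    - by rewrite monicMl.
    - by rewrite /f exprS -mulrA dvdp_mul2l.
  rewrite big_map big_distrr /=; apply: eq_big_seq => u.
  rewrite mem_mdivs // => /andP[/monic_neq0 u0 _].
  by rewrite caM /f exprS -[p * _ * g]mulrA divp_pmul2l // mulrA.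
rewrite -big_filter (perm_big (mdivs g)); last first.
  apply: uniq_perm => [||u]; [exact/filter_uniq/mdivs_uniq|exact: mdivs_uniq|].
  rewrite mem_filter !mem_mdivs //; apply/and3P/andP => [[pu um uf]|[um ug]].
    split=> //; move: uf; rewrite /f Gauss_dvdpr //.
    by rewrite coprimep_expr // coprimep_sym irreducible_poly_coprime.
  split=> //; last by rewrite /f dvdp_mull.
  by apply: contra npg => pu; apply: dvdp_trans ug.
rewrite big_distrr /=; apply: eq_big_seq => u.
rewrite mem_mdivs // => /andP[um ug].
by rewrite /f -divp_mulA // cbM cbX mulrCA.
Qed.

Lemma conv1 : conv 1 = 1.
Proof.
rewrite /conv (perm_big [:: 1 : R]); last first.
  apply: uniq_perm; rewrite ?mdivs_uniq // => u.
  rewrite mem_mdivs ?oner_neq0 // inE dvdp1; apply/andP/eqP => [[um /size_poly1P[c c0 uE]]|->].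
    by move: um; rewrite uE monicE lead_coefC => /eqP->.
  by rewrite monic1 size_poly1.
by rewrite big_seq1 divp1 ca1 cb1.
Qed.

Hypothesis noneg : forall p, mirr p ->
  [\/ ca p = 0 /\ cb p = 0, ca p = 1 /\ cb p = 1, ca p = 1 /\ cb p = -1
    | ca p = -1 /\ cb p = 1].

Lemma conv_local p g : mirr p -> g \is monic -> ~~ (p %| g) -> forall k,
  exists2 c : int, conv (p ^+ k * g) = c * conv g &
   (0 <= c) && ((ca p != 0) ==> ~~ odd k ==> (1 <= c)).
Proof.
move=> pP gm npg; have base : conv (p ^+ 0 * g) = conv g by rewrite expr0 mul1r.
have rec k := conv_rec k pP gm npg.
case: (noneg pP) => -[pa pb]; move: rec; rewrite pa pb => rec k.
- case: k => [|k]; first by exists 1; rewrite ?base ?mul1r.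
  by exists 0 => //; rewrite rec !mul0r expr0n mul0r addr0.
- exists (k.+1)%:R; last by rewrite /= ler0n ler1n /= !implybT.
  elim: k => [|k IH]; first by rewrite base mul1r.
  by rewrite rec IH expr1n !mul1r -[in RHS]natr1 mulrDl mul1r.
- exists (~~ odd k)%:R; last by case: (odd k).
  elim: k => [|k IH]; first by rewrite base mul1r.
  rewrite rec IH mul1r -mulrDl -signr_odd /=; congr (_ * _).
  by case: (odd k).
- exists (~~ odd k)%:R; last by case: (odd k).
  elim: k => [|k IH]; first by rewrite base mul1r.
  rewrite rec IH expr1n mulN1r mul1r /= -mulNr -{2}[conv g]mul1r -mulrDl.
  by case: (odd k).
Qed.

Lemma monic_ind_padic (P : R -> Prop) : P 1 ->
  (forall p g k, mirr p -> g \is monic -> ~~ (p %| g) -> (0 < k)%N -> P g ->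
     P (p ^+ k * g)) ->
  forall f, f \is monic -> P f.
Proof.
move=> P1 Pp f; have [n] := ubnP (size f); elim: n f => // n IH f sf fm.
have [f1|f1] := leqP (size f) 1.
  suff -> : f = 1 by [].
  have fE := size1_polyC f1.
  by move: fm; rewrite fE monicE lead_coefC => /eqP->.
have [p [pI pm pf]] := monic_irreducible_factor f1.
have [p1 _] := pI.
have [k [g [fE npg]]] := padic_split p1 (monic_neq0 fm).
have gm : g \is monic by move: fm; rewrite fE monicMl // monic_exp.
have pk : (0 < k)%N by case: k fE => // fE; move: npg pf; rewrite fE mul1r => /negPf->.
rewrite {}fE in sf *; apply: (Pp) => //; apply: IH => //.
rewrite -ltnS; apply: leq_trans sf; rewrite ltnS.
have pk0 : p ^+ k != 0 by rewrite expf_neq0 ?monic_neq0.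
have : (size p <= size (p ^+ k)%R)%N by rewrite dvdp_leq // -(prednK pk) exprS dvdp_mulr.
rewrite size_mul ?(monic_neq0 gm) //.
by move/(leq_trans p1); case: (size (p ^+ k)) => [//|[//|m]] _; rewrite !addSn /= ltnS leq_addl.
Qed.

Lemma conv_ge0 f : f \is monic -> 0 <= conv f.
Proof.
elim/monic_ind_padic; first by rewrite conv1.
move=> p g k pP gm npg _ IH; have [c -> /andP[c0 _]] := conv_local pP gm npg k.
exact: mulr_ge0.
Qed.

Lemma conv_sqr_ge1 g : g \is monic -> (forall p, mirr p -> p %| g -> ca p != 0) ->
  1 <= conv (g ^+ 2).
Proof.
elim/monic_ind_padic => [_|]; first by rewrite expr1n conv1.
move=> p g' k pP gm npg k0 IH hp.
have pI : irreducible_poly p by case: pP.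
have npg2 : ~~ (p %| g' ^+ 2) by rewrite irr_dvdX.
rewrite exprMn -exprM muln2.
have [c -> /andP[_]] := conv_local pP (monic_exp 2 gm) npg2 k.*2.
rewrite odd_double hp //=; last by rewrite dvdp_mulr // -(prednK k0) exprS dvdp_mulr.
move=> c1; rewrite -[1]mulr1; apply: ler_pM => //; apply: IH => p' p'P p'g.
by apply: hp => //; rewrite dvdp_mull.
Qed.

Let asum n := \sum_(u <- monics E n) ca u.
Let bsum n := \sum_(u <- monics E n) cb u.

Lemma conv_sum n : \sum_(f <- monics E n) conv f = \sum_(i < n.+1) asum i * bsum (n - i).
Proof.
pose A := flatten [seq monics E i | i <- iota 0 n.+1].
have AS : {in monics E n, forall f, conv f = \sum_(u <- A | u %| f) ca u * cb (f %/ u)}.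
  by move=> f; rewrite mem_monics => /andP[_ /eqP fn]; rewrite /conv /mdivs fn big_filter.
rewrite (eq_big_seq _ AS) (exchange_big_dep xpredT) //= /A big_flatten big_map.
rewrite -[iota 0 n.+1]/(index_iota 0 n.+1) big_mkord; apply: eq_bigr => i _.
rewrite big_distrl /=; apply: eq_big_seq => u.
rewrite mem_monics => /andP[um /eqP us]; have u0 := monic_neq0 um.
have iN : (i <= n)%N by rewrite -ltnS.
rewrite -big_filter (perm_big [seq u * v | v <- monics E (n - i)]); last first.
  apply: uniq_perm => [||f]; first exact/filter_uniq/monics_uniq.
    by rewrite (map_inj_uniq (mulfI u0)) monics_uniq.
  rewrite mem_filter; apply/andP/mapP => [[/dvdpP[v ->]]|[v]].
    rewrite mem_monics monicMr // => /andP[vm]; rewrite size_Mmonic ?monic_neq0 //.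
    rewrite us addnS /= => /eqP vs; exists v; last by rewrite mulrC.
    rewrite mem_monics vm -subSn //; apply/eqP.
    by rewrite -[size v](addnK (i : nat)) vs.
  rewrite mem_monics => /andP[vm /eqP vs] ->; rewrite dvdp_mulr // mem_monics monicMl //.
  rewrite vm size_Mmonic ?monic_neq0 // us vs; split=> //.
  by rewrite addnS /= addSn subnKC.
rewrite big_map /bsum big_distrr /=; apply: eq_bigr => v _.
by rewrite mulKp.
Qed.

Variables (D : nat).
Hypothesis asum0 : forall n, (D <= n)%N -> asum n = 0.
Hypothesis bsumS : forall n, (D <= n)%N -> bsum n.+1 = - (q%:R) * bsum n.

(** In the convolution formula for degree [n >= 2 D], each term has an index
    at least [D] on one side: either [asum] vanishes, or [bsum] obeys its
    recurrence. *)
Lemma conv_absurd g : g \is monic -> (forall p, mirr p -> p %| g -> ca p != 0) ->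
  (2 * D <= (size (g ^+ 2)).-1)%N -> False.
Proof.
move=> gm gp; set n := (size (g ^+ 2)).-1 => Dn.
have Spos : 1 <= \sum_(f <- monics E n) conv f.
  have gS : g ^+ 2 \in monics E n.
    rewrite mem_monics monic_exp //= /n prednK ?eqxx //.
    by rewrite size_poly_gt0 monic_neq0 ?monic_exp.
  rewrite (big_rem _ gS) /= -[1]addr0; apply: lerD; first exact: conv_sqr_ge1.
  rewrite big_seq; apply: sumr_ge0 => f /mem_rem.
  by rewrite mem_monics => /andP[fm _]; apply: conv_ge0.
have Sneg : \sum_(f <- monics E n.+1) conv f = - q%:R * \sum_(f <- monics E n) conv f.
  rewrite !conv_sum big_ord_recr /= asum0 ?mul0r ?addr0; last first.
    by apply: leq_trans (leqnSn n); apply: leq_trans Dn; rewrite leq_pmull.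
  rewrite big_distrr /=; apply: eq_bigr => i _.
  have [Di|iD] := leqP D i; first by rewrite asum0 // !mul0r mulr0.
  have iN : (i <= n)%N by rewrite -ltnS.
  rewrite subSn // bsumS; first by rewrite mulrCA.
  by move: Dn iD; lia.
have : 0 <= \sum_(f <- monics E n.+1) conv f.
  rewrite big_seq; apply: sumr_ge0 => f.
  by rewrite mem_monics => /andP[fm _]; apply: conv_ge0.
rewrite Sneg mulNr oppr_ge0 leNgt => /negP[].
rewrite mulr_gt0 ?(lt_le_trans ltr01 Spos) // ltr0n.
exact: ltnW (finNzRing_gt1 E).
Qed.
End Convolution.

Section SymbolProducts.
Variable E : finFieldType.
Hypothesis oddE : odd #|E|.
Local Notation R := {poly E}.
Local Notation q := #|E|.
Local Notation deg p := (size (p : R)).-1.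

Lemma poly_crt (x y a b : R) : coprimep x y -> exists z, (x %| z - a) && (y %| z - b).
Proof.
move=> /Bezout_coprimepP[[u v] /= h]; pose t := u * x + v * y.
have [c c0 tE] : exists2 c, c != 0 & t = c%:P.
  by move: h; rewrite -size_poly_eq1 => /size_poly1P[c c0 e]; exists c.
exists (c^-1%:P * (a * (v * y) + b * (u * x))).
have cK : c^-1%:P * t = 1 by rewrite tE -rmorphM mulVf.
apply/andP; split.
  have -> : c^-1%:P * (a * (v * y) + b * (u * x)) - a =
    (c^-1%:P * u * (b - a)) * x + a * (c^-1%:P * t - 1) by rewrite /t; ring.
  by rewrite cK subrr mulr0 addr0 dvdp_mull.
have -> : c^-1%:P * (a * (v * y) + b * (u * x)) - b =
  (c^-1%:P * v * (a - b)) * y + b * (c^-1%:P * t - 1) by rewrite /t; ring.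
by rewrite cK subrr mulr0 addr0 dvdp_mull.
Qed.

Definition legs (s : seq R) (x : R) : int := \prod_(p <- s) leg (p : R) x.

Lemma leg1 (p : R) : mirr p -> leg p 1 = 1.
Proof.
move=> [[s1 _] _]; apply: (@legP _ _ _ 1); last by rewrite expr1n subrr dvdp0.
by rewrite dvdp1; case: (size p) s1 => // -[].
Qed.

Lemma legs1 s : {in s, forall p, mirr p} -> legs s 1 = 1.
Proof. by move=> hs; rewrite /legs big_seq big1 // => p /hs/leg1. Qed.

Lemma legsM s : {in s, forall p, mirr p} -> {morph legs s : x y / x * y}.
Proof.
move=> hs x y; rewrite /legs -big_split /= big_seq [RHS]big_seq.
by apply: eq_bigr => p /hs/(legM oddE)->.
Qed.

Lemma legs_sign s x : legs s x \in [:: 0; 1; -1].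
Proof.
by rewrite /legs; elim/big_rec: _ => // p t _ ht; rewrite signsM ?leg_sign.
Qed.

Lemma legs_eq0 s x : (legs s x == 0) = has (fun p => p %| x) s.
Proof.
rewrite /legs; elim: s => [|p s IH]; first by rewrite big_nil oner_eq0.
by rewrite big_cons mulf_eq0 leg_eq0 IH.
Qed.

Variables (s : seq R) (M : R).
Hypotheses (sI : {in s, forall p, mirr p}) (us : uniq s).
Hypotheses (Mm : M \is monic) (sM : {in s, forall p, p %| M}).

(** Cutting the product of symbols off at a common modulus [M] makes all the
    characters vanish at the same primes. *)
Definition mchar (x : R) : int := if coprimep x M then legs s x else 0.

Lemma mchar1 : mchar 1 = 1.
Proof. by rewrite /mchar coprime1p legs1. Qed.

Lemma mcharM : {morph mchar : x y / x * y}.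
Proof.
move=> x y; rewrite /mchar coprimepMl legsM //.
by case: (coprimep x M); case: (coprimep y M); rewrite ?mulr0 ?mul0r.
Qed.

Lemma mchar_periodic f g : M %| f - g -> mchar f = mchar g.
Proof.
move=> fg; have e : f %% M = g %% M.
  by apply/eqP; rewrite -subr_eq0 -modpN -modpD; apply: fg.
rewrite /mchar -coprimep_modl e coprimep_modl; case: ifP => // _.
rewrite /legs big_seq [RHS]big_seq; apply: eq_bigr => p ps.
by apply: leg_cong; apply: dvdp_trans (sM ps) fg.
Qed.

Lemma mchar_dvd p : mirr p -> p %| M -> mchar p = 0.
Proof. by move=> [pI _] pM; rewrite /mchar irreducible_poly_coprime // pM. Qed.

Lemma mchar_ndvd p : mirr p -> ~~ (p %| M) ->
  mchar p = legs s p /\ (legs s p = 1 \/ legs s p = -1).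
Proof.
move=> pP npM; rewrite /mchar irreducible_poly_coprime ?npM; last by case: pP.
split=> //; have := legs_sign s p; rewrite !inE legs_eq0 => /or3P[|/eqP|/eqP]; try by auto.
move=> /hasP[r rs rp]; case/negP: npM; move: rp; rewrite mirr_dvd //; last exact: sI.
by move=> /eqP <-; apply: sM.
Qed.

(** The Chinese remainder theorem gives a nonresidue modulo one prime of [s]
    that is 1 modulo the part of [M] prime to it. *)
Lemma mchar_nontrivial : s != [::] -> exists w, coprimep w M /\ mchar w = -1.
Proof.
move=> s0; have [p [t sE]] : exists p t, s = p :: t.
  by case: (s) s0 => // p t _; exists p, t.
have ps : p \in s by rewrite sE inE eqxx.
have pP := sI ps; have [pI _] := pP; have [p1 _] := pI.
have [k [M' [ME npM']]] := padic_split p1 (monic_neq0 Mm).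
have [x px] := leg_nonresidue oddE pP.
have cp : coprimep p M' by rewrite irreducible_poly_coprime.
have [w /andP[wx w1]] := poly_crt x 1 cp.
have lw : leg p w = -1 by rewrite (leg_cong wx).
have cw : coprimep w M.
  rewrite ME coprimepMr; apply/andP; split.
    by rewrite coprimep_expr // coprimep_sym irreducible_poly_coprime // -leg_eq0 lw.
  by rewrite -coprimep_modl (_ : w %% M' = 1 %% M') ?coprimep_modl ?coprime1p //;
     apply/eqP; rewrite -subr_eq0 -modpN -modpD; apply: w1.
exists w; split=> //; rewrite /mchar cw /legs sE big_cons lw big_seq big1 ?mulr1 // => r rt.
have rs : r \in s by rewrite sE inE rt orbT.
have rP := sI rs; rewrite -(leg1 rP); apply: leg_cong; apply: dvdp_trans w1.
have := sM rs; rewrite ME irr_dvdM; last by case: rP.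
case/orP => //; rewrite irr_dvdX; last by case: rP.
case/andP=> _; rewrite [r %| p]mirr_dvd // => /eqP rp.
by move: us; rewrite sE /= -rp rt.
Qed.
End SymbolProducts.

Section PrimeExistence.
Variable E : finFieldType.
Hypothesis oddE : odd #|E|.
Local Notation R := {poly E}.
Local Notation q := #|E|.
Local Notation deg p := (size (p : R)).-1.

(** The sign [sigma] covers the twist by the parity of the degree, that is, the
    constant extension of degree 2. The sums of the first character vanish in
    large degree because [s] is nonempty; those of the second one vanish as
    well when [t] is nonempty, and are multiplied by [- q] from one degree to the
    next when [sigma = -1]. *)
Lemma prime_with_symbols (s t : seq R) (sigma : int) (N : R) :
  {in s, forall p, mirr p} -> uniq s -> s != [::] ->
  {in t, forall p, mirr p} -> uniq t -> sigma ^+ 2 = 1 ->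
  (t != [::]) || (sigma == -1) -> N != 0 ->
  exists p, [/\ mirr p, ~~ (p %| N), legs s p = -1 & sigma ^+ deg p * legs t p = -1].
Proof.
move=> sI us s0 tI ut sig tsig N0.
have prod0 (l : seq R) : {in l, forall p, mirr p} -> \prod_(p <- l) p != 0.
  move=> hl; rewrite prodf_seq_neq0; apply/allP => p /hl[_ pm].
  by rewrite /= monic_neq0.
pose M0 := N * (\prod_(p <- s) p * \prod_(p <- t) p).
have M00 : M0 != 0 by rewrite !mulf_neq0 ?prod0.
pose M := (lead_coef M0)^-1 *: M0.
have lc0 : (lead_coef M0)^-1 != 0 by rewrite invr_eq0 lead_coef_eq0.
have Mm : M \is monic by rewrite monicE lead_coefZ mulVf ?lead_coef_eq0.
have dM x : (x %| M) = (x %| M0) by rewrite dvdpZr.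
have sM : {in s, forall p, p %| M}.
  move=> p ps; rewrite dM /M0 dvdp_mull // dvdp_mulr //.
  by rewrite (big_rem _ ps) /= dvdp_mulr.
have tM : {in t, forall p, p %| M}.
  move=> p ps; rewrite dM /M0 dvdp_mull // dvdp_mull //.
  by rewrite (big_rem _ ps) /= dvdp_mulr.
have M1 : (1 < size M)%N.
  case: (s) s0 sM sI => // p l _ hM hI.
  have [[p1 _] _] := hI p (mem_head _ _).
  exact: leq_trans p1 (dvdp_leq (monic_neq0 Mm) (hM p (mem_head _ _))).
pose D := deg M; have MD : size M = D.+1 by rewrite prednK // ltnW.
pose ca := mchar s M; pose cb x := sigma ^+ deg x * mchar t M x.
have mchar0 l : mchar l M 0 = 0.
  by rewrite /mchar coprime0p -size_poly_eq1 gtn_eqF.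
have cbM : {morph cb : x y / x * y}.
  move=> x y; rewrite /cb; have [->|x0] := eqVneq x 0.
    by rewrite !mul0r mchar0 !mulr0 mul0r.
  have [->|y0] := eqVneq y 0; first by rewrite !mulr0 mchar0 !mulr0.
  rewrite mcharM // size_mul //.
  have -> : (size x + size y).-2 = (deg x + deg y)%N.
    by move: x0 y0; rewrite -!size_poly_gt0; case: (size x) (size y) => [//|a] [//|b]; rewrite addSn addnS.
  by rewrite exprD; ring.
apply: contrapT => hno.
have noneg p : mirr p ->
  [\/ ca p = 0 /\ cb p = 0, ca p = 1 /\ cb p = 1, ca p = 1 /\ cb p = -1
    | ca p = -1 /\ cb p = 1].
  move=> pP; have [pM|npM] := boolP (p %| M).
    by apply: Or41; rewrite /ca /cb !mchar_dvd // mulr0.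
  have [caE cas] := mchar_ndvd sI sM pP npM.
  have [cbE cbs] := mchar_ndvd tI tM pP npM.
  have npN : ~~ (p %| N) by apply: contra npM => pN; rewrite dM /M0 dvdp_mulr.
  have cb1 : cb p = 1 \/ cb p = -1.
    rewrite /cb cbE; have : sigma ^+ deg p = 1 \/ sigma ^+ deg p = -1.
      by move/eqP: sig; rewrite sqrf_eq1 => /orP[]/eqP->; rewrite ?expr1n -1?signr_odd; [left|case: odd; [right|left]].
    by case: cbs => -> [] ->; [left|right|right|left]; rewrite ?mulr1 ?mulrN1 ?opprK.
  rewrite /ca caE; case: cas cb1 => h1 [h2|h2].
  - by apply: Or42.
  - by apply: Or43.
  - by apply: Or44.
  - exfalso; apply: hno; exists p; split=> //.
    by rewrite -cbE.
(* [M + 1] is prime to [M], and its square has degree exactly [2 * D]. *)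
have gM : M + 1 \is monic.
  by rewrite monicE lead_coefDl ?size_poly1 //; apply: Mm.
have gdeg : (2 * D <= (size ((M + 1) ^+ 2)%R).-1)%N.
  have g0 := monic_neq0 gM.
  rewrite expr2 size_mul // size_polyDl ?size_poly1 // MD addSn addnS /= mul2n.
  by rewrite -addnn.
have gp p : mirr p -> p %| M + 1 -> ca p != 0.
  move=> pP pg; have npM : ~~ (p %| M).
    apply/negP => pM; move: pg; rewrite dvdp_addr // dvdp1.
    by case: pP => -[]; case: (size p) => // -[].
  by rewrite /ca; have [-> [|] ->] := mchar_ndvd sI sM pP npM.
have [w [cw pw]] := mchar_nontrivial oddE sI us Mm sM s0.
have perA := @mchar_periodic _ s M sM; have perB := @mchar_periodic _ t M tM.
apply: (@conv_absurd E ca cb (mcharM oddE M sI) cbM (mchar1 M sI) _ noneg D _ _ _ gM gp gdeg).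
- by rewrite /cb size_poly1 expr0 mul1r mchar1.
- move=> n Dn; rewrite -(subnK Dn) (sum_periodic Mm MD _ perA).
  by rewrite (sum_char0 Mm MD perA (mcharM oddE M sI) cw pw) mulr0.
move=> n Dn.
have bE m : \sum_(u <- monics E (m + D)) cb u =
    sigma ^+ (m + D) * ((q ^ m)%:R * \sum_(r <- polys E D) mchar t M r).
  rewrite -(sum_periodic Mm MD _ perB) big_distrr /=; apply: eq_big_seq => u.
  by rewrite mem_monics => /andP[_ /eqP us']; rewrite /cb us'.
rewrite -(subnK Dn) -addSn !bE expnS natrM.
case/orP: tsig => [t0|/eqP->]; last by rewrite addSn exprS; ring.
have [w' [cw' pw']] := mchar_nontrivial oddE tI ut Mm tM t0.
by rewrite (sum_char0 Mm MD perB (mcharM oddE M tI) cw' pw') !mulr0.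
Qed.
End PrimeExistence.

(** * Linear algebra over the field with two elements *)

Section F2Duality.

Lemma F2_neq0 (x : 'F_2) : x != 0 -> x = 1.
Proof. by case: x => [[|[|//]]] //= h _; apply: val_inj. Qed.

(** A vector outside the span of [A] is separated from it by a linear form;
    over the field with two elements a linear combination is a sum over a
    subset, and a linear form is a sum of coordinates. *)
Lemma F2_span_or_separate (r : nat) (A : 'rV['F_2]_r -> Prop) (w : 'rV['F_2]_r) :
  (exists2 S : {set 'rV['F_2]_r}, (forall v, v \in S -> A v) & w = \sum_(v in S) v) \/
  (exists2 I : {set 'I_r}, (forall v, A v -> \sum_(i in I) v 0 i = 0) &
     \sum_(i in I) w 0 i = 1).
Proof.
pose B := \matrix_(k < #|{: 'rV['F_2]_r}|)
  (if `[< A (enum_val k) >] then enum_val k else 0).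
have [/submxP[u wE]|wB] := boolP (w <= B)%MS.
  left; exists [set v | `[< A v >] && (u 0 (enum_rank v) != 0)].
    by move=> v; rewrite inE => /andP[/asboolP].
  rewrite wE mulmx_sum_row (reindex enum_rank) /=; last first.
    by exists enum_val => x _; rewrite ?enum_rankK ?enum_valK.
  rewrite big_mkcond [RHS]big_mkcond; apply: eq_bigr => v _ /=.
  rewrite inE rowK enum_rankK; case: asboolP => [_|_] /=; last by rewrite scaler0.
  by have [->|/F2_neq0->] := eqVneq (u 0 (enum_rank v)) 0; rewrite ?scale0r ?scale1r.
right; have [j wj] : exists j, (w *m cokermx B) 0 j != 0.
  apply/existsP; apply: contraNT wB; rewrite negb_exists => /forallP h.
  rewrite submxE; apply/eqP/rowP => j; rewrite [RHS]mxE; apply/eqP; have := h j.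
  by rewrite negbK.
have key v : (v *m cokermx B) 0 j = \sum_(i in [set i | cokermx B i j != 0]) v 0 i.
  rewrite mxE [RHS]big_mkcond; apply: eq_bigr => i _; rewrite inE.
  by have [->|/F2_neq0->] := eqVneq (cokermx B i j) 0; rewrite ?mulr0 ?mulr1.
exists [set i | cokermx B i j != 0]; last by rewrite -key; exact: F2_neq0.
move=> v Av; rewrite -key.
have -> : v = row (enum_rank v) B by rewrite rowK enum_rankK; case: asboolP.
by rewrite -row_mul mulmx_coker !mxE.
Qed.

Definition sgF2 (x : 'F_2) : int := if x == 0 then 1 else -1.

Lemma sgF2D : {morph sgF2 : x y / x + y >-> x * y}.
Proof. by case=> [[|[|//]] hx] [[|[|//]] hy]. Qed.

Lemma sgF2_sum I (s : seq I) (P : pred I) (f : I -> 'F_2) :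
  sgF2 (\sum_(i <- s | P i) f i) = \prod_(i <- s | P i) sgF2 (f i).
Proof. exact: (big_morph sgF2 sgF2D). Qed.

Lemma sgF2_log (s : int) : s \in [:: 0; 1; -1] -> s != 0 ->
  exists x : 'F_2, s = sgF2 x.
Proof. by rewrite !inE => /or3P[]/eqP-> // _; [exists 0|exists 1]. Qed.
End F2Duality.

(** * The product formula *)

Section Signs.
Variables (s : int).
Hypothesis s2 : s ^+ 2 = 1.
Lemma signX_odd n : s ^+ n = s ^+ odd n.
Proof. by rewrite -{1}[n]odd_double_half exprD -mul2n exprM s2 expr1n mulr1. Qed.
End Signs.

Section ProductFormula.
Variable E : finFieldType.
Hypothesis oddE : odd #|E|.
Local Notation R := {poly E}.
Local Notation deg p := (size (p : R)).-1.
Local Notation kappa := (qchar (-1 : E)).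

Lemma qchar_sqr (c : E) : c != 0 -> qchar c ^+ 2 = 1.
Proof. by rewrite /qchar => /negPf->; case: ifP. Qed.

Lemma kappa2 : kappa ^+ 2 = 1.
Proof. by rewrite qchar_sqr // oppr_eq0 oner_eq0. Qed.

Lemma leg_prod p I (s : seq I) (P : pred I) (f : I -> R) : mirr p ->
  leg p (\prod_(i <- s | P i) f i) = \prod_(i <- s | P i) leg p (f i).
Proof. by move=> pP; apply: big_morph; [exact: legM|exact: leg1]. Qed.

Lemma leg_N1 p : mirr p -> leg p (-1) = kappa ^+ deg p.
Proof. by move=> pP; rewrite -leg_const // rmorphN1. Qed.

(** The product over [s] of the residue symbols of the one-dimensional form
    [<k * prod s>], that is, of the classes left after dividing by the prime. *)
Definition theta (k : E) (s : seq R) : int :=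
  \prod_(p <- s) leg p (k%:P * \prod_(r <- s | r != p) r).

(** Each unordered pair of primes contributes the two symbols of one with
    respect to the other, whose product is given by reciprocity; the exponent
    [sum of deg p * deg r] over pairs is a difference of binomials. *)
Lemma thetaE k s : {in s, forall p, mirr p} -> uniq s ->
  theta k s = qchar k ^+ (\sum_(p <- s) deg p) * kappa ^+ 'C(\sum_(p <- s) deg p, 2)
    * \prod_(p <- s) kappa ^+ 'C(deg p, 2).
Proof.
elim: s => [|p s IH] sI /=; first by rewrite /theta !big_nil !expr0 !mulr1.
move=> /andP[ps us]; have pP := sI p (mem_head _ _).
have sI' : {in s, forall p, mirr p} by move=> r rs; apply: sI; rewrite inE rs orbT.
have step : theta k (p :: s) = qchar k ^+ deg p *
    kappa ^+ (deg p * \sum_(r <- s) deg r) * theta k s.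
  rewrite /theta big_cons big_cons eqxx /=.
  have -> : \prod_(r <- s | r != p) r = \prod_(r <- s) r.
    rewrite big_seq_cond [RHS]big_seq; apply: eq_bigl => r.
    by case: eqP => [->|_]; rewrite ?(negPf ps) ?andbT.
  rewrite legM // leg_const // leg_prod // -!mulrA; congr (_ * _).
  rewrite big_distrr /= -prodrXr -!big_split /= big_seq [RHS]big_seq.
  apply: eq_bigr => r rs; have rP := sI' r rs.
  rewrite big_cons ifT; last by apply: contraNneq ps => ->.
  rewrite mulrCA [leg r (p * _)]legM // mulrA; congr (_ * _).
  rewrite leg_recip // mulrAC -expr2.
  have -> : leg r p ^+ 2 = 1; last by rewrite mul1r.
  have := leg_sign r p; rewrite !inE leg_eq0 mirr_dvd // => /or3P[/eqP e|/eqP->|/eqP->] //.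
  by move: ps; rewrite -e rs.
rewrite step IH // !big_cons.
have -> : 'C(deg p + \sum_(r <- s) deg r, 2) =
    ('C(deg p, 2) + 'C(\sum_(r <- s) deg r, 2) + deg p * \sum_(r <- s) deg r)%N.
  move: (deg p) (\sum_(r <- s) _)%N => m n.
  elim: m => [|m IHm]; first by rewrite add0n bin0n mul0n addn0.
  by rewrite addSn !binS IHm !bin1 mulSn; lia.
rewrite !exprD.
set a := qchar k ^+ deg p; set b := kappa ^+ (_ * _); set c := qchar k ^+ _.
set d := kappa ^+ _; set e := \prod_(r <- s) _; set f := kappa ^+ _.
have f2 : f * f = 1 by rewrite -expr2 -exprM mulnC exprM kappa2 expr1n.
by rewrite -[LHS]mulr1 -f2; ring.
Qed.
End ProductFormula.

(** * Existence of the auxiliary multiplier *)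

(** The form is [sum_i entry i * x_i ^ 2] with squarefree coefficients [entry i]
    whose primes are listed in [T]; [J p] is the set of indices of the
    coefficients divisible by [p]. Each prime divides one or two coefficients.
    The primes that divide a single one, [oddT], are those of the squarefree
    part [disc] of the discriminant; [cof] and [dcof] are the cofactors of [p].

    The hypotheses [resT] and [resI] are the traces of local isotropy: at a
    prime dividing two coefficients, these two cancel modulo [p ^ 2]; at
    infinity, when the discriminant is locally a square, the part of odd degree
    is hyperbolic. *)
Section AuxiliaryMultiplier.
Variable E : finFieldType.
Hypothesis oddE : odd #|E|.
Local Notation R := {poly E}.
Local Notation deg p := (size (p : R)).-1.
Local Notation kappa := (qchar (-1 : E)).
Variables (T : seq R) (J : R -> {set 'I_4}) (l : 'I_4 -> E).
Hypotheses (TI : {in T, forall p, mirr p}) (uT : uniq T).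
Hypothesis (J12 : {in T, forall p, #|J p| = 1%N \/ #|J p| = 2%N}).
Hypothesis (l0 : forall i, l i != 0).

Definition entry i : R := (l i)%:P * \prod_(p <- T | i \in J p) p.
Definition cof i p : R := (l i)%:P * \prod_(r <- T | (i \in J r) && (r != p)) r.
Definition oddT := [seq p <- T | #|J p| == 1%N].
Definition lall := \prod_i l i.
Definition disc : R := lall%:P * \prod_(p <- oddT) p.
Definition dcof p : R := lall%:P * \prod_(r <- oddT | r != p) r.

Hypothesis resT : {in T, forall p, #|J p| = 2%N ->
  leg p (- \prod_(i in J p) cof i p) = 1}.
Local Notation odds := [set i | odd (deg (entry i))].
Hypothesis resI : ~~ odd (deg disc) -> qchar lall = 1 ->
  kappa ^+ #|odds|./2 * \prod_(i in odds) qchar (l i) = 1.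

Lemma lall_neq0 : lall != 0.
Proof. by apply/prodf_neq0 => i _; apply: l0. Qed.

Lemma oddT_sub p : p \in oddT -> p \in T.
Proof. by rewrite mem_filter => /andP[]. Qed.

Lemma entryE i p : p \in T -> i \in J p -> entry i = p * cof i p.
Proof.
move=> pT ip; rewrite /entry /cof big_mkcond (bigD1_seq p) //= ip mulrCA; congr (_ * (_ * _)).
rewrite big_mkcond [RHS]big_mkcond; apply: eq_bigr => r _.
by case: (_ \in _); case: (_ != _).
Qed.

Lemma discE p : p \in oddT -> disc = p * dcof p.
Proof.
move=> pT; rewrite /disc /dcof (bigD1_seq p) ?filter_uniq //=.
by rewrite mulrCA.
Qed.

Lemma deg_prod (k : E) (s : seq R) (P : pred R) : k != 0 -> {in s, forall p, mirr p} ->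
  deg (k%:P * \prod_(p <- s | P p) p) = (\sum_(p <- s | P p) deg p)%N.
Proof.
move=> k0 sI; rewrite size_Cmul //.
suff [] : (size (\prod_(p <- s | P p) p)).-1 = (\sum_(p <- s | P p) deg p)%N /\
   \prod_(p <- s | P p) p \is monic by [].
elim: s sI => [|p s IH] sI; first by rewrite !big_nil size_poly1 monic1.
have [|IH1 IH2] := IH; first by move=> r rs; apply: sI; rewrite inE rs orbT.
have [_ pm] := sI p (mem_head _ _); rewrite !big_cons; case: (P p); last by [].
rewrite monicMl // -IH1 size_Mmonic ?monic_neq0 //; split=> //.
have := monic_neq0 pm; have := monic_neq0 IH2; rewrite -!size_poly_gt0.
by case: (size p) => [//|a]; case: (size (\prod_(p <- s | P p) p)) => [//|b]; rewrite addSn addnS.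
Qed.

Let D i := (\sum_(p <- T | i \in J p) deg p)%N.

Lemma deg_entry i : deg (entry i) = D i.
Proof. exact: deg_prod. Qed.

Lemma deg_disc : deg disc = (\sum_(p <- oddT) deg p)%N.
Proof. by apply: deg_prod; rewrite ?lall_neq0 // => p /oddT_sub/TI. Qed.

(** For [p] in [oddT] dividing [entry i] only, a polynomial [c] prime to [p] has
    symbol [target p] if and only if [entry i] and [c * disc] cancel modulo [p ^ 2], that is,
    [- cof i p * dcof p * c] is a square modulo [p]. *)
Definition target p : int := leg p (- ((\prod_(i in J p) cof i p) * dcof p)).

Lemma mirr_ndvd_const p (k : E) : mirr p -> k != 0 -> ~~ (p %| k%:P).
Proof.
move=> [[s1 _] _] k0; apply/negP => /dvdp_leq; rewrite polyC_eq0 size_polyC k0.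
by move=> /(_ isT); rewrite leqNgt s1.
Qed.

Lemma mirr_ndvd_prod p (s : seq R) (P : pred R) : mirr p -> {in s, forall r, mirr r} ->
  {in s, forall r, P r -> r != p} -> ~~ (p %| \prod_(r <- s | P r) r).
Proof.
move=> pP sI sp; have [pI _] := pP.
rewrite big_seq_cond; elim/big_rec: _ => [|r y /andP[rs Pr] npy].
  exact: mirr_ndvd_const pP (oner_neq0 _).
by rewrite irr_dvdM // negb_or npy andbT mirr_dvd 1?eq_sym ?sp //; apply: sI.
Qed.

Lemma cof_ndvd i p : p \in T -> ~~ (p %| cof i p).
Proof.
move=> pT; have pP := TI pT; have [pI _] := pP.
rewrite irr_dvdM // negb_or mirr_ndvd_const //=.
by apply: mirr_ndvd_prod => // r _ /andP[].
Qed.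

Lemma dcof_ndvd p : p \in oddT -> ~~ (p %| dcof p).
Proof.
move=> pT; have pP := TI (oddT_sub pT); have [pI _] := pP.
rewrite irr_dvdM // negb_or mirr_ndvd_const ?lall_neq0 //=.
by apply: mirr_ndvd_prod => // r /oddT_sub/TI.
Qed.

Lemma target_neq0 p : p \in oddT -> target p != 0.
Proof.
move=> pT; have pP := TI (oddT_sub pT); have [pI _] := pP.
rewrite leg_eq0 dvdpNr irr_dvdM // negb_or dcof_ndvd // andbT.
elim/big_rec: _ => [|i y _ npy]; first exact: mirr_ndvd_const pP (oner_neq0 _).
by rewrite irr_dvdM // negb_or npy andbT cof_ndvd // oddT_sub.
Qed.

Lemma theta_entry i :
  theta (l i) [seq p <- T | i \in J p] = \prod_(p <- T | i \in J p) leg p (cof i p).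
Proof.
rewrite /theta big_filter; apply: eq_bigr => p ip.
by rewrite big_filter_cond.
Qed.

(** The product of all the residue symbols of the form and of its discriminant
    is computed by [thetaE] in terms of constants and degrees. The primes
    dividing two coefficients contribute 1 by [resT], what remains at the primes
    of [oddT] is the product of the targets, and the constants that reciprocity
    leaves over are those of [resI]: this is an instance of Hilbert
    reciprocity, with infinity as the last place. *)
Lemma product_formula : ~~ odd (deg disc) -> qchar lall = 1 ->
  \prod_(p <- oddT) target p = 1.
Proof.
move=> dev l1.
pose twoT := [seq p <- T | #|J p| != 1%N].
have two p : p \in twoT -> #|J p| = 2%N.
  by rewrite mem_filter => /andP[/eqP h /J12[]].
have perm : perm_eq T (oddT ++ twoT) by rewrite perm_sym perm_filterC.
have signX (m n : nat) : odd m = odd n -> kappa ^+ m = kappa ^+ n.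
  by move=> e; rewrite (signX_odd (kappa2 E) m) e -(signX_odd (kappa2 E)).
have h2 : \prod_(p <- twoT) (leg p (-1) * leg p (\prod_(i in J p) cof i p)) = 1.
  rewrite big_seq big1 // => p pT; have p2 := two _ pT.
  have pT' : p \in T by move: pT; rewrite mem_filter => /andP[].
  by rewrite -legM ?mulN1r ?resT //; apply: TI.
have -> : \prod_(p <- oddT) target p =
    \prod_(p <- T) (leg p (-1) * leg p (\prod_(i in J p) cof i p)) *
    \prod_(p <- oddT) leg p (dcof p).
  rewrite (perm_big _ perm) big_cat /= h2 mulr1 -big_split /= big_seq [RHS]big_seq.
  apply: eq_bigr => p pT; have pP := TI (oddT_sub pT).
  by rewrite /target -[- (_ * dcof p)]mulN1r !legM // mulrA.
rewrite big_split /=.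
have -> : \prod_(p <- T) leg p (\prod_(i in J p) cof i p) =
          \prod_i theta (l i) [seq p <- T | i \in J p].
  rewrite (eq_bigr _ (fun i _ => theta_entry i)) (exchange_big_dep xpredT) //=.
  rewrite big_seq [RHS]big_seq; apply: eq_bigr => p pT.
  by rewrite leg_prod //; apply: TI.
have -> : \prod_(p <- oddT) leg p (dcof p) = theta lall oddT by [].
have -> : \prod_(p <- T) leg p (-1) = kappa ^+ (\sum_(p <- T) deg p).
  by rewrite -prodrXr big_seq [RHS]big_seq; apply: eq_bigr => p /TI/(leg_N1 oddE).
have th i : theta (l i) [seq p <- T | i \in J p] = qchar (l i) ^+ D i *
    kappa ^+ 'C(D i, 2) * \prod_(p <- T | i \in J p) kappa ^+ 'C(deg p, 2).
  rewrite thetaE ?filter_uniq // ?big_filter // => p.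
  by rewrite mem_filter => /andP[_ /TI].
rewrite (eq_bigr _ (fun i _ => th i)) thetaE ?filter_uniq //; last first.
  by move=> p /oddT_sub/TI.
rewrite !big_split /= l1 expr1n mul1r.
rewrite (exchange_big_dep xpredT) //=.
rewrite (perm_big _ perm) [\prod_(j <- T) _](perm_big _ perm) /= !big_cat /=.
have sq n : kappa ^+ n * kappa ^+ n = 1 by rewrite -expr2 -exprM mulnC exprM kappa2 expr1n.
have o1 : \prod_(p <- oddT) \prod_(i in J p) kappa ^+ 'C(deg p, 2) *
    \prod_(p <- oddT) kappa ^+ 'C(deg p, 2) = 1.
  rewrite -big_split /= big_seq big1 // => p.
  by rewrite mem_filter => /andP[/eqP p1 _]; rewrite prodr_const p1 expr1 sq.
have o2 : \prod_(p <- twoT) \prod_(i in J p) kappa ^+ 'C(deg p, 2) = 1.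
  rewrite big_seq big1 // => p /two p2.
  by rewrite prodr_const p2 expr2 sq.
rewrite (_ : forall a b c d e f g : int, a * (b * c * (d * e)) * (f * g) =
  (a * c * f) * b * (d * g) * e); last by move=> *; ring.
rewrite o1 o2 !mulr1 prodrXr -!exprD.
have -> : \prod_i qchar (l i) ^+ D i = \prod_(i in odds) qchar (l i).
  rewrite [RHS]big_mkcond; apply: eq_bigr => i _; rewrite inE deg_entry.
  by rewrite signX_odd ?qchar_sqr //; case: odd.
rewrite -[RHS](resI dev l1); congr (_ * _); apply: signX.
move: dev; rewrite deg_disc.
set S1 := (\sum_(p <- oddT) deg p)%N; set S2 := (\sum_(p <- twoT) deg p)%N => dev.
have DS : (\sum_i D i = S1 + S2.*2)%N.
  rewrite /D (exchange_big_dep xpredT) //= (perm_big _ perm) /= big_cat /=; congr (_ + _)%N.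
    rewrite /S1 big_seq [RHS]big_seq; apply: eq_bigr => p.
    by rewrite mem_filter => /andP[/eqP p1 _]; rewrite sum_nat_const p1 mul1n.
  rewrite /S2 -mul2n big_distrr /= big_seq [RHS]big_seq; apply: eq_bigr => p /two p2.
  by rewrite sum_nat_const p2.
have DO : (\sum_i D i = (\sum_i (D i)./2).*2 + #|odds|)%N.
  rewrite -sum1_card -mul2n big_distrr /= [X in (_ + X)%N]big_mkcond -big_split /=.
  apply: eq_bigr => i _; rewrite inE deg_entry mul2n addnC.
  by rewrite -[LHS]odd_double_half; case: odd.
have oC n : odd 'C(n, 2) = odd n./2.
  suff [] : odd 'C(n, 2) = odd n./2 /\ odd 'C(n.+1, 2) = odd n.+1./2 by [].
  elim: n => [//|n [IH1 IH2]]; split=> //.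
  by rewrite binS bin1 binS bin1 !oddD IH1 /=; case: (odd n); case: (odd _).
have oCs : odd (\sum_i 'C(D i, 2)) = odd (\sum_i (D i)./2).
  by elim/big_rec2: _ => // i x y _ e; rewrite !oddD oC e.
rewrite !oddD oCs oC (negPf dev) /=.
have := odd_double_half S1; rewrite (negPf dev) add0n.
move: DS; rewrite DO; set h := (\sum_i _)%N; set m := #|_|; move: (S1./2) => k DS S1E.
have -> : m./2 = (k + S2 - h)%N.
  by rewrite -[m](addKn h.*2) DS -S1E -doubleD -doubleB doubleK.
rewrite oddB ?oddD; first by case: odd; case: odd; case: odd.
by rewrite -leq_double doubleD S1E -DS leq_addr.
Qed.

(** Reciprocity turns the symbol of the discriminant modulo a variable prime [p]
    into a character of [p]. Splitting off a part [s] of even total degree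
    separates it into two factors, to which [prime_with_symbols] applies. *)
Lemma leg_disc_split (s t : seq R) p : mirr p -> perm_eq oddT (s ++ t) ->
  ~~ odd (\sum_(r <- s) deg r) ->
  leg p disc =
    legs s p * ((qchar lall * kappa ^+ (\sum_(r <- t) deg r)) ^+ deg p * legs t p).
Proof.
move=> pP perm sev; rewrite /disc (perm_big _ perm) /= legM // leg_const // leg_prod //.
have rec u : {subset u <= oddT} -> \prod_(r <- u) leg p r =
    legs u p * kappa ^+ (deg p * \sum_(r <- u) deg r).
  move=> usub; rewrite /legs big_distrr /= -prodrXr -big_split /= big_seq [RHS]big_seq.
  by apply: eq_bigr => r /usub/oddT_sub/TI rP; rewrite leg_recip.
rewrite big_cat /= !rec; last 2 first.
- by move=> x xt; rewrite (perm_mem perm) mem_cat xt orbT.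
- by move=> x xs; rewrite (perm_mem perm) mem_cat xs.
have -> : kappa ^+ (deg p * \sum_(r <- s) deg r) = 1.
  by rewrite (signX_odd (kappa2 E)) oddM (negPf sev) andbF.
rewrite exprMn -exprM mulr1 [(_ * deg p)%N]mulnC.
set a := qchar _ ^+ _; set b := legs s p; set c := legs t p; set d := kappa ^+ _; ring.
Qed.

Lemma notin_of_ndvd_prod p : mirr p -> ~~ (p %| \prod_(r <- T) r) -> p \notin T.
Proof.
by move=> pP; apply: contra => pT; rewrite (big_rem _ pT) /= dvdp_mulr.
Qed.

Lemma qchar_signs (c : E) : c != 0 -> qchar c = 1 \/ qchar c = -1.
Proof. by rewrite /qchar => /negPf->; case: ifP; [left|right]. Qed.

(** A set [s] whose character is trivial on constants and on the primes where
    the discriminant is a square cannot obstruct the targets. Triviality on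
    constants makes its degree even. If the complementary character is
    nontrivial, some prime gives [-1] to both characters, hence has
    discriminant symbol 1, against the hypothesis on [s]. Otherwise [s] is all
    of [oddT], [disc] has even degree and square leading coefficient, and the
    product formula concludes. *)
Lemma no_obstruction (s : seq R) : uniq s -> {subset s <= oddT} ->
  (forall k, k != 0 -> legs s k%:P = 1) ->
  (forall p, mirr p -> p \notin T -> leg p disc = 1 -> legs s p = 1) ->
  \prod_(p <- s) target p = 1.
Proof.
move=> us sT hk hp; have [-> |s0] := eqVneq s [::]; first by rewrite big_nil.
have sI : {in s, forall p, mirr p} by move=> p /sT/oddT_sub/TI.
have sev : ~~ odd (\sum_(r <- s) deg r).
  have [k kE] := nonsquare_exists oddE.
  have k0 : k != 0 by apply: contra_eq_neq kE => ->; rewrite /qchar eqxx.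
  have := hk k k0; rewrite /legs (eq_big_seq (fun p => (-1) ^+ deg p)); last first.
    by move=> p ps; rewrite leg_const ?kE //; apply: sI.
  by rewrite prodrXr -signr_odd; case: odd.
pose t := [seq p <- oddT | p \notin s].
have perm : perm_eq oddT (s ++ t).
  rewrite -(perm_filterC (mem s) oddT) perm_sym; apply: perm_cat => //.
  apply: uniq_perm; rewrite ?filter_uniq // => x; rewrite mem_filter.
  by apply/idP/andP => [xs|[]//]; split=> //; apply: sT.
have tI : {in t, forall p, mirr p} by move=> p; rewrite mem_filter => /andP[_ /oddT_sub/TI].
have ut : uniq t by rewrite !filter_uniq.
pose sigma := qchar lall * kappa ^+ (\sum_(r <- t) deg r).
have sig2 : sigma ^+ 2 = 1.
  by rewrite exprMn qchar_sqr ?lall_neq0 // -exprM mulnC exprM kappa2 expr1n.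
have [tsig|] := boolP ((t != [::]) || (sigma == -1)).
  have T0 : \prod_(r <- T) r != 0.
    by rewrite prodf_seq_neq0; apply/allP => p /TI[_ pm]; rewrite /= monic_neq0.
  have [p [pP npT ps pt]] := prime_with_symbols oddE sI us s0 tI ut sig2 tsig T0.
  have := hp p pP (notin_of_ndvd_prod pP npT).
  rewrite (leg_disc_split pP perm sev) -/sigma ps pt mulN1r opprK.
  by move=> /(_ (erefl _)).
rewrite negb_or negbK => /andP[/eqP t0].
have perm' : perm_eq oddT s by move: perm; rewrite t0 cats0.
rewrite /sigma t0 big_nil expr0 mulr1 => lN.
rewrite -(perm_big _ perm'); apply: product_formula.
  by rewrite deg_disc (perm_big _ perm').
by case: (qchar_signs lall_neq0) lN => -> //; rewrite eqxx.
Qed.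

(** The symbols at the primes of [oddT] are vectors over the field with two
    elements. By duality, either the target vector is a sum of vectors of
    constants and of primes at which [disc] is a square, and these factors make
    up [c]; or some subset of [oddT] is orthogonal to all of them but not to the
    target, which [no_obstruction] excludes. *)
Lemma multiplier_exists : exists (k : E) (C : seq R),
  [/\ k != 0, uniq C, {in C, forall p, [/\ mirr p, p \notin T & leg p disc = 1]}
    & {in oddT, forall p, leg p (k%:P * \prod_(r <- C) r) = target p}].
Proof.
pose r := size oddT; pose pr (i : 'I_r) := oddT`_i.
have prT i : pr i \in oddT by rewrite mem_nth.
have prP i : mirr (pr i) by apply/TI/oddT_sub/prT.
pose A (v : 'rV['F_2]_r) := exists x : R,
  ((mirr x /\ x \notin T /\ leg x disc = 1) \/ exists2 k, k != 0 & x = k%:P) /\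
  forall i, leg (pr i) x = sgF2 (v 0 i).
have logv (x : 'I_r -> R) : (forall i, leg (pr i) (x i) != 0) ->
    exists v : 'rV['F_2]_r, forall i, leg (pr i) (x i) = sgF2 (v 0 i).
  move=> x0; have /choice[f hf] i := sgF2_log (leg_sign (pr i) (x i)) (x0 i).
  by exists (\row_i f i) => i; rewrite mxE.
have [w wE] : exists w : 'rV['F_2]_r, forall i, target (pr i) = sgF2 (w 0 i).
  by apply: logv => i; apply: target_neq0.
case: (F2_span_or_separate A w) => [[S SA wS]|[I IA wI]].
  have /choice[f hf] v : exists x : R, v \in S ->
     ((mirr x /\ x \notin T /\ leg x disc = 1) \/ exists2 k, k != 0 & x = k%:P) /\
     forall i, leg (pr i) x = sgF2 (v 0 i).
    by case: (boolP (v \in S)) => [/SA[x hx]|_]; [exists x|exists 0].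
  pose isC v := `[< mirr (f v) >].
  pose C := [seq f v | v <- enum S & isC v].
  have inC p : p \in C -> exists2 v, v \in S & mirr (f v) /\ p = f v.
    move=> /mapP[v]; rewrite mem_filter mem_enum => /andP[/asboolP fv vS] ->.
    by exists v.
  have cst (k : E) : ~ mirr k%:P.
    by move=> [[s1 _] _]; move: s1; rewrite ltnNge (leq_trans (size_polyC_leq1 _)).
  pose K := \prod_(v <- enum S | ~~ isC v) (f v)`_0.
  have fK v : v \in S -> ~~ isC v -> exists2 k, k != 0 & f v = k%:P.
    by move=> vS /asboolPn nm; have [[[] //|//] _] := hf v vS.
  exists K, C; split.
  - rewrite /K big_seq_cond prodf_seq_neq0; apply/allP => v _; apply/implyP.
    rewrite mem_enum => /andP[vS /(fK _ vS)[k k0 ->]]; by rewrite coefC.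
  - rewrite map_inj_in_uniq; first exact/filter_uniq/enum_uniq.
    move=> u v; rewrite mem_filter mem_enum => /andP[_ uS].
    rewrite mem_filter mem_enum => /andP[_ vS] e.
    have [_ hu] := hf u uS; have [_ hv] := hf v vS.
    apply/rowP => i; have := hu i; rewrite e hv.
    by case: (v 0 i) (u 0 i) => [[|[|//]] h1] [[|[|//]] h2] //= _; apply: val_inj.
  - move=> p /inC[v vS [fv ->]]; have [[[? [? ?]]|[k _ fk]] _] := hf v vS => //.
    by move: fv; rewrite fk => /cst.
  move=> p pT; have [i iE] : exists i, p = pr i.
    by exists (Ordinal (etrans (index_mem p oddT) pT)); rewrite /pr nth_index.
  have KE : K%:P * \prod_(x <- C) x = \prod_(v in S) f v.
    rewrite -[RHS]big_enum (bigID isC) /= mulrC big_map big_filter; congr (_ * _).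
    rewrite /K rmorph_prod big_seq_cond [RHS]big_seq_cond; apply: eq_bigr => v.
    by rewrite mem_enum => /andP[vS /(fK _ vS)[k k0 ->]]; rewrite coefC.
  rewrite KE iE leg_prod // wE wS summxE sgF2_sum; apply: eq_bigr => v vS.
  by have [_] := hf v vS.
exfalso; pose s := [seq pr i | i <- enum I].
have us : uniq s.
  rewrite map_inj_uniq ?enum_uniq // => i j /eqP.
  by rewrite nth_uniq ?filter_uniq // => /eqP/val_inj.
have prodS (h : R -> int) : \prod_(p <- s) h p = \prod_(i in I) h (pr i).
  by rewrite big_map big_enum.
have main x : ((mirr x /\ x \notin T /\ leg x disc = 1) \/ exists2 k, k != 0 & x = k%:P) ->
    (forall i, leg (pr i) x != 0) -> legs s x = 1.
  move=> hx x0; have [v hv] := logv (fun=> x) x0.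
  rewrite /legs prodS (eq_bigr _ (fun i _ => hv i)) -sgF2_sum IA //.
  by exists x.
have : \prod_(p <- s) target p = 1.
  apply: no_obstruction => // [p /mapP[i _ ->] //|k k0|p pP pT pd].
    apply: main; first by right; exists k.
    move=> i; rewrite leg_const // expf_neq0 //.
    by case: (qchar_signs k0) => ->.
  apply: main; first by left.
  move=> i; rewrite leg_eq0 mirr_dvd //; apply: contraNneq pT => <-.
  exact/oddT_sub/prT.
by rewrite prodS (eq_bigr _ (fun i _ => wE i)) -sgF2_sum wI.
Qed.
End AuxiliaryMultiplier.

(** * Unimodular symmetric matrices over a polynomial ring *)

Section Lattice.
Variable F : fieldType.
Local Notation R := {poly F}.
Local Notation deg p := (size (p : R)).-1.

Definition qf (S : comNzRingType) n (G : 'M[S]_n) (x : 'rV[S]_n) : S :=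
  (x *m G *m x^T) 0 0.

Lemma qf_mul (S : comNzRingType) m n (G : 'M[S]_n) (P : 'M[S]_(m, n)) x :
  qf G (x *m P) = qf (P *m G *m P^T) x.
Proof. by rewrite /qf trmx_mul !mulmxA. Qed.

Lemma qf_row (S : comNzRingType) n (G P : 'M[S]_n) i :
  qf G (row i P) = (P *m G *m P^T) i i.
Proof.
by rewrite rowE qf_mul /qf -rowE trmx_delta -colE !mxE.
Qed.

Definition shear n (v : 'rV[R]_n.+1) : 'M[R]_n.+1 :=
  1%:M - \matrix_(i, j) (v 0 i *+ ((i != 0) && (j == 0))).

Lemma shear_entry n (v : 'rV[R]_n.+1) i j :
  shear v i j = (i == j)%:R - v 0 i *+ ((i != 0) && (j == 0)).
Proof. by rewrite !mxE. Qed.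

Lemma shear_mul n (v : 'rV[R]_n.+1) m (A : 'M[R]_(n.+1, m)) i j :
  (shear v *m A) i j = A i j - (v 0 i *+ (i != 0)) * A 0 j.
Proof.
rewrite mulmxBl mul1mx !mxE; congr (_ - _); rewrite (bigD1 0) //= big1.
  by rewrite !mxE eqxx andbT addr0.
by move=> k /negPf k0; rewrite !mxE k0 andbF mul0r.
Qed.

Lemma shear_unit n (v : 'rV[R]_n.+1) : shear v \in unitmx.
Proof.
have : shear v *m shear (- v) = 1%:M.
  apply/matrixP => i j; rewrite shear_mul !shear_entry eqxx /= mulr0n subr0 !mxE.
  case: (eqVneq i 0) => [->|i0] /=; first by rewrite !mulr0n mul0r !subr0.
  rewrite !mulr1n; case: (eqVneq j 0) => [->|j0] /=; rewrite ?mulr1n ?mulr0n.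
    by rewrite mulr1 opprK addrK.
  by rewrite mulr0 !subr0.
by case/mulmx1_unit.
Qed.

(** Being a row of an invertible matrix is the form in which unimodularity of a
    vector is used; its equivalence with coprime coordinates is what
    [primitive_content] provides. *)
Definition primitive n (x : 'rV[R]_n) := exists2 P : 'M[R]_n, P \in unitmx & exists i, x = row i P.

Lemma primitive_row0 n (x : 'rV[R]_n.+1) : primitive x ->
  exists2 P : 'M[R]_n.+1, P \in unitmx & x = row 0 P.
Proof.
move=> [P Pu [i ->]]; exists (xrow 0 i P); last first.
  by apply/rowP => j; rewrite !mxE tpermL.
by rewrite xrowE unitmx_mul unitmx_perm.
Qed.

Lemma primitive_mul n (x : 'rV[R]_n) (P : 'M[R]_n) : P \in unitmx -> primitive x ->
  primitive (x *m P).
Proof.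
move=> Pu [Q Qu [i ->]]; exists (Q *m P); first by rewrite unitmx_mul Qu.
by exists i; rewrite row_mul.
Qed.

(** Euclid's algorithm on columns: among the matrices equivalent to [x], take
    one whose first coordinate is nonzero of least size; reducing the other
    coordinates modulo it must give 0. *)
Lemma primitive_content n (x : 'rV[R]_n.+1) : exists h y, primitive y /\ x = h *: y.
Proof.
have [->|x0] := eqVneq x 0.
  exists 0, (row 0 1%:M); split; last by rewrite scale0r.
  by exists 1%:M; rewrite ?unitmx1 //; exists 0.
pose S m := `[< exists2 P : 'M[R]_n.+1, P \in unitmx &
  (x *m P) 0 0 != 0 /\ size ((x *m P) 0 0) = m >].
have exS : exists m, S m.
  have [j xj] : exists j, x 0 j != 0.
    apply/existsP; apply: contraNT x0; rewrite negb_exists => /forallP h.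
    by apply/eqP/rowP => j; rewrite mxE; apply/eqP; rewrite -[_ == _]negbK.
  exists (size (x 0 j)); apply/asboolP; exists (tperm_mx 0 j); first exact: unitmx_perm.
  by rewrite -xcolE !mxE tpermL.
case: (ex_minnP exS) => m /asboolP[P Pu [g0 gm]] minm.
set g := (x *m P) 0 0 in g0 gm; pose v := \row_j ((x *m P) 0 j %/ g).
pose P2 := P *m (shear v)^T.
have P2u : P2 \in unitmx by rewrite unitmx_mul Pu unitmx_tr shear_unit.
have xP2 j : (x *m P2) 0 j = if j == 0 then g else (x *m P) 0 j %% g.
  rewrite mulmxA -(trmxK (x *m P *m _)) trmx_mul trmxK mxE shear_mul.
  rewrite [(x *m P)^T j 0]mxE [(x *m P)^T 0 0]mxE [v 0 j]mxE -/g.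
  case: eqVneq => [->|j0] /=; first by rewrite mulr0n mul0r subr0.
  rewrite mulr1n; apply/eqP; rewrite subr_eq addrC; apply/eqP.
  exact: divp_eq.
have xg : x *m P2 = g *: delta_mx 0 0.
  apply/rowP => j; rewrite xP2 [RHS]mxE [X in _ * X]mxE eqxx /=; case: eqVneq => [_|j0]; rewrite ?mulr1 ?mulr0n ?mulr0 //.
  apply/eqP; apply: contraT => r0.
  have : (m <= size ((x *m P) 0 j %% g)%R)%N.
    apply: minm; apply/asboolP; exists (P2 *m tperm_mx 0 j).
      by rewrite unitmx_mul P2u unitmx_perm.
     by rewrite mulmxA -xcolE mxE tpermL xP2 (negPf j0); split.
  by rewrite leqNgt -gm ltn_modp g0.
exists g, (row 0 (invmx P2)); split.
  by exists (invmx P2); [rewrite unitmx_inv|exists 0].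
by rewrite rowE scalemxAl -xg mulmxK.
Qed.

Definition symm (S : comNzRingType) n (G : 'M[S]_n) := G^T = G.

Lemma symm_congr (S : comNzRingType) n (G P : 'M[S]_n) : symm G -> symm (P *m G *m P^T).
Proof. by move=> Gs; rewrite /symm !trmx_mul trmxK Gs mulmxA. Qed.

Lemma qf_scale (S : comNzRingType) n (G : 'M[S]_n) a x : qf G (a *: x) = a ^+ 2 * qf G x.
Proof. by rewrite /qf linearZ /= -!scalemxAl -scalemxAr !mxE mulrA expr2. Qed.

Lemma unit_det n (P : 'M[R]_n) : P \in unitmx -> exists2 c, c != 0 & \det P = c%:P.
Proof.
rewrite unitmxE poly_unitE => /andP[/size_poly1P[c c0 e] _]; by exists c.
Qed.

Lemma det_congr_size n (G P : 'M[R]_n) : P \in unitmx ->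
  size (\det (P *m G *m P^T)) = size (\det G).
Proof.
move=> /unit_det[c c0 e]; rewrite !det_mulmx det_tr e.
by rewrite mulrAC -rmorphM size_Cmul // mulf_neq0.
Qed.

Lemma entry_add (S : nzRingType) (A B : 'M[S]_1) : (A + B) 0 0 = A 0 0 + B 0 0.
Proof. by rewrite mxE. Qed.
Lemma entry_sub (S : nzRingType) (A B : 'M[S]_1) : (A - B) 0 0 = A 0 0 - B 0 0.
Proof. by rewrite !mxE. Qed.
Lemma entry_scalar (S : nzRingType) (c : S) : (c%:M : 'M_1) 0 0 = c.
Proof. by rewrite mxE eqxx mulr1n. Qed.
Lemma entry_scale (S : nzRingType) (c : S) (A : 'M_1) : (c *: A) 0 0 = c * A 0 0.
Proof. by rewrite mxE. Qed.

Lemma ulsubmx_scalar (S : nzRingType) m (G : 'M[S]_(1 + m)) : ulsubmx G = (G 0 0)%:M.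
Proof.
by apply/matrixP => i j; rewrite !ord1 !mxE eqxx mulr1n; congr (G _ _); apply: val_inj.
Qed.

Lemma block_gram (S : comNzRingType) m (G : 'M[S]_(1 + m)) (a : S) (x : 'rV_m) : symm G ->
  let b := ursubmx G in let beta := (b *m x^T) 0 0 in
  qf G (row_mx a%:M x) = a ^+ 2 * G 0 0 + 2 * a * beta + qf (drsubmx G) x.
Proof.
move=> Gs b beta.
have Gul := ulsubmx_scalar G.
have Gdl : dlsubmx G = b^T by rewrite /b trmx_ursub Gs.
have bx : b *m x^T = beta%:M.
  by apply/matrixP => i j; rewrite !ord1 [in RHS]mxE eqxx mulr1n.
rewrite /qf -{1}[G]submxK Gul Gdl -/b mul_row_block tr_row_mx mul_row_col mulmxDl.
rewrite tr_scalar_mx.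
have xb : x *m b^T = beta%:M by rewrite -[LHS]trmxK trmx_mul trmxK bx tr_scalar_mx.
rewrite xb !mulmxDl -!scalar_mxM -[a%:M *m b *m _]mulmxA bx -!scalar_mxM.
rewrite !entry_add !entry_scalar.
set t := (x *m _ *m _) 0 0; rewrite expr2; ring.
Qed.

Lemma primitive_row_mx m a (x : 'rV[R]_m.+1) : primitive x ->
  primitive (row_mx a%:M x : 'rV_(1 + m.+1)).
Proof.
move=> /primitive_row0[P Pu ->].
exists (block_mx 1%:M 0 (a *: delta_mx 0 0 : 'M_(m.+1, 1)) P).
  by rewrite unitmxE det_lblock det1 mul1r -unitmxE.
exists (rshift 1 0); rewrite /block_mx rowKd row_row_mx; congr row_mx.
apply/rowP => j; rewrite !ord1 !mxE eqxx mulr1n mulr1 //.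
Qed.

(** Hermite reduction. Assume that 0 is not a value at a primitive vector. Let
    [g] be a value of least degree at such a vector, taken as the first basis
    vector, and let [G'] be [g] times the form on the projection orthogonal to
    it, of determinant [g ^ m * det G]. By induction [G'] has
    a primitive vector [x'] of small value. Lift it to [a * e_0 + x'] with [a]
    chosen by Euclidean division, so that the component along [e_0] is a
    remainder modulo [g]: then [g * Q = qf G' x' + remainder ^ 2], where the last
    term is too small to matter since the value [Q] has degree at least that of
    [g]. *)
Lemma hermite n (G : 'M[R]_n.+1) : symm G -> \det G != 0 ->
  exists x, primitive x /\ (qf G x = 0 \/ (n.+1 * deg (qf G x) <= deg (\det G))%N).
Proof.
elim: n G => [|m IH] G Gs dG.
  exists (row 0 1%:M); split; first by exists 1%:M; rewrite ?unitmx1 //; exists 0.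
  by right; rewrite qf_row mul1mx trmx1 mulmx1 det_mx11 mul1n.
have [[x [xp x0]]|noz] := pselect (exists x, primitive x /\ qf G x = 0).
  by exists x; split=> //; left.
pose S k := `[< exists2 x, primitive x & size (qf G x) = k >].
have exS : exists k, S k.
  exists (size (qf G (row 0 1%:M))); apply/asboolP; exists (row 0 1%:M) => //.
  by exists 1%:M; rewrite ?unitmx1 //; exists 0.
case: (ex_minnP exS) => k /asboolP[x xp xk] mink.
exists x; split=> //; right.
have [P Pu xE] := primitive_row0 xp.
pose G1 : 'M[R]_(1 + m.+1) := P *m G *m P^T.
have G1s : symm G1 by apply: symm_congr.
have gE : qf G x = G1 0 0 by rewrite xE qf_row.
set g := qf G x in gE xk *.
have val y : primitive y -> qf G1 y != 0 /\ (size g <= size (qf G1 y))%N.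
  move=> yp; have yPp := primitive_mul Pu yp.
  rewrite -qf_mul; split; first by apply/eqP => e; apply: noz; exists (y *m P).
  by rewrite xk; apply: mink; apply/asboolP; exists (y *m P).
have g0 : g != 0 by apply/eqP => e; apply: noz; exists x.
pose b := ursubmx G1; pose C := drsubmx G1; pose G' := g *: C - b^T *m b.
have G's : symm G'.
  by rewrite /symm /G' linearB linearZ /= trmx_mul trmxK /C trmx_drsub G1s.
have detG' : \det G' = g ^+ m * \det G1.
  apply: (mulfI g0); rewrite mulrA -exprS.
  have e : block_mx 1%:M 0 (- b^T) g%:M *m G1 = block_mx g%:M b 0 G'.
    have Gul : ulsubmx G1 = g%:M by rewrite gE ulsubmx_scalar.
    have Gdl : dlsubmx G1 = b^T by rewrite /b trmx_ursub G1s.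
    rewrite -[G1 in LHS]submxK mulmx_block Gul Gdl -/b -/C !mul1mx !mul0mx !addr0.
    congr block_mx; last by rewrite mulNmx mul_scalar_mx addrC.
    by rewrite mul_scalar_mx mulNmx mul_mx_scalar addNr.
  have := congr1 determinant e; rewrite det_mulmx det_lblock det_ublock det1 mul1r.
  by rewrite !det_scalar expr1 => <-.
have dG1 : \det G1 != 0 by rewrite -size_poly_eq0 det_congr_size // size_poly_eq0.
have [|x' [x'p hx']] := IH G' G's; first by rewrite detG' mulf_neq0 ?expf_neq0.
pose beta := (b *m x'^T) 0 0; pose a := - (beta %/ g).
have [q0 qs] := val _ (primitive_row_mx a x'p).
move: q0 qs; rewrite block_gram // -gE -/b -/beta -/C.
set Q := (_ + _ + _) => Q0 Qs.
have rE : beta + a * g = beta %% g by rewrite {1}(divp_eq beta g) /a mulNr addrAC subrr add0r.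
have gQ : g * Q = qf G' x' + (beta %% g) ^+ 2.
  have -> : qf G' x' = g * qf C x' - beta ^+ 2.
    have xb : x' *m b^T = beta%:M.
      rewrite -[LHS]trmxK trmx_mul trmxK; apply/matrixP => i j.
      by rewrite !ord1 mxE [in RHS]mxE eqxx mulr1n.
    have bx : b *m x'^T = beta%:M.
      by rewrite -[LHS]trmxK trmx_mul trmxK xb tr_scalar_mx.
    rewrite /qf /G' mulmxBr mulmxBl -scalemxAr -scalemxAl mulmxA xb -mulmxA bx.
    by rewrite -scalar_mxM entry_sub entry_scalar entry_scale expr2.
  by rewrite -rE /Q; ring.
have sr : (size ((beta %% g) ^+ 2)%R < size (g * Q)%R)%N.
  have s1 : (size (beta %% g)%R < size g)%N by rewrite ltn_modp.
  rewrite [X in (_ < X)%N]size_mul // expr2; apply: leq_ltn_trans (size_polyMleq _ _) _.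
  by move: s1 Qs; case: (size g) => // sg; case: (size Q) => // sQ; case: (size (beta %% g)%R) => [|sr]; rewrite /= ?addnS ?addSn /=; lia.
have sgp : size (qf G' x') = size (g * Q).
  by rewrite -[qf G' x'](addrK ((beta %% g) ^+ 2)) -gQ size_polyDl // size_polyN.
case: hx' => [z|].
  by move: sr; rewrite -sgp z size_poly0 ltn0.
have sgm : size (g ^+ m) = ((size g).-1 * m).+1.
  by rewrite -size_exp prednK // size_poly_gt0 expf_neq0.
rewrite sgp detG' (size_mul g0 Q0) (size_mul (expf_neq0 m g0) dG1) sgm det_congr_size //.
move: Qs g0 Q0 dG; rewrite -!size_poly_gt0.
case: (size g) => // sg; case: (size Q) => // sQ; case: (size (\det G)) => // dd.
rewrite /= ?addnS ?addSn /=; nia.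
Qed.

Hypothesis two0 : (2 : F) != 0.

(** When the determinant is constant, Hermite's bound gives a primitive [x] of
    constant value. If this value is 0, unimodularity gives [y] with
    [x G y^T = 1], and [y + k x] has value 1 for [k = (1 - qf G y) / 2]. *)
Lemma unit_value n (G : 'M[R]_n.+1) : symm G -> G \in unitmx ->
  exists z c, [/\ primitive z, c != 0 & qf G z = c%:P].
Proof.
move=> Gs Gu; have [d d0 dE] := unit_det Gu.
have [|x [xp hx]] := @hermite n G Gs; first by rewrite dE polyC_eq0.
have [c cE] : exists c, qf G x = c%:P.
  case: hx => [->|]; first by exists 0.
  rewrite dE size_polyC d0 leqn0 muln_eq0 /= => /eqP h.
  exists (qf G x)`_0; apply: size1_polyC; move: h; by case: (size _) => [|[]].
have [c0|c0] := eqVneq c 0; last by exists x, c.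
have [P Pu xE] := primitive_row0 xp.
pose y := (invmx G *m invmx P *m delta_mx 0 0 : 'cV[R]_n.+1)^T.
have xy : x *m G *m y^T = 1%:M.
  rewrite trmxK !mulmxA mulmxK // xE rowE mulmxK //.
  by apply/matrixP => i j; rewrite !ord1 mul_delta_mx !mxE eqxx.
have yx : y *m G *m x^T = 1%:M.
  have e : (y *m G *m x^T)^T = 1%:M by rewrite !trmx_mul trmxK Gs mulmxA.
  by rewrite -[LHS]trmxK e trmx1.
pose k : R := 2^-1%:P * (1 - qf G y); pose z := y + k *: x.
have half : (2^-1%:P + 2^-1%:P : R) = 1.
  by rewrite -rmorphD -mulr2n -[_ *+ 2]mulr_natl mulfV.
have qz : qf G z = 1.
  have -> : qf G z = qf G y + k *+ 2 + k ^+ 2 * qf G x.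
    rewrite /qf /z linearD linearZ /= !mulmxDl !mulmxDr -!scalemxAl -!scalemxAr xy yx.
    by rewrite !entry_add !entry_scale entry_scalar; ring.
  rewrite cE c0 mulr0 addr0 mulr2n /k -mulrDl half mul1r addrC subrK //.
have [h [w [wp zE]]] := primitive_content z.
have hw : h ^+ 2 * qf G w = 1 by rewrite -qf_scale -zE.
have [e e0 eE] : exists2 e, e != 0 & qf G w = e%:P.
  have : qf G w %| 1 by rewrite -hw dvdp_mull.
  by rewrite dvdp1 => /size_poly1P.
by exists w, e.
Qed.

(** Harder's theorem: a unimodular symmetric matrix over [F[X]] is congruent to
    a constant diagonal one. A primitive vector of invertible value splits off
    orthogonally, and one concludes by induction. *)
Lemma harder n (G : 'M[R]_n) : symm G -> G \in unitmx ->
  exists P (u : 'rV[F]_n), P \in unitmx /\ P *m G *m P^T = diag_mx (map_mx polyC u).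
Proof.
elim: n G => [|n IH] G Gs Gu.
  by exists 1%:M, 0; split; [exact: unitmx1|apply/matrixP => -[]].
have [z [c [zp c0 zc]]] := unit_value Gs Gu.
have [P Pu zE] := primitive_row0 zp.
pose G1 : 'M[R]_(1 + n) := P *m G *m P^T.
have G1s : symm G1 by apply: symm_congr.
have Gul : ulsubmx G1 = c%:P%:M by rewrite ulsubmx_scalar -zc zE qf_row.
pose b := ursubmx G1; pose C := drsubmx G1.
have Gdl : dlsubmx G1 = b^T by rewrite /b trmx_ursub G1s.
have Cs : C^T = C by rewrite /C trmx_drsub G1s.
pose C' := C - c^-1%:P *: (b^T *m b).
have cK : c^-1%:P * c%:P = 1 :> R by rewrite -rmorphM mulVf.
pose P2 : 'M[R]_(1 + n) := block_mx 1%:M 0 (- (c^-1%:P *: b^T)) 1%:M.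
have P2u : P2 \in unitmx by rewrite unitmxE det_lblock !det1 mulr1 unitr1.
have G2 : P2 *m G1 *m P2^T = block_mx c%:P%:M 0 0 C'.
  rewrite -[G1]submxK Gul Gdl -/b -/C tr_block_mx !trmx1 trmx0 !mulmx_block.
  rewrite !mul1mx !mul0mx !mulmx1 !mulmx0 !addr0.
  have e1 : - (c^-1%:P *: b^T) *m c%:P%:M + b^T = 0.
    by rewrite mul_mx_scalar scalerN scalerA mulrC cK scale1r addNr.
  have e2 : c%:P%:M *m (- (c^-1%:P *: b^T))^T + b = 0.
    by rewrite linearN linearZ /= trmxK mul_scalar_mx scalerN scalerA mulrC cK scale1r addNr.
  by rewrite e1 e2 mul0mx add0r mulNmx -scalemxAl addrC.
have C'u : C' \in unitmx.
  have : \det (P2 *m G1 *m P2^T) \is a GRing.unit.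
    by rewrite -unitmxE !unitmx_mul !unitmx_tr P2u Pu Gu.
  rewrite G2 det_ublock det_scalar expr1 unitrM => /andP[_].
  by rewrite -unitmxE.
have C's : symm C' by rewrite /symm /C' linearB linearZ /= trmx_mul trmxK Cs.
have [P' [u [P'u P'E]]] := IH C' C's C'u.
pose P3 : 'M[R]_(1 + n) := block_mx 1%:M 0 0 P'.
have P3u : P3 \in unitmx by rewrite unitmxE det_lblock det1 mul1r -unitmxE.
exists (P3 *m P2 *m P), (row_mx c%:M u : 'rV_(1 + n)); split.
  by rewrite !unitmx_mul Pu P2u P3u.
have -> : P3 *m P2 *m P *m G *m (P3 *m P2 *m P)^T = P3 *m (P2 *m G1 *m P2^T) *m P3^T.
  by rewrite !trmx_mul !mulmxA.
rewrite G2 tr_block_mx !trmx0 trmx1 !mulmx_block !mul1mx !mul0mx !mulmx0 !mulmx1 !addr0 !add0r.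
rewrite P'E; transitivity (diag_mx (row_mx c%:P%:M (map_mx polyC u))).
  have e1 : c%:P%:M = diag_mx (c%:P%:M : 'M_1).
    by apply/matrixP => i j; rewrite !ord1 !mxE !eqxx !mulr1n.
  by rewrite mul0mx {1}e1 -diag_mx_row.
have mE : map_mx polyC (row_mx c%:M u) = row_mx c%:P%:M (map_mx polyC u).
  by rewrite map_row_mx map_scalar_mx.
by congr diag_mx; symmetry; exact: mE.
Qed.

(** The conditions under which adjoining [x / p] to the lattice of Gram matrix
    [G] enlarges it properly and keeps the form integral. *)
Definition locally_glued (p : R) n (G : 'M[R]_n) (x : 'rV[R]_n) :=
  [/\ exists j, ~~ (p %| x 0 j), forall j, p %| (x *m G) 0 j & p ^+ 2 %| qf G x].

Lemma dvdp_mulmx p m n k (A : 'M[R]_(m, n)) (B : 'M[R]_(n, k)) i :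
  (forall j, p %| A i j) -> forall j, p %| (A *m B) i j.
Proof.
move=> pA j; rewrite mxE; elim/big_rec: _ => [|l y _ py]; first exact: dvdp0.
by rewrite dvdp_addr // dvdp_mulr.
Qed.

(** The lattice enlarged by [x / p]: after a change of basis making [x]
    proportional to the first basis vector, its row and column in the Gram
    matrix are divisible by [p] and its value by [p ^ 2]; dividing this vector by
    [p] is the congruence by [D ^-1]. *)
Lemma glue_step n (G : 'M[R]_n.+1) p x : irreducible_poly p -> symm G ->
  locally_glued p G x ->
  exists D G' c, [/\ symm G', G = D *m G' *m D^T, c != 0 & \det D = c%:P * p].
Proof.
move=> pI Gs [[j pxj] pxG pqx]; have [p1 _] := pI.
have p0 : p != 0 by rewrite -size_poly_gt0 ltnW.
have [h [y [yp xE]]] := primitive_content x.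
have [P Pu yE] := primitive_row0 yp.
have ph : ~~ (p %| h) by apply: contra pxj => ph; rewrite xE mxE dvdp_mulr.
have [G1 G1E] : exists M, M = P *m G *m P^T by eexists.
have G1s : symm G1 by rewrite G1E; apply: symm_congr.
have G10 k : p %| G1 0 k.
  have : p %| h * G1 0 k.
    have -> : h * G1 0 k = (x *m G *m P^T) 0 k.
      rewrite xE yE G1E -!scalemxAl [RHS]mxE; congr (_ * _).
      by rewrite -!row_mul [RHS]mxE.
    exact: dvdp_mulmx.
  by rewrite irr_dvdM // (negPf ph).
have G100 : p ^+ 2 %| G1 0 0.
  move: pqx; rewrite xE qf_scale yE qf_row -G1E Gauss_dvdpr //.
  by rewrite coprimep_expl // coprimep_expr // irreducible_poly_coprime.
pose d (i : 'I_n.+1) : R := if i == 0 then p else 1.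
have d0 i : d i != 0 by rewrite /d; case: ifP => // _; apply: oner_neq0.
have dG i k : d i * d k %| G1 i k.
  rewrite /d; case: (eqVneq i 0) => [->|i0]; case: (eqVneq k 0) => [->|k0].
  - by rewrite -expr2.
  - by rewrite mulr1.
  - by rewrite mul1r -G1s mxE.
  - by rewrite mulr1 dvd1p.
pose D0 := diag_mx (\row_i d i).
pose G' := \matrix_(i, k) (G1 i k %/ (d i * d k)).
have [c c0 cE] := unit_det Pu.
exists (invmx P *m D0), G', c^-1; split.
- by apply/matrixP => i k; rewrite !mxE -[in LHS]G1s mxE [d k * _]mulrC.
- have DG : D0 *m G' *m D0^T = G1.
    rewrite tr_diag_mx; apply/matrixP => i k; rewrite mul_mx_diag mxE mul_diag_mx !mxE.
    by rewrite mulrAC mulrC divpK.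
  rewrite trmx_mul -mulmxA [G' *m _]mulmxA mulmxA -!(mulmxA (invmx P)) mulmxA.
  rewrite [D0 *m (G' *m D0^T)]mulmxA DG G1E !mulmxA mulVmx // mul1mx -mulmxA -trmx_mul.
  by rewrite mulVmx // trmx1 mulmx1.
- by rewrite invr_eq0.
rewrite det_mulmx det_inv cE det_diag; congr (_ * _); first by rewrite polyCV.
rewrite (bigD1 0) //= big1 => [|i i0]; first by rewrite mulr1 mxE.
by rewrite mxE /d (negPf i0).
Qed.

(** An enlargement at a prime different from [p] has index prime to [p], so the
    gluing vector at [p] survives it; the index is removed by means of the
    adjugate matrix. *)
Lemma glued_transport n (G D G' : 'M[R]_n) p r c x : irreducible_poly p -> ~~ (p %| r) ->
  symm G' -> G = D *m G' *m D^T -> c != 0 -> \det D = c%:P * r ->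
  locally_glued p G x -> locally_glued p G' (x *m D).
Proof.
move=> pI pr G's GE c0 dD [[j pj] pG pq].
have pdet (z : R) : p %| z * \det D -> p %| z.
  rewrite dD mulrCA irr_dvdM // => /orP[|].
    move/dvdp_leq; rewrite polyC_eq0 size_polyC c0 => /(_ isT).
    by case: pI => p1 _; rewrite leqNgt p1.
  by rewrite irr_dvdM // (negPf pr) orbF.
split; last by rewrite qf_mul -GE.
  apply: contrapT => h; case/negP: pj; apply: pdet.
  have -> : x 0 j * \det D = (x *m D *m \adj D) 0 j.
    by rewrite -mulmxA mul_mx_adj mul_mx_scalar mxE mulrC.
  apply: dvdp_mulmx => k; apply: contrapT => /negP pk; apply: h; by exists k.
move=> k; apply: pdet; rewrite -det_tr.
have -> : (x *m D *m G') 0 k * \det D^T = (x *m G *m \adj D^T) 0 k.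
  rewrite GE !mulmxA -[_ *m D^T *m _]mulmxA mul_mx_adj mul_mx_scalar.
  by rewrite [RHS]mxE mulrC.
exact: dvdp_mulmx.
Qed.

Lemma glue n (G : 'M[R]_n.+1) (T : seq R) c : symm G -> {in T, forall p, irreducible_poly p /\ p \is monic} ->
  uniq T -> c != 0 -> \det G = c%:P * \prod_(p <- T) p ^+ 2 ->
  {in T, forall p, exists x, locally_glued p G x} ->
  exists D G', [/\ symm G', G = D *m G' *m D^T, \det D != 0 & G' \in unitmx].
Proof.
elim: T G c => [|p T IH] G c Gs TI uT c0 dG gl.
  exists 1%:M, G; rewrite mul1mx trmx1 mulmx1 det1 oner_neq0; split=> //.
  by rewrite unitmxE dG big_nil mulr1 poly_unitE size_polyC c0 coefC unitfE.
have [pI pm] := TI p (mem_head _ _).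
have TI' : {in T, forall p, irreducible_poly p /\ p \is monic}.
  by move=> r rT; apply: TI; rewrite inE rT orbT.
move: uT => /= /andP[pT uT].
have [x hx] := gl p (mem_head _ _).
have [D [G1 [e [G1s GE e0 dD]]]] := glue_step pI Gs hx.
have dG1 : \det G1 = (c / e ^+ 2)%:P * \prod_(r <- T) r ^+ 2.
  have p20 : e%:P ^+ 2 * p ^+ 2 != 0.
    by rewrite mulf_neq0 ?expf_neq0 ?polyC_eq0 // monic_neq0.
  have cE : c%:P = (c / e ^+ 2)%:P * e%:P ^+ 2 :> R.
    by rewrite -rmorphXn -rmorphM mulfVK // expf_neq0.
  apply: (mulfI p20); move: dG; rewrite GE !det_mulmx det_tr dD big_cons cE => h.
  transitivity (e%:P * p * \det G1 * (e%:P * p)); first by ring.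
  by rewrite h; ring.
have [|r rT|D' [G2 [G2s G1E dD' G2u]]] := IH G1 _ G1s TI' uT _ dG1.
- by rewrite mulf_neq0 ?invr_eq0 ?expf_neq0.
- have rpT : r \in p :: T by rewrite inE rT orbT.
  have [y hy] := gl r rpT.
  have [rI rm] := TI' r rT.
  exists (y *m D); apply: (glued_transport rI _ G1s GE e0 dD hy).
  apply/negP => rp; move: pT; suff -> : p = r by rewrite rT.
  have [_ /(_ r)] := pI; case: (rI) => r1 _.
  move=> h; apply/eqP; rewrite -eqp_monic // eqp_sym; apply: h => //.
  by case: (size r) r1 => [|[]].
exists (D *m D'), G2; split=> //; last first.
  rewrite det_mulmx mulf_neq0 // dD mulf_neq0 ?polyC_eq0 // monic_neq0 //.
by rewrite GE G1E trmx_mul !mulmxA.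
Qed.
End Lattice.

(** * Isotropy of the first four coordinates of a hyperbolic six-dimensional form *)

Section SixDimensional.
Variable E : finFieldType.
Hypothesis oddE : odd #|E|.

Definition diag_form (S : comNzRingType) n (u x y : 'rV[S]_n) : S :=
  \sum_i u 0 i * x 0 i * y 0 i.

Lemma diag_formE (S : comNzRingType) n (u x y : 'rV[S]_n) :
  (x *m diag_mx u *m y^T) 0 0 = diag_form u x y.
Proof.
rewrite mxE; apply: eq_bigr => i _; rewrite !mxE (bigD1 i) //= big1.
  by rewrite !mxE eqxx mulr1n addr0 [x 0 i * _]mulrC.
by move=> j /negPf ji; rewrite !mxE ji mulr0n mulr0.
Qed.

(** A six-dimensional form over a finite field with the discriminant of three
    hyperbolic planes is hyperbolic. Ternary forms are isotropic: a hyperbolic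
    plane splits off [<v0, v1, v2>] and leaves [<f>], another one splits off
    [<f, v3, v4>] and leaves [<g>], and [<g, v5>] is a hyperbolic plane because of
    the discriminant. The rows are a zero of each of the three, each written in
    the orthogonal of the preceding ones. *)
Lemma lagrangian_six (u : 'rV[E]_6) r : (forall i, u 0 i != 0) ->
  \prod_i u 0 i = - r ^+ 2 ->
  exists W : 'M[E]_(3, 6), W *m diag_mx u *m W^T = 0 /\ row_free W.
Proof.
move=> u0 pu.
pose v k := u 0 (inord k).
have v0 k : v k != 0 by apply: u0.
have [a [b ab]] := @binary_universal E (v 0%N) (v 1%N) (- v 2%N) (v0 _) (v0 _).
(* up to squares, [<v0, v1, v2>] is the sum of a hyperbolic plane and [<f>] *)
pose f := - (v 0%N * v 1%N * v 2%N).
have f0 : f != 0 by rewrite oppr_eq0 !mulf_neq0.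
have [c [d cd]] := @binary_universal E f (v 3%N) (- v 4%N) f0 (v0 _).
pose g := v 0%N * v 1%N * v 2%N * v 3%N * v 4%N.
have g0 : g != 0 by rewrite !mulf_neq0.
have gv : g * v 5%N = - r ^+ 2.
  rewrite -pu !big_ord_recl big_ord0 mulr1 /g /v !mulrA.
  by do ![congr (_ * _)]; congr (u _ _); apply: val_inj; rewrite /= inordK.
pose s := r / g.
have sE : g * s ^+ 2 + v 5%N = 0.
  apply: (mulfI g0); rewrite mulr0 mulrDr gv /s.
  by field.
(* [(f1, f2)] spans the orthogonal of [(a, b)] in [<v0, v1>], with value [f] *)
pose f1 := - (b * v 1%N); pose f2 := a * v 0%N.
pose rows := [:: [:: a; b; 1; 0; 0; 0];
  [:: c * f1; c * f2; 0; d; 1; 0];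
  [:: - (s * d * v 3%N * f1); - (s * d * v 3%N * f2); 0; s * c * f; 0; 1]].
pose W : 'M[E]_(3, 6) := \matrix_(i, j) nth 0 (nth [::] rows i) j.
exists W; split.
  have WE i j : (W *m diag_mx u *m W^T) i j =
     \sum_(k < 6) v k * nth 0 (nth [::] rows i) k * nth 0 (nth [::] rows j) k.
    rewrite mxE; apply: eq_bigr => k _; rewrite mul_mx_diag !mxE.
    by rewrite /v inord_val [_ * u 0 k]mulrC.
  have e1 : v 0%N * a ^+ 2 = - v 2%N - v 1%N * b ^+ 2 by rewrite -ab addrK.
  have e2 : f * c ^+ 2 = - v 4%N - v 3%N * d ^+ 2 by rewrite -cd addrK.
  have e3 : v 5%N = - (g * s ^+ 2) by apply/eqP; rewrite -addr_eq0 addrC sE.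
  have ff : v 0%N * f1 ^+ 2 + v 1%N * f2 ^+ 2 = f.
    have -> : v 0%N * f1 ^+ 2 + v 1%N * f2 ^+ 2 =
      v 0%N * v 1%N * (v 0%N * a ^+ 2 + v 1%N * b ^+ 2) by rewrite /f1 /f2; ring.
    by rewrite ab /f; ring.
  have f12 : v 0%N * a * f1 + v 1%N * b * f2 = 0 by rewrite /f1 /f2; ring.
  have fg : f * v 3%N * - v 4%N = g by rewrite /f /g; ring.
  have S6 (h : nat -> E) : \sum_(k < 6) h k = h 0%N + h 1%N + h 2%N + h 3%N + h 4%N + h 5%N.
    by rewrite !big_ord_recl big_ord0 addr0 !addrA.
  apply/matrixP => i j; rewrite WE [RHS]mxE (S6 (fun k => v k * nth 0 (nth [::] rows i) k * nth 0 (nth [::] rows j) k)).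
  case: i => [[|[|[|//]]] hi]; case: j => [[|[|[|//]]] hj] /=.
  - by rewrite !mulr0 !addr0 !mulr1 -!mulrA -!expr2 ab addNr.
  - rewrite !mulr0 !mul0r !addr0; transitivity (c * (v 0%N * a * f1 + v 1%N * b * f2)); first ring.
    by rewrite f12 mulr0.
  - rewrite !mulr0 !mul0r !addr0.
    transitivity (- (s * d * v 3%N) * (v 0%N * a * f1 + v 1%N * b * f2)); first ring.
    by rewrite f12 mulr0.
  - rewrite !mulr0 !mul0r !addr0; transitivity (c * (v 0%N * a * f1 + v 1%N * b * f2)); first ring.
    by rewrite f12 mulr0.
  - transitivity (c ^+ 2 * (v 0%N * f1 ^+ 2 + v 1%N * f2 ^+ 2) + v 3%N * d ^+ 2 + v 4%N); first ring.
    by rewrite ff mulrC cd addNr.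
  - transitivity (- (s * d * c * v 3%N) * (v 0%N * f1 ^+ 2 + v 1%N * f2 ^+ 2) + v 3%N * d * s * c * f); first ring.
    by rewrite ff; ring.
  - rewrite !mulr0 !mul0r !addr0.
    transitivity (- (s * d * v 3%N) * (v 0%N * a * f1 + v 1%N * b * f2)); first ring.
    by rewrite f12 mulr0.
  - transitivity (- (s * d * c * v 3%N) * (v 0%N * f1 ^+ 2 + v 1%N * f2 ^+ 2) + v 3%N * d * s * c * f); first ring.
    by rewrite ff; ring.
  - transitivity ((s * d * v 3%N) ^+ 2 * (v 0%N * f1 ^+ 2 + v 1%N * f2 ^+ 2) + v 3%N * (s * c * f) ^+ 2 + v 5%N); first ring.
    rewrite ff; transitivity (s ^+ 2 * f * v 3%N * (f * c ^+ 2 + v 3%N * d ^+ 2) + v 5%N); first ring.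
    by rewrite cd -sE -fg; ring.
apply/row_freeP; exists (\matrix_(j < 6, i < 3) (j == inord (nth 0%N [:: 2; 4; 5]%N i))%:R).
apply/matrixP => i j; rewrite mxE (bigD1 (inord (nth 0%N [:: 2; 4; 5]%N j))) //= big1 => [|k kj].
  rewrite !mxE eqxx mulr1 addr0.
  by case: i => [[|[|[|//]]] hi]; case: j => [[|[|[|//]]] hj] /=; rewrite inordK.
by rewrite !mxE (negPf kj) mulr0.
Qed.

Local Notation R := {poly E}.
Local Notation K := {fraction {poly E}}.
Local Notation tof := (@tofrac R).

(** Comparing leading coefficients brings the discriminant down to the
    constants. *)
Lemma prod_square_const (u : 'rV[E]_6) (d t : R) : d != 0 -> t != 0 ->
  - t ^+ 2 = d ^+ 2 * (\prod_i u 0 i)%:P ->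
  (forall i, u 0 i != 0) /\ \prod_i u 0 i = - (lead_coef t / lead_coef d) ^+ 2.
Proof.
move=> d0 t0 e; have := congr1 lead_coef e.
rewrite lead_coefN lead_coef_exp lead_coefM lead_coef_exp lead_coefC => e1.
have ld : lead_coef d != 0 by rewrite lead_coef_eq0.
have lt : lead_coef t != 0 by rewrite lead_coef_eq0.
have pu : \prod_i u 0 i = - (lead_coef t / lead_coef d) ^+ 2.
  apply: (mulfI (expf_neq0 2 ld)); rewrite -e1; by field.
split=> // i; apply: contra_eq_neq pu => ui.
by rewrite (bigD1 i) //= ui mul0r eq_sym oppr_eq0 expf_neq0 // mulf_neq0 ?invr_eq0.
Qed.

Lemma qf_map n (G : 'M[R]_n) (D H : 'M[R]_n) (x : 'rV[K]_n) :
  G = D *m H *m D^T ->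
  qf (map_mx tof G) x = qf (map_mx tof H) (x *m map_mx tof D).
Proof. by move=> ->; rewrite qf_mul !map_mxM map_trmx. Qed.

(** Gluing at all primes of [T] gives a unimodular lattice, which [harder] makes
    constant; over the finite field of constants it has a totally isotropic
    subspace of dimension 3. Over the fraction field, the two conditions
    [x_4 = x_5 = 0] still leave a nonzero vector in that subspace. *)
Lemma lattice_isotropic (b : 'rV[R]_6) (T : seq R) (k : E) (t : R) :
  {in T, forall p, irreducible_poly p /\ p \is monic} -> uniq T -> k != 0 -> t != 0 ->
  \prod_i b 0 i = k%:P * \prod_(p <- T) p ^+ 2 -> \prod_i b 0 i = - t ^+ 2 ->
  {in T, forall p, exists x, locally_glued p (diag_mx b) x} ->
  exists x : 'rV[K]_6, [/\ x != 0, x 0 (inord 4) = 0, x 0 (inord 5) = 0 &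
    \sum_i tof (b 0 i) * x 0 i ^+ 2 = 0].
Proof.
move=> TI uT k0 t0 bT bt gl.
have Gs : symm (diag_mx b) by rewrite /symm tr_diag_mx.
have dG : \det (diag_mx b) = k%:P * \prod_(p <- T) p ^+ 2 by rewrite det_diag.
have [D [G' [G's GE D0 G'u]]] := glue Gs TI uT k0 dG gl.
have [P [u [Pu PE]]] := harder (two_neq0 oddE) G's G'u.
pose D1 := D *m invmx P.
have GE1 : diag_mx b = D1 *m diag_mx (map_mx polyC u) *m D1^T.
  rewrite -PE /D1 trmx_mul !mulmxA mulmxKV // -[_ *m P^T *m _]mulmxA -trmx_mul mulVmx //.
  by rewrite trmx1 mulmx1.
have D10 : \det D1 != 0.
  have Pi : invmx P \in unitmx by rewrite unitmx_inv.
  by have [e e0 eE] := unit_det Pi; rewrite det_mulmx eE mulf_neq0 // polyC_eq0.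
move: D1 GE1 D10 => D1 GE1 D10.
have [u0 pu] : (forall i, u 0 i != 0) /\ \prod_i u 0 i = - (lead_coef t / lead_coef (\det D1)) ^+ 2.
  apply: prod_square_const => //; rewrite -bt -det_diag GE1 !det_mulmx det_tr det_diag.
  rewrite rmorph_prod (eq_bigr (fun i => (u 0 i)%:P)) => [|i _]; last by rewrite mxE.
  by rewrite expr2 mulrAC.
have [W [W0 /row_freeP[B WB]]] := lagrangian_six u0 pu.
have map2 m n (A : 'M[E]_(m, n)) : map_mx tof (map_mx polyC A) = map_mx (tof \o polyC) A.
  by apply/matrixP => i j; rewrite !mxE.
pose DK := map_mx tof D1; pose WK : 'M[K]_(3, 6) := map_mx (tof \o polyC) W.
have DKu : DK \in unitmx by rewrite unitmxE det_map_mx unitfE tofrac_eq0.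
pose N := WK *m invmx DK.
pose c45 (j : 'I_2) : 'I_6 := inord (4 + j).
have [z z0 zN] : exists2 z : 'rV[K]_3, z != 0 & z *m colsub c45 N = 0.
  have : kermx (colsub c45 N) != 0.
    rewrite -mxrank_eq0 mxrank_ker -lt0n subn_gt0.
    by apply: leq_ltn_trans (rank_leq_col _) _.
  case/rowV0Pn => z /sub_kermxP zk z0; by exists z.
pose x := z *m N; exists x.
have xc j : x 0 (c45 j) = 0.
  have zj := congr1 (fun A : 'rV_2 => A 0 j) zN; rewrite [RHS]mxE in zj.
  rewrite -[RHS]zj /x [LHS]mxE [RHS]mxE; apply: eq_bigr => l _.
  by rewrite [X in _ = _ * X]mxE.
split.
- apply: contra z0 => /eqP x0; have zW : z *m WK = 0.
    by rewrite -[WK](mulmxKV DKu) mulmxA -/N -/x x0 mul0mx.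
  by rewrite -[z]mulmx1 -(map_mx1 (tof \o polyC)) -WB map_mxM mulmxA -/WK zW mul0mx.
- by have := xc 0; rewrite /c45 addn0.
- by have := xc 1; rewrite /c45.
transitivity (qf (map_mx tof (diag_mx b)) x).
  rewrite map_diag_mx /qf diag_formE; apply: eq_bigr => i _.
  have -> : map_mx tof b 0 i = tof (b 0 i) by rewrite mxE.
  by rewrite expr2 mulrA.
have xD : x *m DK = z *m WK by rewrite /x /N mulmxA mulmxKV.
rewrite (qf_map _ GE1) -/DK xD qf_mul.
rewrite map_diag_mx /=.
have -> : WK *m diag_mx (map_mx tof (map_mx polyC u)) *m WK^T = 0.
  by rewrite /WK map2 -map_diag_mx map_trmx -!map_mxM W0 map_mx0.
by rewrite /qf mulmx0 mul0mx mxE.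
Qed.
End SixDimensional.

(** * The p-adic valuations and the degree valuation of E(X) *)

Lemma mulr_cancel_div (F : fieldType) (a b c : F) : c != 0 -> a / b = a * c / (b * c).
Proof. by move=> c0; rewrite invfM mulrACA divff // mulr1. Qed.

Section FractionValuation.
Local Open Scope quotient_scope.
Variable R : idomainType.
Local Notation K := {fraction R}.
Local Notation tof := (@tofrac R).

Lemma fraction_repr (z : K) : exists n d, d != 0 /\ z = tof n / tof d.
Proof.
elim/quotW: z => r; have d0 := denom_ratioP r.
exists \n_r, \d_r; split=> //; apply: (canRL (mulfK _)); first by rewrite tofrac_eq0.
rewrite !piE; apply/eqmodP; rewrite /= FracField.equivfE /FracField.mulf.
by rewrite !numden_Ratio ?mulr1 ?oner_neq0 // mulrC.
Qed.

Variable w : R -> int.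
Hypothesis wM : forall x y, x != 0 -> y != 0 -> w (x * y) = w x + w y.
Hypothesis wD : forall x y, x != 0 -> y != 0 -> x + y != 0 ->
  Num.min (w x) (w y) <= w (x + y).
Hypothesis w1 : exists x y, [/\ x != 0, y != 0 & w x - w y = 1].

Definition fval (z : K) : int :=
  let nd := cid (fraction_repr z) in w (sval nd) - w (sval (cid (svalP nd))).

Lemma fvalE n d : n != 0 -> d != 0 -> fval (tof n / tof d) = w n - w d.
Proof.
move=> n0 d0; rewrite /fval; case: cid => n' /= hn'; case: cid => d' /= [d'0 e].
have : n * d' = n' * d.
  by apply/eqP; rewrite -tofrac_eq !tofracM -eqr_div ?tofrac_eq0 // e.
move=> h; have n'0 : n' != 0.
  by apply: contraNneq n0 => n'0; move: h => /eqP; rewrite n'0 mul0r mulf_eq0 (negPf d'0) orbF.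
have := congr1 w h; rewrite !wM // => h2.
by apply/eqP; rewrite subr_eq addrAC eq_sym subr_eq h2.
Qed.

Lemma fraction_repr0 (z : K) : z != 0 -> exists n d, [/\ n != 0, d != 0 & z = tof n / tof d].
Proof.
have [n [d [d0 ->]]] := fraction_repr z => z0; exists n, d; split=> //.
by apply: contraNneq z0 => ->; rewrite tofrac0 mul0r.
Qed.

Lemma common_denom (x y : K) : exists n m d, [/\ d != 0, x = tof n / tof d & y = tof m / tof d].
Proof.
have [n [d [d0 ->]]] := fraction_repr x; have [m [e [e0 ->]]] := fraction_repr y.
exists (n * e), (m * d), (d * e); rewrite mulf_neq0 // !tofracM.
split=> //; first by rewrite (@mulr_cancel_div _ _ _ (tof e)) // tofrac_eq0.
by rewrite [tof d * _]mulrC (@mulr_cancel_div _ (tof m) _ (tof d)) // tofrac_eq0.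
Qed.

Lemma fvalM x y : x != 0 -> y != 0 -> fval (x * y) = fval x + fval y.
Proof.
move=> /fraction_repr0[n [d [n0 d0 ->]]] /fraction_repr0[m [e [m0 e0 ->]]].
rewrite mulrACA -invfM -!tofracM (fvalE (mulf_neq0 n0 m0) (mulf_neq0 d0 e0)).
by rewrite (fvalE n0 d0) (fvalE m0 e0) !wM // opprD addrACA.
Qed.

Lemma fvalD x y : x != 0 -> y != 0 -> x + y != 0 ->
  Num.min (fval x) (fval y) <= fval (x + y).
Proof.
have [n [m [d [d0 -> ->]]]] := common_denom x y.
have d1 : tof d != 0 by rewrite tofrac_eq0.
rewrite -mulrDl -tofracD !mulf_eq0 !invr_eq0 !tofrac_eq0 (negPf d0) !orbF => n0 m0 nm0.
by rewrite !fvalE // -addr_minl lerD2r wD.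
Qed.

Lemma fval_surj (n : int) : exists2 x, x != 0 & fval x = n.
Proof.
have [x [y [x0 y0 xy]]] := w1; have x1 : tof x != 0 by rewrite tofrac_eq0.
have y1 : tof y != 0 by rewrite tofrac_eq0.
pose t := tof x / tof y; have t0 : t != 0 by rewrite mulf_neq0 ?invr_eq0.
have vt : fval t = 1 by rewrite fvalE.
have v1 : fval 1 = 0.
  by have := fvalM t0 (oner_neq0 K); rewrite mulr1 vt => /eqP; rewrite addrC -subr_eq subrr eq_sym => /eqP.
have vX k : fval (t ^+ k) = k%:Z.
  elim: k => [|k IH]; first by rewrite expr0 v1.
  by rewrite exprS fvalM ?expf_neq0 // vt IH -intS.
case: n => k; first by exists (t ^+ k); rewrite ?expf_neq0 ?vX.
exists (t ^+ k.+1)^-1; first by rewrite invr_eq0 expf_neq0.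
have tk : t ^+ k.+1 != 0 by rewrite expf_neq0.
have ti : (t ^+ k.+1)^-1 != 0 by rewrite invr_eq0.
apply: (addrI (fval (t ^+ k.+1))); rewrite -fvalM // divff // v1 vX.
by rewrite NegzE subrr.
Qed.

Definition frac_valuation : discrete_valuation K :=
  DiscreteValuation fvalM fvalD fval_surj.

Lemma frac_valuationE n d : n != 0 -> d != 0 -> frac_valuation (tof n / tof d) = w n - w d.
Proof. exact: fvalE. Qed.

Lemma frac_valuation_tofrac n : n != 0 -> frac_valuation (tof n) = w n.
Proof.
move=> n0; have := @frac_valuationE n 1 n0 (oner_neq0 _).
rewrite tofrac1 divr1 => ->; have := wM (oner_neq0 R) (oner_neq0 R).
by rewrite mulr1 => /eqP; rewrite -subr_eq subrr => /eqP <-; rewrite subr0.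
Qed.
End FractionValuation.

Section PolyValuations.
Variable E : fieldType.
Local Notation R := {poly E}.
Local Notation K := {fraction {poly E}}.
Local Notation tof := (@tofrac R).

Section Padic.
Variable p : R.
Hypothesis pI : irreducible_poly p.

Let p1 : (1 < size p)%N. Proof. by case: pI. Qed.
Let p0 : p != 0. Proof. by rewrite -size_poly_gt0 ltnW. Qed.

Definition pval (f : R) : nat :=
  if pselect (f != 0) is left h then sval (cid (padic_split p1 h)) else 0%N.

Lemma pval_spec f : f != 0 -> exists2 g, f = p ^+ pval f * g & ~~ (p %| g).
Proof.
by move=> f0; rewrite /pval; case: pselect => // h; case: cid => k /= [g [fE ng]]; exists g.
Qed.

Lemma pval_unique f k g : f = p ^+ k * g -> ~~ (p %| g) -> pval f = k.
Proof.
move=> fE ng; have g0 : g != 0 by apply: contraNneq ng => ->; rewrite dvdp0.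
have f0 : f != 0 by rewrite fE mulf_neq0 ?expf_neq0.
have [g' fE' ng'] := pval_spec f0.
have key m n (a b : R) : p ^+ m * a = p ^+ n * b -> ~~ (p %| a) -> (n <= m)%N.
  move=> e na; rewrite leqNgt; apply/negP => mn; case/negP: na.
  have pm : p ^+ m != 0 by rewrite expf_neq0.
  move: e; rewrite -(subnKC mn) exprD exprSr -!mulrA => /(mulfI pm) ->.
  by rewrite dvdp_mulr.
have e : p ^+ k * g = p ^+ pval f * g' by rewrite -fE -fE'.
by apply/eqP; rewrite eqn_leq (key _ _ _ _ e ng) (key _ _ _ _ (esym e) ng').
Qed.

Lemma pval_ge f k : f != 0 -> (k <= pval f)%N = (p ^+ k %| f).
Proof.
move=> f0; have [g fE ng] := pval_spec f0; apply/idP/idP => [h|].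
  by rewrite fE -(subnKC h) exprD -mulrA dvdp_mulr.
move=> /dvdpP[y fE']; rewrite leqNgt; apply/negP => lt; case/negP: ng.
have pm : p ^+ pval f != 0 by rewrite expf_neq0.
have : p ^+ pval f * g = p ^+ pval f * (p * (p ^+ (k - (pval f).+1) * y)).
  by rewrite -fE {1}fE' -{1}(subnKC lt) exprD exprSr mulrC -!mulrA.
by move/(mulfI pm) ->; rewrite dvdp_mulr.
Qed.

Lemma pvalM x y : x != 0 -> y != 0 -> pval (x * y) = (pval x + pval y)%N.
Proof.
move=> x0 y0; have [g xE ng] := pval_spec x0; have [h yE nh] := pval_spec y0.
apply: (@pval_unique _ _ (g * h)); last by rewrite irr_dvdM // negb_or ng.
by rewrite {1}xE {1}yE exprD mulrACA.
Qed.

(** Constants are prime to [p], so the [p]-adic valuation is one of those of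
    [Omega]. *)
Lemma pval_val : exists v : discrete_valuation K, Omega v /\
  forall f, f != 0 -> v (tof f) = (pval f)%:Z.
Proof.
have wM x y : x != 0 -> y != 0 -> (pval (x * y))%:Z = (pval x)%:Z + (pval y)%:Z.
  by move=> x0 y0; rewrite pvalM.
have wD x y : x != 0 -> y != 0 -> x + y != 0 ->
    Num.min (pval x)%:Z (pval y)%:Z <= (pval (x + y))%:Z.
  move=> x0 y0 xy0; have [h|h] := leqP (pval x) (pval y).
    by rewrite min_l // lez_nat pval_ge // dvdp_add // -pval_ge.
  rewrite min_r; last by rewrite lez_nat ltnW.
  by rewrite lez_nat pval_ge // dvdp_add // -pval_ge // ltnW.
have w1 : exists x y, [/\ x != 0, y != 0 & (pval x)%:Z - (pval y)%:Z = 1].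
  have n1 : ~~ (p %| 1) by rewrite dvdp1 gtn_eqF.
  exists p, 1; split; rewrite ?oner_neq0 //.
  rewrite (@pval_unique p 1 1) ?expr1 ?mulr1 // (@pval_unique 1 0 1) ?expr0 ?mulr1 //.
exists (frac_valuation wM wD w1); split=> [c c0|f f0]; last exact: frac_valuation_tofrac.
rewrite frac_valuation_tofrac ?polyC_eq0 // (@pval_unique _ 0 c%:P) ?expr0 ?mul1r //.
apply/negP => /dvdp_leq; rewrite polyC_eq0 => /(_ c0); rewrite size_polyC c0.
by rewrite leqNgt p1.
Qed.
End Padic.

(** The place at infinity: minus the degree. *)
Lemma deg_val : exists v : discrete_valuation K, Omega v /\
  forall f, f != 0 -> v (tof f) = - ((size f).-1)%:Z.
Proof.
have wM (x y : R) : x != 0 -> y != 0 ->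
    - (size (x * y)).-1%:Z = - (size x).-1%:Z - (size y).-1%:Z.
  move=> x0 y0; rewrite size_mul // -opprD -PoszD; congr (- Posz _).
  by move: x0 y0; rewrite -!size_poly_gt0; case: (size x) (size y) => [//|a] [//|b]; rewrite addSn addnS.
have wD (x y : R) : x != 0 -> y != 0 -> x + y != 0 ->
    Num.min (- (size x).-1%:Z) (- (size y).-1%:Z) <= - (size (x + y)).-1%:Z.
  move=> x0 y0 xy0; have := size_polyD x y.
  rewrite ge_min !lerN2 !lez_nat.
  rewrite leq_max -!subn1 => /orP[h|h]; first by rewrite leq_sub2r.
  by apply/orP; right; rewrite leq_sub2r.
have w1 : exists x y : R, [/\ x != 0, y != 0 & - (size x).-1%:Z - - (size y).-1%:Z = 1].
  by exists 1, 'X; rewrite oner_neq0 polyX_eq0 size_poly1 size_polyX.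
exists (frac_valuation wM wD w1); split=> [c c0|f f0]; last exact: frac_valuation_tofrac.
by rewrite frac_valuation_tofrac ?polyC_eq0 // size_polyC c0.
Qed.
End PolyValuations.

(** * Diagonal forms over a discretely valued field *)

Section LocalForms.
Variables (F : fieldType) (v : discrete_valuation F).

(** Anisotropy over the completion, expressed in the field itself: a small value
    of the form forces small coordinates. This uniform version passes to Cauchy
    sequences. *)
Definition vaniso n (a : 'I_n -> F) := forall N, exists M, forall y : 'I_n -> F,
  dval_ge v M (\sum_i a i * y i ^+ 2) -> forall i, dval_ge v N (y i).

(** The binary form [<f, g>] is anisotropic over the completion, in the sharp
    sense that the two terms never cancel. *)
Definition noncancel (f g : F) := forall M x y,
  dval_ge v M (f * x ^+ 2 + g * y ^+ 2) ->
  dval_ge v M (f * x ^+ 2) && dval_ge v M (g * y ^+ 2).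

Lemma dval_geE M x : x != 0 -> dval_ge v M x = (M <= v x).
Proof. by rewrite /dval_ge => /negPf->. Qed.

Lemma dval_geB M x y : dval_ge v M x -> dval_ge v M y -> dval_ge v M (x - y).
Proof. by move=> hx hy; apply: dval_geD => //; rewrite dval_geN. Qed.

Lemma dval_term f x : f != 0 -> x != 0 -> v (f * x ^+ 2) = v f + 2 * v x.
Proof.
move=> f0 x0; rewrite expr2 !dvalM ?mulf_neq0 //.
by rewrite mulr_natl mulr2n.
Qed.

Lemma dval_term_ge f x N M : f != 0 -> v f + 2 * N <= M -> dval_ge v M (f * x ^+ 2) ->
  dval_ge v N x.
Proof.
move=> f0 NM; have [->|x0] := eqVneq x 0; first by rewrite dval_ge0.
rewrite !dval_geE ?mulf_neq0 ?expf_neq0 // dval_term // => /(le_trans NM).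
by rewrite lerD2l ler_pM2l.
Qed.

(** Without cancellation the value of a binary form is that of one of its two
    terms, so its parity is that of the coefficients. *)
Lemma noncancel_parity f g c x y : f != 0 -> g != 0 -> noncancel f g ->
  v g = v f + 2 * c -> f * x ^+ 2 + g * y ^+ 2 != 0 ->
  exists k, v (f * x ^+ 2 + g * y ^+ 2) = v f + 2 * k.
Proof.
move=> f0 g0 nc vg A0; set A := _ + _ in A0 *.
have [|hx hy] := andP (nc (v A) x y _); first by rewrite -/A dval_geE.
have [x0|x0] := eqVneq x 0.
  have y0 : y != 0 by apply: contraNneq A0 => y0; rewrite /A x0 y0 expr0n !mulr0 addr0.
  by exists (c + v y); rewrite /A x0 expr0n mulr0 add0r dval_term // vg; lia.
have [y0|y0] := eqVneq y 0.
  by exists (v x); rewrite /A y0 expr0n mulr0 addr0 dval_term.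
have nx : f * x ^+ 2 != 0 by rewrite mulf_neq0 ?expf_neq0.
have ny : g * y ^+ 2 != 0 by rewrite mulf_neq0 ?expf_neq0.
move: hx hy (dvalD v nx ny A0); rewrite !dval_geE // ge_min !dval_term // -/A.
move=> hx hy /orP[h|h]; [exists (v x)|exists (c + v y)]; first lia.
by move: hy h; rewrite vg; lia.
Qed.

Lemma dval_ge_addl M A B : (A != 0 -> B != 0 -> v A != v B) -> dval_ge v M (A + B) ->
  dval_ge v M A.
Proof.
move=> AB h; have [->|A0] := eqVneq A 0; first exact: dval_ge0.
have [B0|B0] := eqVneq B 0; first by move: h; rewrite B0 addr0.
have {}AB := AB A0 B0; have nB0 : - B != 0 by rewrite oppr_eq0.
rewrite dval_geE // leNgt; apply/negP => lt.
have [AB0|AB0] := eqVneq (A + B) 0.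
  by move: AB; rewrite (_ : A = - B) ?dvalN ?eqxx //; apply/eqP; rewrite -addr_eq0 AB0.
move: h; rewrite dval_geE // => h.
have [lt2|] := ltP (v A) (v B).
  have := dvalD v AB0 nB0; rewrite addrK => /(_ A0); rewrite ge_min dvalN => /orP[]; lia.
rewrite le_eqVlt eq_sym (negPf AB) /= => lt2.
have nA0 : - A != 0 by rewrite oppr_eq0.
have := dvalD v AB0 nA0; rewrite addrAC subrr add0r => /(_ B0); rewrite ge_min dvalN.
by move=> /orP[]; lia.
Qed.

Lemma four_terms f g h k c c1 c2 M x y z w :
  f != 0 -> g != 0 -> h != 0 -> k != 0 -> noncancel f g -> noncancel h k ->
  v g = v f + 2 * c -> v h = v f + 1 + 2 * c1 -> v k = v h + 2 * c2 ->
  dval_ge v M ((f * x ^+ 2 + g * y ^+ 2) + (h * z ^+ 2 + k * w ^+ 2)) ->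
  [/\ dval_ge v M (f * x ^+ 2), dval_ge v M (g * y ^+ 2),
      dval_ge v M (h * z ^+ 2) & dval_ge v M (k * w ^+ 2)].
Proof.
move=> f0 g0 h0 k0 nfg nhk vg vh vk.
set A := f * x ^+ 2 + g * y ^+ 2; set B := h * z ^+ 2 + k * w ^+ 2 => hAB.
have AB : A != 0 -> B != 0 -> v A != v B.
  move=> A0 B0; have [i Ei] := noncancel_parity f0 g0 nfg vg A0.
  have [j Ej] := noncancel_parity h0 k0 nhk vk B0.
  by rewrite /A /B Ei Ej vh; apply/eqP; lia.
have hA : dval_ge v M A by apply: dval_ge_addl AB hAB.
have hB : dval_ge v M B.
  by apply: (@dval_ge_addl _ _ A); rewrite 1?addrC // => B0 A0; rewrite eq_sym AB.
by have /andP[-> ->] := nfg _ _ _ hA; have /andP[-> ->] := nhk _ _ _ hB.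
Qed.

Lemma sum_I4 (S : nzRingType) (G : 'I_4 -> S) i j k l : uniq [:: i; j; k; l] ->
  \sum_x G x = G i + G j + (G k + G l).
Proof.
move=> us; have sub : {subset [:: i; j; k; l] <= index_enum 'I_4} by move=> x _; rewrite mem_index_enum.
have [|_ e] := uniq_min_size us sub.
  by rewrite /index_enum -enumT -cardE card_ord.
rewrite (perm_big [:: i; j; k; l]); last by apply: uniq_perm; rewrite ?index_enum_uniq // => x; rewrite e.
by rewrite !big_cons big_nil /= addr0 !addrA.
Qed.

(** Springer's criterion, in the direction used below: when two coefficients
    have even and two have odd valuation, up to a common shift, the values of the two binary halves
    have valuations of different parities and cannot cancel each other; so the
    form is anisotropic as soon as its halves are. *)
Lemma vaniso_four (a : 'I_4 -> F) i j k l c c1 c2 : uniq [:: i; j; k; l] ->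
  (forall x, a x != 0) -> noncancel (a i) (a j) -> noncancel (a k) (a l) ->
  v (a j) = v (a i) + 2 * c -> v (a k) = v (a i) + 1 + 2 * c1 ->
  v (a l) = v (a k) + 2 * c2 -> vaniso a.
Proof.
move=> us a0 nij nkl vj vk vl N.
pose m := `|v (a i)| + `|v (a j)| + `|v (a k)| + `|v (a l)|.
exists (m + 2 * N) => y; rewrite (sum_I4 _ us).
case/(four_terms (a0 i) (a0 j) (a0 k) (a0 l) nij nkl vj vk vl) => hi hj hk hl x.
have sub : {subset [:: i; j; k; l] <= index_enum 'I_4} by move=> z _; rewrite mem_index_enum.
have [|_ e] := uniq_min_size us sub.
  by rewrite /index_enum -enumT -cardE card_ord.
have : x \in [:: i; j; k; l] by rewrite e mem_index_enum.
rewrite !inE => /or4P[]/eqP->.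
- by apply: (dval_term_ge (a0 i)) hi; rewrite /m; lia.
- by apply: (dval_term_ge (a0 j)) hj; rewrite /m; lia.
- by apply: (dval_term_ge (a0 k)) hk; rewrite /m; lia.
- by apply: (dval_term_ge (a0 l)) hl; rewrite /m; lia.
Qed.

(** If a sum has larger valuation than one of its two terms, then both terms have
    the same valuation, exceeded by that of the sum. *)
Lemma cancel_of_not f g : f != 0 -> g != 0 -> ~ noncancel f g ->
  exists x y, [/\ x != 0, y != 0, v (f * x ^+ 2) = v (g * y ^+ 2) &
    dval_ge v (v (f * x ^+ 2) + 1) (f * x ^+ 2 + g * y ^+ 2)].
Proof.
have key f' g' x y M : dval_ge v M (f' * x ^+ 2 + g' * y ^+ 2) ->
   ~~ dval_ge v M (f' * x ^+ 2) ->
   [/\ x != 0, y != 0, v (f' * x ^+ 2) = v (g' * y ^+ 2) &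
    dval_ge v (v (f' * x ^+ 2) + 1) (f' * x ^+ 2 + g' * y ^+ 2)].
  move=> hs; rewrite {1}/dval_ge negb_or -ltNge => /andP[fx0 lt].
  set e := v (f' * x ^+ 2) in lt *.
  have hs1 : dval_ge v (e + 1) (f' * x ^+ 2 + g' * y ^+ 2).
    by apply: dval_geW hs; rewrite -lezD1 in lt.
  have ngy : ~~ dval_ge v (e + 1) (g' * y ^+ 2).
    apply/negP => hg; have := dval_geB hs1 hg; rewrite addrK dval_geE // -/e; lia.
  have gy : dval_ge v e (g' * y ^+ 2).
    rewrite -[g' * _](addKr (f' * x ^+ 2)) addrC; apply: dval_geB.
      by apply: dval_geW hs1; lia.
    by rewrite dval_geE.
  have gy0 : g' * y ^+ 2 != 0 by apply: contraNneq ngy => ->; apply: dval_ge0.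
  rewrite dval_geE // in ngy; rewrite dval_geE // in gy.
  split=> //; last by move: ngy gy; lia.
    by apply: contraNneq fx0 => ->; rewrite expr0n mulr0.
  by apply: contraNneq gy0 => ->; rewrite expr0n mulr0.
move=> f0 g0 /existsNP[M /existsNP[x /existsNP[y /not_implyP[hs /negP]]]].
rewrite negb_and => /orP[nf|ng]; first by exists x, y; apply: key hs nf.
have hs' : dval_ge v M (g * y ^+ 2 + f * x ^+ 2) by rewrite addrC.
have [y0 x0 e h] := key g f y x M hs' ng.
by exists x, y; split=> //; rewrite -e [f * _ + _]addrC.
Qed.
End LocalForms.

Lemma mul_sqr_div (F : fieldType) (c u d : F) : c * (u / d) ^+ 2 = c * u ^+ 2 * d^-1 ^+ 2.
Proof. by rewrite exprMn mulrA. Qed.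

Section LocalPolynomials.
Variable E : finFieldType.
Hypothesis oddE : odd #|E|.
Local Notation R := {poly E}.
Local Notation K := {fraction {poly E}}.
Local Notation tof := (@tofrac R).
Local Notation deg p := (size (p : R)).-1.

Lemma cancel_polys (v : discrete_valuation K) (a b : R) : a != 0 -> b != 0 ->
  ~ noncancel v (tof a) (tof b) ->
  exists n m : R, [/\ n != 0, m != 0, v (tof (a * n ^+ 2)) = v (tof (b * m ^+ 2)) &
    dval_ge v (v (tof (a * n ^+ 2)) + 1) (tof (a * n ^+ 2 + b * m ^+ 2))].
Proof.
move=> a0 b0; case/cancel_of_not; rewrite ?tofrac_eq0 // => x [y []].
have [n [m [d [d0 -> ->]]]] := common_denom x y.
rewrite !mulf_eq0 !invr_eq0 !tofrac_eq0 (negPf d0) !orbF => n0 m0.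
have d1 : tof d != 0 by rewrite tofrac_eq0.
have dd : (tof d)^-1 ^+ 2 != 0.
  apply: expf_neq0; rewrite invr_eq0; exact: d1.
have e (c u : R) : tof c * (tof u / tof d) ^+ 2 = tof (c * u ^+ 2) * (tof d)^-1 ^+ 2.
  by rewrite mul_sqr_div -tofracXn -tofracM.
have t0 (c u : R) : c != 0 -> u != 0 -> tof (c * u ^+ 2) != 0.
  by move=> c0 u0; rewrite tofrac_eq0 mulf_neq0 // expf_neq0.
rewrite !e -mulrDl -tofracD (dvalM v (t0 _ _ a0 n0) dd) (dvalM v (t0 _ _ b0 m0) dd) => /addIr h hs.
exists n, m; split=> //.
have := dval_geM hs (_ : dval_ge v (- v ((tof d)^-1 ^+ 2)) ((tof d)^-1 ^+ 2)^-1).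
rewrite mulfK // addrAC addrK; apply.
by rewrite dval_geE ?invr_eq0 // dvalV.
Qed.

(** For coefficients [a] and [b] of [p]-adic valuation [e], this says that the
    residue form of [<a, b>] is isotropic. *)
Definition cancels (p : R) (e : nat) (a b : R) := exists n m,
  [/\ ~~ (p %| n), ~~ (p %| m) & p ^+ e.+1 %| a * n ^+ 2 + b * m ^+ 2].

Lemma cancels_padic p (pI : irreducible_poly p) (v : discrete_valuation K) e (a b : R) :
  (forall f, f != 0 -> v (tof f) = (pval pI f)%:Z) -> a != 0 -> b != 0 ->
  pval pI a = e -> pval pI b = e -> ~ noncancel v (tof a) (tof b) -> cancels p e a b.
Proof.
move=> vE a0 b0 ae be /(cancel_polys a0 b0)[n [m [n0 m0]]].
have p0 : p != 0 by apply: irredp_neq0.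
rewrite !expr2 !vE ?mulf_neq0 // !pvalM ?mulf_neq0 // ae be => -[].
move=> /addnI h; have {h}nm : pval pI n = pval pI m by lia.
have [n' nE nn'] := pval_spec pI n0; have [m' mE nm'] := pval_spec pI m0.
set j := pval pI n in nm nE *; rewrite -nm in mE.
move=> hs; exists n', m'; split=> //.
have : p ^+ (j + j) * p ^+ e.+1 %| p ^+ (j + j) * (a * n' ^+ 2 + b * m' ^+ 2).
  have -> : p ^+ (j + j) * (a * n' ^+ 2 + b * m' ^+ 2) = a * (n * n) + b * (m * m).
    by rewrite {1 2}nE {1 2}mE exprD; move: (p ^+ j) => c; rewrite !expr2; ring.
  move: hs; have [->|s0] := eqVneq (a * (n * n) + b * (m * m)) 0; first by rewrite dvdp0.
  rewrite dval_geE ?tofrac_eq0 // vE // -PoszD lez_nat addn1 pval_ge //.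
  by rewrite -exprD addnS addnC.
by rewrite dvdp_mul2l // expf_neq0.
Qed.

(** Cancellation in degree kills the top coefficient, so that
    [lead_coef a * n0 ^ 2 + lead_coef b * m0 ^ 2 = 0] with [n0], [m0] nonzero
    constants. *)
Lemma cancels_infinity (v : discrete_valuation K) (a b : R) :
  (forall f, f != 0 -> v (tof f) = - (deg f)%:Z) -> a != 0 -> b != 0 ->
  ~ noncancel v (tof a) (tof b) -> qchar (- (lead_coef a * lead_coef b)) = 1.
Proof.
move=> vE a0 b0 /(cancel_polys a0 b0)[n [m [n0 m0]]].
have A0 : a * n ^+ 2 != 0 by rewrite mulf_neq0 ?expf_neq0.
have B0 : b * m ^+ 2 != 0 by rewrite mulf_neq0 ?expf_neq0.
rewrite !vE // => /oppr_inj[dAB] hs.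
have lA : lead_coef a * lead_coef n ^+ 2 + lead_coef b * lead_coef m ^+ 2 = 0.
  rewrite -!lead_coef_exp -!lead_coefM [in X in X + _]/lead_coef [in X in _ + X]/lead_coef -dAB -coefD.
  move: hs; have [->|s0] := eqVneq (a * n ^+ 2 + b * m ^+ 2) 0; first by rewrite coef0.
  rewrite dval_geE ?tofrac_eq0 // vE // => h; rewrite nth_default //.
  have : (0 < size (a * n ^+ 2 + b * m ^+ 2)%R)%N by rewrite size_poly_gt0.
  move: h; case: (size (a * n ^+ 2 + b * m ^+ 2)%R) => // s /=.
  by rewrite lezD1 ltrN2 ltz_nat.
have la : lead_coef a != 0 by rewrite lead_coef_eq0.
have lb : lead_coef b != 0 by rewrite lead_coef_eq0.
have ln : lead_coef n != 0 by rewrite lead_coef_eq0.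
have lm : lead_coef m != 0 by rewrite lead_coef_eq0.
rewrite /qchar oppr_eq0 mulf_eq0 (negPf la) (negPf lb) /=.
have -> : - (lead_coef a * lead_coef b) = (lead_coef a * lead_coef n / lead_coef m) ^+ 2.
  have -> : lead_coef b = - (lead_coef a * lead_coef n ^+ 2) / lead_coef m ^+ 2.
    by apply: (canRL (mulfK _)); rewrite ?expf_neq0 //; apply/eqP; rewrite -addr_eq0 addrC lA.
  by field.
by rewrite ifT //; apply/imsetP; exists (lead_coef a * lead_coef n / lead_coef m).
Qed.
End LocalPolynomials.

(** * Normal form of a locally isotropic diagonal form *)

Lemma scaled_square (F : fieldType) (b r y c : F) : c != 0 ->
  b * (r * y) ^+ 2 = c * b * r ^+ 2 * y ^+ 2 * c^-1.
Proof. by move=> c0; field. Qed.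

Lemma vaniso_similar (F : fieldType) (v : discrete_valuation F) n (z b r : 'I_n -> F) (c : F) :
  c != 0 -> (forall i, r i != 0) -> (forall i, z i = c * b i * r i ^+ 2) ->
  vaniso v b -> vaniso v z.
Proof.
move=> c0 r0 zE bv N; pose B := \sum_j `|v (r j)|.
have [M hM] := bv (N + B); exists (M + v c) => y hy.
have hb : dval_ge v M (\sum_i b i * (r i * y i) ^+ 2).
  have -> : \sum_i b i * (r i * y i) ^+ 2 = (\sum_i z i * y i ^+ 2) * c^-1.
    by rewrite big_distrl; apply: eq_bigr => i _ /=; rewrite zE (scaled_square _ _ _ c0).
  rewrite -[M](addrK (v c)); apply: dval_geM => //.
  by rewrite dval_geE ?invr_eq0 // dvalV.
move=> i; have := hM _ hb i; have [->|y0] := eqVneq (y i) 0; first by rewrite dval_ge0.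
rewrite !dval_geE ?mulf_neq0 // dvalM // => h.
have rB : v (r i) <= B.
  apply: le_trans (ler_norm _) _; rewrite /B (bigD1 i) //= lerDl.
  exact: sumr_ge0.
by rewrite -(lerD2l (v (r i))) (le_trans _ h) // addrC lerD2l.
Qed.

Section Normalization.
Variable E : finFieldType.
Hypothesis oddE : odd #|E|.
Local Notation R := {poly E}.
Local Notation K := {fraction {poly E}}.
Local Notation tof := (@tofrac R).

Lemma squarefree_repr (f : R) : f != 0 -> exists (l : E) (S : seq R) (g : R),
  [/\ l != 0, uniq S, {in S, forall p, mirr p}, g != 0 & f = l%:P * \prod_(p <- S) p * g ^+ 2].
Proof.
have [n] := ubnP (size f); elim: n f => // n IH f sf f0.
have [f1|f1] := leqP (size f) 1.
  exists f`_0, [::], 1; rewrite big_nil expr1n !mulr1 oner_neq0.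
  have fE := size1_polyC f1; split=> //.
  by apply: contraNneq f0 => c0; rewrite fE c0.
have [p [pI pm /dvdpP[h fE]]] := monic_irreducible_factor f1.
have h0 : h != 0 by apply: contraNneq f0 => h0; rewrite fE h0 mul0r.
have [|//|l [S [g [l0 uS SI g0 hE]]]] := IH h.
  apply: leq_trans (_ : size f <= n)%N; last by rewrite -ltnS.
  rewrite fE size_Mmonic //; have [p1 _] := pI; case: (size p) p1 => [|[|s]] // _.
  by rewrite !addnS /= ltnS leq_addr.
have [pS|pS] := boolP (p \in S).
  exists l, (rem p S), (p * g); split=> //.
  - exact: rem_uniq.
  - by move=> r /mem_rem/SI.
  - by rewrite mulf_neq0 // monic_neq0.
  rewrite fE hE (big_rem _ pS) /= exprMn; set P := \prod_(_ <- _) _; ring.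
exists l, (p :: S), g; split=> //=; first by rewrite pS.
  by move=> r; rewrite inE => /predU1P[->|/SI //]; split.
by rewrite fE hE big_cons; set P := \prod_(_ <- _) _; ring.
Qed.

(** The primes of all four squarefree coefficients are collected in one list. *)
Lemma common_repr (z : 'I_4 -> K) : (forall i, z i != 0) ->
  exists (T : seq R) (J : R -> {set 'I_4}) (l : 'I_4 -> E) (r : 'I_4 -> K),
  [/\ uniq T, {in T, forall p, mirr p}, forall i, l i != 0, forall i, r i != 0 &
    forall i, z i = tof (entry T J l i) * r i ^+ 2].
Proof.
move=> z0.
have /choice[F hF] i : exists t : E * seq R * K, [/\ t.1.1 != 0, uniq t.1.2,
    {in t.1.2, forall p, mirr p}, t.2 != 0 &
    z i = tof (t.1.1%:P * \prod_(p <- t.1.2) p) * t.2 ^+ 2].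
  have [n [d [n0 d0 zE]]] := fraction_repr0 (z0 i).
  have [l [S [g [l0 uS SI g0 fE]]]] := squarefree_repr (mulf_neq0 n0 d0).
  have d1 : tof d != 0 by rewrite tofrac_eq0.
  exists (l, S, tof g / tof d); apply: (And5 l0 uS SI).
    by apply: (mulf_neq0 (_ : tof g != 0)); [rewrite tofrac_eq0|rewrite invr_eq0].
  change (z i = tof (l%:P * \prod_(p <- S) p) * (tof g / tof d) ^+ 2).
  rewrite mul_sqr_div -tofracXn -tofracM -fE zE tofracM.
  by rewrite expr2 mulrA; congr (_ * _); rewrite mulfK.
pose S i := (F i).1.2.
pose T := undup (flatten [seq S i | i <- enum 'I_4]).
have inT i p : p \in S i -> p \in T.
  move=> pS; rewrite mem_undup; apply/flattenP; exists (S i) => //.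
  by apply: map_f; rewrite mem_enum.
exists T, (fun p => [set i | p \in S i]), (fun i => (F i).1.1), (fun i => (F i).2).
split; first exact: undup_uniq.
- move=> p; rewrite mem_undup => /flattenP[_ /mapP[i _ ->]] pS.
  by have [_ _ SI _ _] := hF i; apply: SI.
- by move=> i; have [] := hF i.
- by move=> i; have [] := hF i.
move=> i; have [_ uS _ _ {1}->] := hF i; congr (tof (_ * _) * _).
rewrite -[RHS]big_filter; apply: perm_big; apply: uniq_perm => // [|p].
  exact/filter_uniq/undup_uniq.
by rewrite mem_filter inE; apply/idP/andP => [pS|[]//]; split=> //; apply: inT pS.
Qed.

(** Multiplying the form by [p] and removing squares exchanges the coefficients
    divisible by [p] with those that are not. *)
Lemma toggle (T : seq R) (J : R -> {set 'I_4}) l (bad : pred R) i :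
  let J' p := if bad p then ~: J p else J p in
  \prod_(p <- T | bad p) p * entry T J l i =
  entry T J' l i * (\prod_(p <- T | bad p && (i \in J p)) p) ^+ 2.
Proof.
move=> J'; rewrite /entry mulrCA -mulrA; congr (_ * _).
rewrite -prodrXl big_mkcond [X in _ * X]big_mkcond [X in _ = X * _]big_mkcond.
rewrite [X in _ = _ * X]big_mkcond -!big_split /=; apply: eq_bigr => p _.
rewrite /J'; case: (bad p) => /=; rewrite ?inE; case: (i \in J p) => /=;
  by rewrite ?mulr1 ?mul1r ?expr2.
Qed.

Lemma pval_entry (T : seq R) (J : R -> {set 'I_4}) l i p (pI : irreducible_poly p) :
  uniq T -> {in T, forall p, mirr p} -> (forall i, l i != 0) -> p \in T ->
  pval pI (entry T J l i) = (i \in J p).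
Proof.
move=> uT TI l0 pT; have [ip|ip] := boolP (i \in J p).
  apply: (@pval_unique _ _ _ _ _ (cof T J l i p)); last exact: cof_ndvd.
  by rewrite expr1; apply: entryE.
apply: (@pval_unique _ _ _ _ _ (entry T J l i)); first by rewrite expr0 mul1r.
have pP := TI p pT.
rewrite /entry irr_dvdM // negb_or mirr_ndvd_const //=.
by apply: mirr_ndvd_prod => // r rT ir; apply: contraNneq ip => <-.
Qed.

Lemma entry_neq0 (T : seq R) (J : R -> {set 'I_4}) l i :
  {in T, forall p, mirr p} -> (forall i, l i != 0) -> entry T J l i != 0.
Proof.
move=> TI l0; rewrite mulf_neq0 ?polyC_eq0 // big_seq_cond.
elim/big_rec: _ => [|p y /andP[/TI[_ pm] _] y0]; first exact: oner_neq0.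
by rewrite mulf_neq0 // monic_neq0.
Qed.

Lemma compl_pair (J : {set 'I_4}) : #|J| = 2%N -> exists i j k l,
  [/\ J = [set i; j], ~: J = [set k; l] & uniq [:: i; j; k; l]].
Proof.
move=> cJ; have /cards2P[i [j [ij JE]]] : #|J| == 2%N by rewrite cJ.
have /cards2P[k [l [kl cE]]] : #|~: J| == 2%N.
  by rewrite -(eqn_add2l #|J|) cardsC card_ord cJ.
exists i, j, k, l; split=> //.
have dis x y : x \in J -> y \in ~: J -> x != y.
  by move=> xJ; rewrite inE; apply: contraNneq => <-.
have iJ : i \in J by rewrite JE set21. have jJ : j \in J by rewrite JE set22.
have kJ : k \in ~: J by rewrite cE set21. have lJ : l \in ~: J by rewrite cE set22.
by rewrite /= !inE !negb_or ij kl !dis.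
Qed.

(** If neither the pair of coefficients divisible by [p] nor the other pair
    cancels, the form is anisotropic at [p] by [vaniso_four]. *)
Lemma padic_pair (z : 'I_4 -> K) (T : seq R) (J : R -> {set 'I_4}) l (r : 'I_4 -> K) (c : K) p :
  (forall v, Omega v -> ~ vaniso v z) ->
  uniq T -> {in T, forall p, mirr p} -> (forall i, l i != 0) ->
  c != 0 -> (forall i, r i != 0) ->
  (forall i, z i = c * tof (entry T J l i) * r i ^+ 2) -> p \in T -> #|J p| = 2%N ->
  (exists i j, [/\ i != j, J p = [set i; j] & cancels p 1 (entry T J l i) (entry T J l j)]) \/
  (exists k m, [/\ k != m, ~: J p = [set k; m] & cancels p 0 (entry T J l k) (entry T J l m)]).
Proof.
move=> ziso uT TI l0 c0 r0 zE pT /compl_pair[i [j [k [m [JE cE us]]]]].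
have [pI _] := TI p pT; have [v [Ov vE]] := pval_val pI.
have e0 x := entry_neq0 J x TI l0.
have pv x := pval_entry J x pI uT TI l0 pT.
have val x : v (tof (entry T J l x)) = (x \in J p)%:Z by rewrite vE // pv.
have iJ : i \in J p by rewrite JE set21. have jJ : j \in J p by rewrite JE set22.
have kJ : k \notin J p by rewrite -in_setC cE set21.
have mJ : m \notin J p by rewrite -in_setC cE set22.
have [ij km] : i != j /\ k != m.
  by case/and4P: us; rewrite !inE !negb_or => /and3P[].
have [nij|nij] := pselect (noncancel v (tof (entry T J l i)) (tof (entry T J l j))); last first.
  left; exists i, j; apply: (And3 ij JE); apply: (cancels_padic oddE vE (e0 i) (e0 j) _ _ nij).
    by rewrite pv iJ.
  by rewrite pv jJ.
have [nkm|nkm] := pselect (noncancel v (tof (entry T J l k)) (tof (entry T J l m))); last first.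
  right; exists k, m; apply: (And3 km cE); apply: (cancels_padic oddE vE (e0 k) (e0 m) _ _ nkm).
    by rewrite pv (negPf kJ).
  by rewrite pv (negPf mJ).
exfalso; apply: (ziso v Ov); apply: (vaniso_similar c0 r0 zE).
have t0 x : tof (entry T J l x) != 0 by rewrite tofrac_eq0.
apply: (@vaniso_four _ _ _ i j k m 0 (-1) 0 us t0 nij nkm).
- by rewrite (val i) (val j) iJ jJ mulr0 addr0.
- by rewrite (val i) (val k) iJ (negPf kJ).
- by rewrite (val k) (val m) (negPf kJ) (negPf mJ) mulr0 addr0.
Qed.
End Normalization.

Lemma rescale_entry (F : fieldType) (lam e e' g r : F) : lam != 0 -> lam * e = e' * g ^+ 2 ->
  e * r ^+ 2 = lam^-1 * e' * (g * r) ^+ 2.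
Proof.
move=> l0 h; have -> : e = lam^-1 * (e' * g ^+ 2) by rewrite -h mulKf.
by field.
Qed.

Lemma scale_one (F : fieldType) (e r : F) : e * r ^+ 2 = 1 * e * r ^+ 2.
Proof. by rewrite mul1r. Qed.

Lemma tofrac_sqr (R : idomainType) (a b : R) :
  tofrac (a * b ^+ 2) = tofrac a * tofrac b ^+ 2.
Proof. by rewrite tofracM tofracXn. Qed.

Section Assembly.
Variable E : finFieldType.
Hypothesis oddE : odd #|E|.
Local Notation R := {poly E}.
Local Notation K := {fraction {poly E}}.
Local Notation tof := (@tofrac R).
Local Notation deg p := (size (p : R)).-1.

(** Cancellation is insensitive to the scaling of [toggle]; the exponent records
    whether [p] is among the primes of [lam]. *)
Lemma cancels_scale p e k (lam a b a' b' g h : R) : irreducible_poly p ->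
  lam * a = a' * g ^+ 2 -> lam * b = b' * h ^+ 2 -> ~~ (p %| g) -> ~~ (p %| h) ->
  p ^+ k %| lam -> cancels p e a b -> cancels p (k + e) a' b'.
Proof.
move=> pI ea eb pg ph pl [n [m [pn pm hs]]]; exists (g * n), (h * m).
rewrite !irr_dvdM // !negb_or pg ph pn pm; split=> //.
have -> : a' * (g * n) ^+ 2 + b' * (h * m) ^+ 2 = lam * (a * n ^+ 2 + b * m ^+ 2).
  by rewrite mulrDr !mulrA ea eb; ring.
by rewrite -addnS exprD dvdp_mul.
Qed.

Lemma prod_mirr_neq0 (T : seq R) (P : pred R) : {in T, forall p, mirr p} ->
  \prod_(p <- T | P p) p != 0.
Proof.
move=> TI; rewrite big_seq_cond.
elim/big_rec: _ => [|p y /andP[/TI[_ pm] _] y0]; first exact: oner_neq0.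
by rewrite mulf_neq0 // monic_neq0.
Qed.

(** The bad primes are those that divide more than two coefficients, and those
    that divide exactly two which do not cancel. At the latter the other two
    coefficients cancel, by local isotropy. Multiplying the form by all the bad
    primes exchanges the two halves there. *)
Lemma normalized_form (z : 'I_4 -> K) : (forall i, z i != 0) ->
  (forall v, Omega v -> ~ vaniso v z) ->
  exists (T : seq R) (J : R -> {set 'I_4}) (l : 'I_4 -> E) (c : K) (r : 'I_4 -> K),
  [/\ [/\ uniq T, {in T, forall p, mirr p},
          {in T, forall p, #|J p| = 1%N \/ #|J p| = 2%N} & forall i, l i != 0],
      [/\ c != 0, forall i, r i != 0 &
         forall i, z i = c * tof (entry T J l i) * r i ^+ 2] &
      {in T, forall p, #|J p| = 2%N -> exists i j,
         [/\ i != j, J p = [set i; j] & cancels p 1 (entry T J l i) (entry T J l j)]}].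
Proof.
move=> z0 ziso; have [T [J [l [r [uT TI l0 r0 zE]]]]] := common_repr z0.
pose good p := `[< exists i j, [/\ i != j, J p = [set i; j] &
  cancels p 1 (entry T J l i) (entry T J l j)] >].
pose bad p := (2 < #|J p|)%N || ((#|J p| == 2%N) && ~~ good p).
pose J' p := if bad p then ~: J p else J p.
(* a prime dividing all four coefficients disappears after the scaling *)
pose T' := [seq p <- T | J' p != set0].
pose lam := \prod_(p <- T | bad p) p.
pose g i := \prod_(p <- T | bad p && (i \in J p)) p.
have sub p : p \in T' -> p \in T by rewrite mem_filter => /andP[].
have eE i : entry T' J' l i = entry T J' l i.
  rewrite /entry /T' big_filter_cond; congr (_ * _); apply: eq_bigl => p.
  by case: (boolP (i \in J' p)) => ip; rewrite ?andbF // andbT; apply/set0Pn; exists i.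
have lamE i : lam * entry T J l i = entry T' J' l i * g i ^+ 2.
  by rewrite eE; apply: toggle.
have lam0 : lam != 0 by apply: prod_mirr_neq0.
have g0 i : g i != 0 by apply: prod_mirr_neq0.
have tlam0 : tof lam != 0 by rewrite tofrac_eq0.
have tg0 i : tof (g i) != 0 by rewrite tofrac_eq0.
exists T', J', l, (tof lam)^-1, (fun i => tof (g i) * r i); split.
- split=> //; first exact: filter_uniq.
    by move=> p /sub/TI.
  move=> p; rewrite mem_filter => /andP[J0 pT].
  have : (#|J' p| <= 2)%N.
    rewrite /J' /bad; case: ifP => [h|/negbT].
      have := cardsC (J p); rewrite card_ord => e.
      by case/orP: h => [h|/andP[/eqP h _]]; move: e h; lia.
    by rewrite negb_or -leqNgt => /andP[].
  by rewrite leq_eqVlt ltnS => /predU1P[->|]; [right|rewrite leq_eqVlt => /predU1P[->|]; [left|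
     rewrite ltnS leqn0 cards_eq0 (negPf J0)]].
- apply: And3 => [|i|i].
  + by rewrite invr_eq0.
  + exact: (mulf_neq0 (tg0 i) (r0 i)).
  rewrite zE; apply: (rescale_entry _ tlam0).
  exact: (etrans (esym (tofracM _ _)) (etrans (congr1 tof (lamE i)) (tofrac_sqr _ _))).
move=> p /[dup] pT' /sub pT; have [pI _] := TI p pT.
have ndg i (P : pred R) : (forall q, P q -> bad q && (i \in J q)) -> ~~ P p ->
    ~~ (p %| \prod_(q <- T | P q) q).
  move=> hP nP; apply: mirr_ndvd_prod => //; first exact: TI.
  by move=> q _ Pq; apply: contraNneq nP => <-.
rewrite {1 2}/J'; case: ifP => [bp|/negbT nb] J2.
  have cJ : #|J p| = 2%N.
    by have := cardsC (J p); rewrite J2 card_ord => /eqP; rewrite -[4%N]/(2 + 2)%N eqn_add2r => /eqP.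
  have zE1 i : z i = 1 * tof (entry T J l i) * r i ^+ 2 := etrans (zE i) (scale_one _ _).
  have [gp|[i [j [ij JE cc]]]] := padic_pair oddE ziso uT TI l0 (oner_neq0 K) r0 zE1 pT cJ.
    by move: bp; rewrite /bad cJ ltnn /= => /negP[]; apply/asboolP.
  exists i, j; split=> //; apply: (cancels_scale (k := 1) pI (lamE i) (lamE j)) cc.
  - apply: (ndg i) => //; rewrite negb_and orbC -in_setC JE set21 //.
  - by apply: (ndg j) => //; rewrite negb_and orbC -in_setC JE set22.
  by rewrite expr1 /lam big_mkcond (big_rem _ pT) /= bp dvdp_mulr.
have gp : good p by move: nb; rewrite /bad J2 eqxx ltnn /= negbK.
have [i [j [ij JE cc]]] := asboolW gp.
exists i, j; split=> //; apply: (cancels_scale (k := 0) pI (lamE i) (lamE j)) cc.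
- by apply: (ndg i) => //; rewrite (negPf nb).
- by apply: (ndg j) => //; rewrite (negPf nb).
by rewrite expr0 dvd1p.
Qed.

Section Normalized.
Variables (T : seq R) (J : R -> {set 'I_4}) (l : 'I_4 -> E).
Hypotheses (uT : uniq T) (TI : {in T, forall p, mirr p}).
Hypothesis (J12 : {in T, forall p, #|J p| = 1%N \/ #|J p| = 2%N}).
Hypothesis (l0 : forall i, l i != 0).
Local Notation a := (entry T J l).
Local Notation kappa := (qchar (-1 : E)).
Local Notation odds := [set i | odd (deg (a i))].

(** Dividing the congruence modulo [p ^ 2] by [p] leaves
    [cof i * n ^ 2 = - cof j * m ^ 2] modulo [p]. *)
Lemma residue_of_cancels p i j : p \in T -> i != j -> J p = [set i; j] ->
  cancels p 1 (a i) (a j) -> leg p (- \prod_(i in J p) cof T J l i p) = 1.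
Proof.
move=> pT ij JE [n [m [pn pm]]]; have pP := TI pT; have [pI _] := pP.
have iJ : i \in J p by rewrite JE set21. have jJ : j \in J p by rewrite JE set22.
have p0 : p != 0 by apply: irredp_neq0.
rewrite (entryE l uT pT iJ) (entryE l uT pT jJ) JE big_setU1 ?inE //= big_set1.
move: (cof_ndvd J TI l0 i pT) (cof_ndvd J TI l0 j pT).
move: (cof T J l i p) (cof T J l j p) => x y px py hs.
have hd : p %| x * n ^+ 2 - - (y * m ^+ 2).
  rewrite opprK -(dvdp_mul2l _ _ p0) -expr2.
  by move: hs; rewrite -!mulrA -mulrDr.
have leg2 w : ~~ (p %| w) -> leg p w ^+ 2 = 1.
  rewrite -leg_eq0; have := leg_sign p w; rewrite !inE.
  by case/or3P=> /eqP->.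
have := leg_cong hd; rewrite -mulN1r !(legM oddE pP) -!expr2 !leg2 // !mulr1 => e.
by rewrite -mulN1r !(legM oddE pP) mulrCA -e -expr2 leg2.
Qed.

Lemma deg_entry_disc_parity : ~~ odd (deg (disc T J l)) -> ~~ odd #|odds|.
Proof.
move=> dev; suff -> : odd #|odds| = odd (deg (disc T J l)) by [].
rewrite (deg_disc J TI l0).
have -> : odd #|odds| = odd (\sum_i deg (a i))%N.
  rewrite -sum1_card big_mkcond /=.
  elim/big_rec2: _ => // i x y _ e; rewrite !oddD e inE.
  by case: (odd (deg (a i))).
have -> : (\sum_i deg (a i) = \sum_(p <- T) #|J p| * deg p)%N.
  rewrite (eq_bigr (fun i => \sum_(p <- T | i \in J p) deg p)%N); last first.
    by move=> i _; rewrite (deg_entry J TI l0).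
  rewrite (exchange_big_dep xpredT) //=; apply: eq_bigr => p _.
  by rewrite sum_nat_const.
rewrite /oddT big_filter [X in _ = odd X]big_mkcond big_seq [in RHS]big_seq.
elim/big_rec2: _ => // p x y pT e; rewrite !oddD e oddM.
by case: (J12 pT) => -> //.
Qed.

(** With [disc] of even degree and the product of the [l i] a square, the
    coefficients of odd degree number 0, 2 or 4. Only 2 needs isotropy at
    infinity: one of the two binary halves cancels there, so its leading
    coefficients have opposite square classes, and then so do those of the
    other half, the product of all four being a square. *)
Lemma infinity_sign (z : 'I_4 -> K) (c : K) (r : 'I_4 -> K) :
  (forall v, Omega v -> ~ vaniso v z) -> c != 0 -> (forall i, r i != 0) ->
  (forall i, z i = c * tof (a i) * r i ^+ 2) ->
  ~~ odd (deg (disc T J l)) -> qchar (lall l) = 1 ->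
  kappa ^+ #|odds|./2 * \prod_(i in odds) qchar (l i) = 1.
Proof.
move=> ziso c0 r0 zE dev l1; have := deg_entry_disc_parity dev.
have qall : \prod_i qchar (l i) = 1.
  rewrite -l1 /lall; symmetry; apply: (big_morph (@qchar E)); first exact: (qcharM oddE).
  rewrite /qchar oner_eq0 ifT //; apply/imsetP; exists 1 => //; by rewrite expr1n.
have : (#|odds| <= 4)%N by apply: leq_trans (max_card _) _; rewrite card_ord.
case: (posnP #|odds|) => [c0' _ _|].
  by rewrite c0' (cards0_eq c0') big_set0 mulr1.
have [c2|] := eqVneq #|odds| 2%N; last first.
  have [c4|] := eqVneq #|odds| 4%N; last by case: #|odds| => [|[|[|[|[|?]]]]].
  move=> _ _ _ _; rewrite c4 kappa2 mul1r.
  have -> : odds = [set: 'I_4].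
    by apply/setP/subset_cardP; rewrite ?cardsT ?card_ord // subsetT.
  by rewrite -[RHS]qall; apply: eq_bigl => i; rewrite inE.
move=> _ _ _; rewrite c2 expr1.
have [i [j [k [m [OE CE us]]]]] := compl_pair c2.
have [v [Ov vE]] := deg_val E.
have e0 x : a x != 0 by apply: entry_neq0.
have t0 x : tof (a x) != 0 by rewrite tofrac_eq0.
have lc x : lead_coef (a x) = l x.
  rewrite /entry lead_coefM lead_coefC (_ : lead_coef _ = 1) ?mulr1 //.
  apply/eqP; rewrite -monicE big_seq_cond.
  elim/big_rec: _ => [|p y /andP[/TI[_ pm] _] ym]; first exact: monic1.
  by rewrite monicMl.
have par x y : odd (deg (a x)) = odd (deg (a y)) ->
    exists d, v (tof (a y)) = v (tof (a x)) + 2 * d.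
  rewrite !vE // => e.
  exists (((deg (a x))./2)%:Z - ((deg (a y))./2)%:Z).
  rewrite -{1}[deg (a x)]odd_double_half -{1}[deg (a y)]odd_double_half e.
  by rewrite -!mul2n; case: odd => /=; lia.
have oJ x : (x \in odds) = odd (deg (a x)) by rewrite inE.
have iO : odd (deg (a i)) by rewrite -oJ OE set21.
have jO : odd (deg (a j)) by rewrite -oJ OE set22.
have kO : ~~ odd (deg (a k)) by rewrite -oJ -in_setC CE set21.
have mO : ~~ odd (deg (a m)) by rewrite -oJ -in_setC CE set22.
have [ij km] : i != j /\ k != m by case/and4P: us; rewrite !inE !negb_or => /and3P[].
have qij : \prod_(x in odds) qchar (l x) = qchar (l i) * qchar (l j).
  by rewrite OE big_setU1 ?inE //= big_set1.
have qkm : \prod_(x in ~: odds) qchar (l x) = qchar (l k) * qchar (l m).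
  by rewrite CE big_setU1 ?inE //= big_set1.
have q4 : qchar (l i) * qchar (l j) * (qchar (l k) * qchar (l m)) = 1.
  rewrite -qij -qkm; apply: etrans qall; rewrite [RHS](bigID (mem odds)) /=.
  by congr (_ * _); apply: eq_bigl => x; rewrite !inE.
have qN x y : qchar (- (l x * l y)) = kappa * (qchar (l x) * qchar (l y)).
  by rewrite -[- (_ * _)]mulN1r !(qcharM oddE).
rewrite qij.
have [nij|nij] := pselect (noncancel v (tof (a i)) (tof (a j))); last first.
  by have := cancels_infinity vE (e0 i) (e0 j) nij; rewrite !lc qN.
have [nkm|nkm] := pselect (noncancel v (tof (a k)) (tof (a m))); last first.
  have := cancels_infinity vE (e0 k) (e0 m) nkm; rewrite !lc qN => h.
  have ss (s t : int) : s * t = 1 -> s ^+ 2 = 1 -> s = t.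
    by move=> st s2; rewrite -[t]mul1r -s2 expr2 -mulrA st mulr1.
  have k2 : kappa ^+ 2 = 1 := kappa2 E.
  have e1 := ss _ _ h k2.
  have e2 : qchar (l i) * qchar (l j) * kappa = 1 by rewrite e1 q4.
  by rewrite mulrC.
exfalso; apply: (ziso v Ov); apply: (vaniso_similar c0 r0 zE).
have [d1 hd1] : exists d, v (tof (a j)) = v (tof (a i)) + 2 * d by apply: par; rewrite iO jO.
have [d2 hd2] : exists d, v (tof (a m)) = v (tof (a k)) + 2 * d.
  by apply: par; rewrite (negPf kO) (negPf mO).
have [d3 hd3] : exists d, v (tof (a k)) = v (tof (a i)) + 1 + 2 * d.
  rewrite !vE //; exists (((deg (a i))./2)%:Z - ((deg (a k))./2)%:Z).
  rewrite -{1}[deg (a i)]odd_double_half -{1}[deg (a k)]odd_double_half iO (negPf kO) -!mul2n /=.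
  by lia.
exact: (@vaniso_four _ _ _ i j k m d1 d3 d2 us t0 nij nkm hd1 hd3 hd2).
Qed.
End Normalized.
End Assembly.

(** * The local-global principle for diagonal forms *)

Section Six.
Variable E : finFieldType.
Hypothesis oddE : odd #|E|.
Local Notation R := {poly E}.
Local Notation K := {fraction {poly E}}.
Local Notation tof := (@tofrac R).

(** Two coefficients that cancel modulo [p ^ 2] give a gluing vector supported on
    their two coordinates. *)
Lemma glued_pair p n (b : 'rV[R]_n) i j (x y : R) : i != j ->
  ~~ (p %| y) -> p %| b 0 i -> p %| b 0 j ->
  p ^+ 2 %| b 0 i * x ^+ 2 + b 0 j * y ^+ 2 ->
  exists w, locally_glued p (diag_mx b) w.
Proof.
move=> ij py pbi pbj pq; pose f h := if h == i then x else if h == j then y else 0.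
have fi : f i = x by rewrite /f eqxx.
have fj : f j = y by rewrite /f eq_sym (negPf ij) eqxx.
have f0 h : h != i -> h != j -> f h = 0 by rewrite /f => /negPf-> /negPf->.
have wE h : (\row_h f h) 0 h = f h by rewrite mxE.
exists (\row_h f h); split.
- by exists j; rewrite wE fj.
- move=> h; rewrite mul_mx_diag mxE wE.
  have [->|hi] := eqVneq h i; first by rewrite dvdp_mull.
  have [->|hj] := eqVneq h j; first by rewrite dvdp_mull.
  by rewrite f0 // mul0r dvdp0.
rewrite /qf diag_formE /diag_form (bigD1 i) //= (bigD1 j) /=; last by rewrite eq_sym.
rewrite big1 ?addr0 => [|h /andP[hi hj]]; last by rewrite wE f0 // mulr0.
by rewrite !wE fi fj -!mulrA -!expr2.
Qed.

Definition six (S : Type) (a : 'I_4 -> S) (u w : S) : 'rV[S]_(4 + 2) :=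
  row_mx (\row_i a i) (\row_(j < 2) if j == 0 then u else w).

Lemma six_l S (a : 'I_4 -> S) u w i : six a u w 0 (lshift 2 i) = a i.
Proof. by rewrite row_mxEl mxE. Qed.
Lemma six_u S (a : 'I_4 -> S) u w : six a u w 0 (rshift 4 0) = u.
Proof. by rewrite row_mxEr mxE. Qed.
Lemma six_w S (a : 'I_4 -> S) u w : six a u w 0 (rshift 4 1) = w.
Proof. by rewrite row_mxEr mxE. Qed.

Lemma prod_six (S : comNzRingType) (a : 'I_4 -> S) u w :
  \prod_i six a u w 0 i = \prod_i a i * (u * w).
Proof.
rewrite big_split_ord /=; congr (_ * _).
  by apply: eq_bigr => i _; rewrite six_l.
rewrite !big_ord_recl big_ord0 mulr1; congr (_ * _); first exact: six_u.
by rewrite (_ : lift _ _ = 1 :> 'I_2) ?six_w //; apply: val_inj.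
Qed.

Section Normalized.
Variables (T : seq R) (J : R -> {set 'I_4}) (l : 'I_4 -> E).
Hypotheses (uT : uniq T) (TI : {in T, forall p, mirr p}).
Hypothesis (J12 : {in T, forall p, #|J p| = 1%N \/ #|J p| = 2%N}).
Hypothesis (l0 : forall i, l i != 0).
Local Notation a := (entry T J l).
Local Notation d := (disc T J l).
Local Notation two := (\prod_(p <- T | #|J p| != 1%N) p).

Lemma prod_entry : \prod_i a i = d * two ^+ 2.
Proof.
rewrite /entry big_split /= /disc /lall rmorph_prod -mulrA; congr (_ * _).
rewrite (exchange_big_dep xpredT) //=.
rewrite /oddT big_filter -prodrXl [X in _ = X * _]big_mkcond [X in _ = _ * X]big_mkcond.
rewrite -big_split /= big_seq [RHS]big_seq.
apply: eq_bigr => p pT; rewrite prodr_const.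
by case: (J12 pT) => -> /=; rewrite ?expr1 ?mulr1 ?mul1r.
Qed.

(** The six-dimensional form [q + <- c, c * disc>] has discriminant minus a
    square. It is glued at the primes dividing two coefficients by their
    cancellation, at those of [oddT] by the residue condition on [c], linking
    the coefficient to [c * disc], and at the primes of [C] because [disc] is a
    square there, linking [- c] to [c * disc]. *)
Lemma isotropic_of_multiplier k (C : seq R) : k != 0 -> uniq C ->
  {in T, forall p, #|J p| = 2%N -> exists i j,
         [/\ i != j, J p = [set i; j] & cancels p 1 (a i) (a j)]} ->
  {in C, forall p, [/\ mirr p, p \notin T & leg p d = 1]} ->
  {in oddT T J, forall p, leg p (k%:P * \prod_(r <- C) r) = target T J l p} ->
  exists x : 'I_4 -> K, (exists i, x i != 0) /\ \sum_i tof (a i) * x i ^+ 2 = 0.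
Proof.
move=> k0 uC canc Cd legc; set c := k%:P * _ in legc.
pose b := six a (- c) (c * d).
have CI : {in C, forall p, mirr p} by move=> p /Cd[].
have c0 : c != 0 by rewrite mulf_neq0 ?polyC_eq0 // prod_mirr_neq0.
have la0 : lall l != 0 by apply/prodf_neq0 => i _.
have d0 : d != 0.
  rewrite mulf_neq0 ?polyC_eq0 //; apply: prod_mirr_neq0 => p.
  by rewrite mem_filter => /andP[_ /TI].
have two0 : two != 0 by apply: prod_mirr_neq0.
have pb : \prod_i b 0 i = - (c * d * two) ^+ 2.
  by rewrite prod_six prod_entry; set t := two; ring.
have pb2 : \prod_i b 0 i = (- (k * lall l) ^+ 2)%:P * \prod_(p <- T ++ C) p ^+ 2.
  rewrite pb big_cat /= !prodrXl /c /disc polyCN polyC_exp polyCM.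
  have -> : \prod_(p <- T) p = \prod_(p <- oddT T J) p * two.
    by rewrite big_filter (bigID (fun p : R => #|J p| == 1%N)).
  set t := two; set s := \prod_(p <- _) _; set u := \prod_(p <- _) _; ring.
have [||||p|x [x0 x4 x5 xq]] := lattice_isotropic oddE _ _ _ _ pb2 pb.
- by move=> p; rewrite mem_cat => /orP[/TI|/CI].
- rewrite cat_uniq uT uC andbT; apply/hasPn => p /Cd[_ + _]; exact.
- by rewrite oppr_eq0 expf_neq0 // mulf_neq0.
- exact: (mulf_neq0 (mulf_neq0 c0 d0) two0).
- rewrite mem_cat => /orP[pT|pC].
    have pP := TI pT; have [pI _] := pP.
    have p0 : p != 0 by apply: irredp_neq0.
    case: (J12 pT) => cJ; last first.
      have [i [j [ij JE [x [y [px py h]]]]]] := canc p pT cJ.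
      have iJ : i \in J p by rewrite JE set21. have jJ : j \in J p by rewrite JE set22.
      apply: (@glued_pair p (4 + 2) b (lshift 2 i) (lshift 2 j) x y); rewrite ?six_l //.
        by rewrite (entryE l uT pT iJ) dvdp_mulr.
      by rewrite (entryE l uT pT jJ) dvdp_mulr.
    have /cards1P[i JE] : #|J p| == 1%N by rewrite cJ.
    have iJ : i \in J p by rewrite JE set11.
    have pO : p \in oddT T J by rewrite mem_filter cJ.
    have := legc p pO; rewrite /target JE big_set1.
    have pf := cof_ndvd J TI l0 i pT; have pg := dcof_ndvd TI l0 pO.
    have aE := entryE l uT pT iJ; have dE := discE l uT pO.
    move: (cof T J l i p) (dcof T J l p) pf pg aE dE => f g pf pg aE dE lc.
    (* [f * y ^ 2 + c * g * f ^ 2 = f * (y ^ 2 + f * g * c)] *)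
    have [y hy] : exists y, p %| y ^+ 2 - (- (f * g) * c).
      apply: leg_eq1; rewrite (legM oddE pP) lc -expr2.
      have : leg p (- (f * g)) != 0.
        by rewrite leg_eq0 // dvdpNr irr_dvdM // negb_or pf.
      have := leg_sign p (- (f * g)); rewrite !inE.
      by case/or3P=> /eqP->.
    apply: (@glued_pair p (4 + 2) b (lshift 2 i) (rshift 4 1) y f); rewrite ?six_l ?six_w //.
    - by rewrite (@eq_lrshift 4 2).
    - by rewrite aE dvdp_mulr.
    - by rewrite dE mulrCA dvdp_mulr.
    rewrite aE dE.
    have -> : p * f * y ^+ 2 + c * (p * g) * f ^+ 2 = p * (f * (y ^+ 2 - (- (f * g) * c))).
      by ring.
    by rewrite expr2 dvdp_mul2l // dvdp_mull.
  have [pP pT /leg_eq1[y hy]] := Cd p pC.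
  have pc : p %| c by rewrite /c (big_rem _ pC) /= mulrCA dvdp_mulr.
  apply: (@glued_pair p (4 + 2) b (rshift 4 0) (rshift 4 1) y 1); rewrite ?six_u ?six_w //.
  - by rewrite dvdp1; case: pP => [[p1 _] _]; rewrite neq_ltn p1 orbT.
  - by rewrite dvdpNr.
  - by rewrite dvdp_mulr.
  have -> : - c * y ^+ 2 + c * d * 1 ^+ 2 = - (c * (y ^+ 2 - d)) by ring.
  by rewrite dvdpNr expr2 dvdp_mul.
pose w : 'rV[K]_(4 + 2) := x; exists (fun i => w 0 (lshift 2 i)).
have w45 j : w 0 (rshift 4 j) = 0.
  case: j => [[|[|//]] ?]; [rewrite -[RHS]x4|rewrite -[RHS]x5]; congr (w 0 _);
    by apply: val_inj; rewrite /= inordK.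
split.
  have /rV0Pn[i] : w != 0 by exact: x0.
   case: (split_ordP i) => j -> h; first by exists j.
  by rewrite w45 eqxx in h.
have {xq} : \sum_(i < 4 + 2) tof (b 0 i) * w 0 i ^+ 2 = 0 := xq.
 rewrite big_split_ord /=.
rewrite [X in _ + X]big1 ?addr0 => [h|j _]; last by rewrite w45 expr0n mulr0.
by apply: etrans h; apply: eq_bigr => i _; rewrite six_l.
Qed.
End Normalized.

Lemma sum_similar (F : fieldType) n (c : F) (z e r x : 'I_n -> F) :
  (forall i, r i != 0) -> (forall i, z i = c * e i * r i ^+ 2) ->
  \sum_i e i * x i ^+ 2 = 0 -> \sum_i z i * (x i / r i) ^+ 2 = 0.
Proof.
move=> r0 zE ex; apply: etrans (_ : c * \sum_i e i * x i ^+ 2 = 0); last by rewrite ex mulr0.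
by rewrite big_distrr; apply: eq_bigr => i _; rewrite zE /=; field.
Qed.

Lemma diagonal_local_global (z : 'I_4 -> K) : (forall i, z i != 0) ->
  (forall v, Omega v -> ~ vaniso v z) ->
  exists y : 'I_4 -> K, (exists i, y i != 0) /\ \sum_i z i * y i ^+ 2 = 0.
Proof.
move=> z0 ziso.
have [T [J [l [c [r [[uT TI J12 l0] [c0 r0 zE] canc]]]]]] := normalized_form oddE z0 ziso.
have resT : {in T, forall p, #|J p| = 2%N -> leg p (- \prod_(i in J p) cof T J l i p) = 1}.
  move=> p pT cJ; have [i [j [ij JE h]]] := canc p pT cJ.
  exact: (residue_of_cancels oddE uT TI l0 pT ij JE h).
have [k [C [k0 uC Cd legc]]] := multiplier_exists oddE TI uT J12 l0 resT
  (infinity_sign oddE uT TI J12 l0 ziso c0 r0 zE).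
have [x [[i xi] xq]] := isotropic_of_multiplier uT TI J12 l0 k0 uC canc Cd legc.
exists (fun i => x i / r i); split.
  by exists i; apply: (mulf_neq0 xi); rewrite invr_eq0; apply: r0.
exact: (sum_similar r0 zE xq).
Qed.
End Six.

(** * Diagonalisation, and anisotropy over a completion *)

Lemma sum_symmetric (S : comNzRingType) n (f : 'I_n -> 'I_n -> S) :
  (forall i j, f i j = f j i) ->
  \sum_i \sum_j f i j = \sum_i f i i + 2 * \sum_(i < n) \sum_(j < n | (i < j)%N) f i j.
Proof.
move=> fs.
have -> : \sum_i \sum_j f i j = \sum_(i < n) (f i i + \sum_(j < n | (i < j)%N) f i j +
    \sum_(j < n | (j < i)%N) f i j).
  apply: eq_bigr => i _; rewrite (bigD1 i) //= -addrA; congr (_ + _).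
  rewrite (bigID (fun j : 'I_n => (i < j)%N)) /=; congr (_ + _); apply: eq_bigl => j.
    by rewrite andb_idl // => ij; rewrite -val_eqE /= gtn_eqF.
  by rewrite -leqNgt ltn_neqAle -val_eqE.
rewrite !big_split /= -addrA; congr (_ + _); rewrite mulr_natl mulr2n; congr (_ + _).
rewrite (exchange_big_dep xpredT) //=; apply: eq_bigr => i _; exact: eq_bigr.
Qed.

Section QuadraticForm.
Variables (F : fieldType) (V : vectType F) (q : quadratic_form V).
Local Notation n := (\dim {:V}).
Local Notation e := (vbasis {:V}).

Definition gram : 'M[F]_n := \matrix_(i, j) polar q e`_i e`_j.

Lemma polarC u w : polar q u w = polar q w u.
Proof. by rewrite /polar [w + u]addrC; ring. Qed.

Lemma polar_sum m (c : 'I_m -> F) (f : 'I_m -> V) w :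
  polar q (\sum_i c i *: f i) w = \sum_i c i * polar q (f i) w.
Proof.
have L := qval_polar q w.
have p0 : polar q 0 w = 0 by have := L (-1) 0 0; rewrite /= scaler0 addr0 mulN1r addNr.
elim: m c f => [|m IH] c f; first by rewrite !big_ord0 p0.
rewrite !big_ord_recl addrC -IH addrC.
by have := L (c ord0) (f ord0) (\sum_i c (lift ord0 i) *: f (lift ord0 i)).
Qed.

Lemma polar_diag u : polar q u u = 2 * q u.
Proof. by rewrite /polar -mulr2n -scaler_nat qvalZ; ring. Qed.

Lemma gram_symm : symm gram.
Proof. by apply/matrixP => i j; rewrite !mxE polarC. Qed.

Lemma gram_form (x : 'rV[F]_n) : qf gram x = 2 * scalar_ext_val idfun q x.
Proof.
have -> : qf gram x = \sum_i \sum_j gram i j * (x 0 i * x 0 j).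
  rewrite /qf mxE exchange_big; apply: eq_bigr => j _ /=.
  rewrite mxE big_distrl; apply: eq_bigr => i _ /=.
  by rewrite [x^T _ _]mxE; ring.
rewrite sum_symmetric => [|i j].
  rewrite /scalar_ext_val mulrDr; congr (_ + _); last first.
    congr (_ * _); apply: eq_bigr => i _; apply: eq_bigr => j _.
    by rewrite [gram _ _]mxE.
  rewrite big_distrr; apply: eq_bigr => i _ /=.
  by rewrite [gram _ _]mxE polar_diag -mulrA expr2.
by rewrite [gram _ _]mxE [gram j i]mxE polarC [x 0 i * _]mulrC.
Qed.

Lemma gram_unit : regular q -> gram \in unitmx.
Proof.
move=> rq; rewrite -row_free_unit -kermx_eq0; apply/rowV0P => x /sub_kermxP xG.
pose u := \sum_i x 0 i *: e`_i.
have pu (j : 'I_n) : polar q u e`_j = 0.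
  have h := congr1 (fun A : 'rV_n => A 0 j) xG; rewrite /= mxE [RHS]mxE in h.
  by rewrite polar_sum; apply: etrans h; apply: eq_bigr => i _; rewrite [gram _ _]mxE.
have u0 : u = 0.
  apply: rq => w; rewrite (coord_vbasis (memvf w)) polarC polar_sum big1 // => j _.
  by rewrite polarC pu mulr0.
apply/rowP => i; rewrite [RHS]mxE.
have := coord_sum_free (fun i => x 0 i) i (basis_free (vbasisP {:V})).
by rewrite -/u u0 linear0 => <-.
Qed.

(** The Gram matrix is constant as a polynomial matrix, so [harder] applies to
    it; evaluating the resulting congruence at 0 diagonalises over the field. *)
Lemma diagonalization : (2 : F) != 0 -> regular q -> exists (P : 'M[F]_n) (z : 'I_n -> F),
  [/\ P \in unitmx, forall i, z i != 0 &
      forall x : 'rV_n, scalar_ext_val idfun q (x *m P) = \sum_i z i * x 0 i ^+ 2].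
Proof.
move=> two0 rq; have Gu := gram_unit rq.
have ev0 (A : 'M[F]_n) : map_mx (horner_eval 0) (map_mx polyC A) = A.
  by apply/matrixP => i j; rewrite !mxE /= /horner_eval hornerC.
have Ls : symm (map_mx polyC gram) by rewrite /symm map_trmx gram_symm.
have Lu : map_mx polyC gram \in unitmx by rewrite unitmxE det_map_mx rmorph_unit.
have [P [u [Pu PE]]] := harder two0 Ls Lu.
pose P0 := map_mx (horner_eval 0) P.
have P0u : P0 \in unitmx by rewrite unitmxE det_map_mx rmorph_unit.
have {}PE : P0 *m gram *m P0^T = diag_mx u.
  rewrite -{1}[gram]ev0 map_trmx -!map_mxM PE.
  by apply/matrixP => i j; rewrite !mxE /= /horner_eval hornerMn hornerC.
exists P0, (fun i => u 0 i / 2); split=> // [i|x].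
  have : \det (diag_mx u) != 0.
    rewrite -PE !det_mulmx det_tr -unitfE !unitrM -!unitmxE P0u Gu.
    by [].
  by rewrite det_diag => /prodf_neq0/(_ i isT) ui; rewrite mulf_neq0 ?invr_eq0.
apply: (mulfI two0); rewrite -gram_form big_distrr /=.
have -> : qf gram (x *m P0) = qf (diag_mx u) x.
  by rewrite -PE /qf trmx_mul !mulmxA.
rewrite /qf diag_formE; apply: eq_bigr => i _.
by field.
Qed.

End QuadraticForm.

Section Evaluation.
Variables (F : fieldType) (v : discrete_valuation F).

(** Taking the [m]-th term is a ring morphism; named in order to carry that
    structure. *)
Definition term (m : nat) (s : cauchy v) : F := s m.
Lemma termB m : zmod_morphism (term m). Proof. by []. Qed.
Lemma termM m : monoid_morphism (term m). Proof. by []. Qed.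
HB.instance Definition _ m :=
  GRing.isZmodMorphism.Build (cauchy v) F (term m) (termB m).
HB.instance Definition _ m :=
  GRing.isMonoidMorphism.Build (cauchy v) F (term m) (termM m).

Definition cst (x : F) : cauchy v := Cauchy (cst_cauchy v x).

Lemma completion_class_eq0 (s : cauchy v) : completion_class s = 0 <-> null_seq v s.
Proof.
have := completion_class_eq s 0; rewrite rmorph0 => h.
by split=> [/h|hs]; [|apply/h]; rewrite [_ - _]subr0.
Qed.

(** A zero of the form over the completion is the class of a sequence of vectors
    whose values tend to 0; by hypothesis the coordinates tend to 0 too, so the
    zero is trivial. *)
Lemma aniso_completion (V : vectType F) (q : quadratic_form V) :
  (forall N, exists M, forall x, dval_ge v M (scalar_ext_val idfun q x) ->
     forall i, dval_ge v N (x 0 i)) ->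
  anisotropic (scalar_ext (to_completion v) q).
Proof.
move=> H [x x0 qx].
have /choice[s sE] i : exists s : cauchy v, x 0 i = completion_class s.
  exact: completion_class_surj.
pose t : cauchy v := \sum_(i < \dim {:V}) cst (q (vbasis {:V})`_i) * s i ^+ 2 +
  \sum_(i < \dim {:V}) \sum_(j < \dim {:V} | (i < j)%N)
    cst (polar q (vbasis {:V})`_i (vbasis {:V})`_j) * (s i * s j).
have tE m : term m t = scalar_ext_val idfun q (\row_i s i m).
  rewrite /t rmorphD !rmorph_sum; congr (_ + _); apply: eq_bigr => i _.
    by rewrite rmorphM rmorphXn mxE.
  rewrite rmorph_sum; apply: eq_bigr => j _.
  by rewrite !rmorphM !mxE.
have : completion_class t = 0.
  rewrite -qx /= /t rmorphD !rmorph_sum; congr (_ + _); apply: eq_bigr => i _.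
    by rewrite sE rmorphM rmorphXn.
  rewrite rmorph_sum; apply: eq_bigr => j _.
  by rewrite !sE !rmorphM.
move/completion_class_eq0 => tn.
move/eqP: x0; apply; apply/rowP => i; rewrite sE mxE; apply/completion_class_eq0 => N.
have [M hM] := H N; have [k hk] := tn M; exists k => m km.
have := hM (\row_i s i m); rewrite -tE => /(_ (hk m km) i); by rewrite mxE.
Qed.

Lemma dval_ge_sum n N (f : 'I_n -> F) : (forall i, dval_ge v N (f i)) ->
  dval_ge v N (\sum_i f i).
Proof.
move=> h; elim/big_rec: _ => [|i y _ hy]; first exact: dval_ge0.
by apply: dval_geD.
Qed.

Lemma vaniso_completion (V : vectType F) (q : quadratic_form V)
    (P : 'M[F]_(\dim {:V})) (z : 'I_(\dim {:V}) -> F) :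
  P \in unitmx ->
  (forall x : 'rV_(\dim {:V}), scalar_ext_val idfun q (x *m P) = \sum_i z i * x 0 i ^+ 2) ->
  vaniso v z -> anisotropic (scalar_ext (to_completion v) q).
Proof.
move=> Pu qP vz; apply: aniso_completion => N.
pose B := - (\sum_i \sum_j `|v (P i j)|).
have hB i j : dval_ge v B (P i j).
  apply/orP; right; rewrite /B lerNl; apply: le_trans (_ : `|v (P i j)| <= _).
    by rewrite -normrN ler_norm.
  rewrite (bigD1 i) //= (bigD1 j) //= -addrA lerDl addr_ge0 ?sumr_ge0 // => k _.
  by rewrite sumr_ge0.
have [M hM] := vz (N - B); exists M => x hx i.
have xE : x = (x *m invmx P) *m P by rewrite mulmxKV.
rewrite {1}xE qP in hx; have hy := hM (fun i => (x *m invmx P) 0 i) hx.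
rewrite xE mxE; apply: dval_ge_sum => j; rewrite -(subrK B N).
exact: dval_geM.
Qed.
End Evaluation.

Lemma diagonal_local_global_dim (E : finFieldType) n
    (z : 'I_n -> {fraction {poly E}}) : odd #|E| -> n = 4%N -> (forall i, z i != 0) ->
  (forall v, Omega v -> ~ vaniso v z) ->
  exists y : 'I_n -> {fraction {poly E}}, (exists i, y i != 0) /\ \sum_i z i * y i ^+ 2 = 0.
Proof. by move=> oddE n4; subst n; apply: diagonal_local_global. Qed.

Lemma two_neq0_fraction (E : finFieldType) : odd #|E| -> (2 : {fraction {poly E}}) != 0.
Proof.
move=> oddE; rewrite -(rmorph_nat (@tofrac {poly E})) tofrac_eq0 -polyC_natr polyC_eq0.
exact: two_neq0.
Qed.

(** * The local-global principle *)

Theorem corollary6p3 (E : finFieldType) (hE : odd #|E|)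
    (V : vectType {fraction {poly E}}) (hV : \dim {:V} = 4%N)
    (q : quadratic_form V) (hreg : regular q) (haniso : anisotropic q) :
  exists2 v : discrete_valuation {fraction {poly E}},
    Omega v & anisotropic (scalar_ext (to_completion v) q).
Proof.
have [P [z [Pu z0 qP]]] := diagonalization (two_neq0_fraction hE) hreg.
have [[v [Ov vz]]|nv] := pselect (exists v, Omega v /\ vaniso v z).
  by exists v => //; apply: (vaniso_completion Pu qP vz).
exfalso.
have [|y [[i yi] yq]] := diagonal_local_global_dim hE hV z0.
  by move=> v Ov vz; apply: nv; exists v.
pose x : 'rV_(\dim {:V}) := \row_j y j.
pose u : V := \sum_j (x *m P) 0 j *: (vbasis {:V})`_j.
have uE j : coord (vbasis {:V}) j u = (x *m P) 0 j.
  exact: (coord_sum_free _ _ (basis_free (vbasisP {:V}))).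
have rE : \row_j coord (vbasis {:V}) j u = x *m P by apply/rowP => j; rewrite mxE; apply: uE.
apply: haniso; exists u.
  apply: contraNneq yi => u0.
  have xP : x *m P = 0.
    by rewrite -rE u0; apply/rowP => j; rewrite mxE linear0 mxE.
  have : x = 0 by rewrite -[x](mulmxK Pu) xP mul0mx.
  by move/(congr1 (fun A : 'rV_(\dim {:V}) => A 0 i)); rewrite !mxE => ->.
have := scalar_extE idfun q u; rewrite /= rE qP => <-.
by apply: etrans yq; apply: eq_bigr => j _; rewrite mxE.
Qed.
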